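(* For all $\tau$ in the upper half plane, with $U,V,U^*,V^*,g,g^\vee$ and the $5\times5$ matrix $S$ as defined in the context, $$V\left(-\frac{1}{2\tau}\right)=SU(\tau),\qquad U\left(-\frac{1}{2\tau}\right)=2SV(\tau),$$ and $$V^*\left(-\frac{1}{2\tau}\right)=SU^*(\tau),\qquad U^*\left(-\frac{1}{2\tau}\right)=2SV^*(\tau).$$ As a consequence, $$g^\vee\left(-\frac{1}{2\tau}\right)=2Sg(\tau),\qquad g\left(-\frac{1}{2\tau}\right)=Sg^\vee(\tau).$$
   Context: Let $\mathrm{Im}\,\tau>0$, $q=e^{2\pi i\tau}$, and $q^{r}=e^{2\pi i r\tau}$ for rational $r$. For $n\in\mathbb{Z}_{\ge 0}$, $(a;p)_n=\prod_{k=0}^{n-1}(1-ap^k)$. Define $$F(u,v,w;q^{1/2})=\sum_{i,j,k\ge 0}\frac{q^{\frac12 i^2+j^2+2k^2+ik+2jk}u^iv^jw^k}{(q;q)_i(q;q)_j(q^2;q^2)_k},\qquad G(u,v,w;q)=\sum_{i,j,k\ge 0}\frac{q^{i^2+2j^2+k^2+2ij+ik}u^iv^jw^k}{(q;q)_i(q^2;q^2)_j(q^2;q^2)_k},$$ and for $\sigma\in\{0,1\}$ let $F_\sigma(u,v,w;q^{1/2})$ and $G_\sigma(u,v,w;q)$ be the same sums restricted to $i\equiv\sigma\pmod 2$ (with $i,j,k\ge 0$). Define the vector-valued functions $$g(\tau)=\begin{pmatrix}q^{-5/88}F_0(1,1,1;q^{1/2})\\ q^{-1/88}F_1(1,1,q;q^{1/2})\\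 q^{7/88}\big(F_1(1,q,q;q^{1/2})+qF_1(q,q^2,q^3;q^{1/2})\big)\\ q^{19/88}F_0(1,q,q^2;q^{1/2})\\ q^{35/88}F_0(q,q,q^2;q^{1/2})\end{pmatrix},\qquad g^\vee(\tau)=\begin{pmatrix}q^{-7/88}G(1,1,1;q)\\ q^{25/88}\big(G(q,1,1;q)+G(q^3,q^2,q;q)\big)\\ q^{1/88}G(1,1,q;q)\\ q^{9/88}G(q,1,q;q)\\ q^{49/88}G(q^2,q^2,q;q)\end{pmatrix},$$ $$U(\tau)=\begin{pmatrix}q^{-5/88}F(1,1,1;q^{1/2})\\ q^{-1/88}F(1,1,q;q^{1/2})\\ q^{7/88}\big(F(1,q,q;q^{1/2})+qF(q,q^2,q^3;q^{1/2})\big)\\ q^{19/88}F(1,q,q^2;q^{1/2})\\ q^{35/88}F(q,q,q^2;q^{1/2})\end{pmatrix},\qquad V(\tau)=\begin{pmatrix}q^{-7/88}G_0(1,1,1;q)\\ q^{25/88}\big(G_0(q,1,1;q)+G_1(q^3,q^2,q;q)\big)\\ q^{1/88}G_1(1,1,q;q)\\ q^{9/88}G_1(q,1,q;q)\\ q^{49/88}G_1(q^2,q^2,q;q)\end{pmatrix},$$ and $$U^*(\tau)=2g(\tau)-U(\tau),\qquad V^*(\tau)=g^\vee(\tau)-V(\tau).$$ Finally $$S=\begin{pmatrix}\alpha_5&\alpha_4&\alpha_3&\alpha_2&\alpha_1\\ \alpha_4&\alpha_1&-\alpha_2&-\alpha_5&-\alpha_3\\ \alpha_3&-\alpha_2&-\alpha_4&\alpha_1&\alpha_5\\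 \alpha_2&-\alpha_5&\alpha_1&\alpha_3&-\alpha_4\\ \alpha_1&-\alpha_3&\alpha_5&-\alpha_4&\alpha_2\end{pmatrix},\qquad \alpha_k=\sqrt{\frac{2}{11}}\,\sin\frac{k\pi}{11}.$$ *)

(* Defs.v *)
From HB Require Import structures.
From mathcomp Require Import all_boot all_order all_algebra.
From mathcomp Require Import complex.
From mathcomp Require Import all_classical all_reals all_analysis.

Set Implicit Arguments.
Unset Strict Implicit.
Unset Printing Implicit Defensive.

Import Order.TTheory GRing.Theory Num.Theory.
Import numFieldNormedType.Exports.

Local Open Scope ring_scope.
Local Open Scope complex_scope.

(* The topology of R[i] is the one given by its own norm [`|z|]; it is what
   the infinite sums [\big[+%R/0]_(0 <= i <oo)] below refer to. *)
HB.instance Definition _ (R : realType) := NormedModule.copy R[i] (R[i])^o.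

Section Defs.
Variable R : realType.
Implicit Types (u v w p q a tau z : R[i]) (P : pred nat).

Definition cexp z : R[i] :=
  (expR (complex.Re z))%:C * (cos (complex.Im z) +i* sin (complex.Im z)).

Definition qpow tau (r : rat) : R[i] := cexp (2 * pi%:C * 'i * ratr r * tau).

Definition qpoch a p (n : nat) : R[i] := \prod_(0 <= k < n) (1 - a * p ^+ k).

(* The last argument p stands for q^(1/2), so q = p ^+ 2 and the exponent of
   p is twice that of q: i^2/2 + j^2 + 2k^2 + ik + 2jk.
   The outer index is restricted to P.  For `|p| < 1 and any u, v, w the
   family is absolutely summable, so the iterated sum is the triple sum. *)
Definition Fsum P u v w p : R[i] :=
  \big[+%R/0]_(0 <= i <oo | P i) \big[+%R/0]_(0 <= j <oo) \big[+%R/0]_(0 <= k <oo)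
    (p ^+ (i ^ 2 + 2 * j ^ 2 + 4 * k ^ 2 + 2 * i * k + 4 * j * k)%N
       * u ^+ i * v ^+ j * w ^+ k
     / (qpoch (p ^+ 2) (p ^+ 2) i * qpoch (p ^+ 2) (p ^+ 2) j
        * qpoch (p ^+ 4) (p ^+ 4) k)).

Definition Gsum P u v w q : R[i] :=
  \big[+%R/0]_(0 <= i <oo | P i) \big[+%R/0]_(0 <= j <oo) \big[+%R/0]_(0 <= k <oo)
    (q ^+ (i ^ 2 + 2 * j ^ 2 + k ^ 2 + 2 * i * j + i * k)%N
       * u ^+ i * v ^+ j * w ^+ k
     / (qpoch q q i * qpoch (q ^+ 2) (q ^+ 2) j * qpoch (q ^+ 2) (q ^+ 2) k)).

Definition F := Fsum predT.
Definition G := Gsum predT.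
Definition Fpar (sigma : nat) := Fsum (fun i => i == sigma %[mod 2]).
Definition Gpar (sigma : nat) := Gsum (fun i => i == sigma %[mod 2]).

Definition gvec tau : 'cV[R[i]]_5 :=
  let q := qpow tau 1 in
  let F0 u v w := Fpar 0 u v w (qpow tau (1 / 2)) in
  let F1 u v w := Fpar 1 u v w (qpow tau (1 / 2)) in
  \col_(i < 5)
    [:: qpow tau (- 5 / 88) * F0 1 1 1;
        qpow tau (- 1 / 88) * F1 1 1 q;
        qpow tau (7 / 88) * (F1 1 q q + q * F1 q (q ^+ 2) (q ^+ 3));
        qpow tau (19 / 88) * F0 1 q (q ^+ 2);
        qpow tau (35 / 88) * F0 q q (q ^+ 2)]`_i.

Definition gvee tau : 'cV[R[i]]_5 :=
  let q := qpow tau 1 in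
  \col_(i < 5)
    [:: qpow tau (- 7 / 88) * G 1 1 1 q;
        qpow tau (25 / 88) * (G q 1 1 q + G (q ^+ 3) (q ^+ 2) q q);
        qpow tau (1 / 88) * G 1 1 q q;
        qpow tau (9 / 88) * G q 1 q q;
        qpow tau (49 / 88) * G (q ^+ 2) (q ^+ 2) q q]`_i.

Definition Uvec tau : 'cV[R[i]]_5 :=
  let q := qpow tau 1 in
  let F u v w := F u v w (qpow tau (1 / 2)) in
  \col_(i < 5)
    [:: qpow tau (- 5 / 88) * F 1 1 1;
        qpow tau (- 1 / 88) * F 1 1 q;
        qpow tau (7 / 88) * (F 1 q q + q * F q (q ^+ 2) (q ^+ 3));
        qpow tau (19 / 88) * F 1 q (q ^+ 2);
        qpow tau (35 / 88) * F q q (q ^+ 2)]`_i.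

Definition Vvec tau : 'cV[R[i]]_5 :=
  let q := qpow tau 1 in
  \col_(i < 5)
    [:: qpow tau (- 7 / 88) * Gpar 0 1 1 1 q;
        qpow tau (25 / 88)
          * (Gpar 0 q 1 1 q + Gpar 1 (q ^+ 3) (q ^+ 2) q q);
        qpow tau (1 / 88) * Gpar 1 1 1 q q;
        qpow tau (9 / 88) * Gpar 1 q 1 q q;
        qpow tau (49 / 88) * Gpar 1 (q ^+ 2) (q ^+ 2) q q]`_i.

Definition Ustar tau : 'cV[R[i]]_5 := 2 *: gvec tau - Uvec tau.
Definition Vstar tau : 'cV[R[i]]_5 := gvee tau - Vvec tau.

Definition alpha (k : nat) : R[i] :=
  (Num.sqrt (2 / 11) * sin (k%:R * pi / 11))%:C.

Definition Smx : 'M[R[i]]_5 :=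
  \matrix_(i < 5, j < 5)
    (nth [::]
      [:: [:: alpha 5; alpha 4; alpha 3; alpha 2; alpha 1];
          [:: alpha 4; alpha 1; - alpha 2; - alpha 5; - alpha 3];
          [:: alpha 3; - alpha 2; - alpha 4; alpha 1; alpha 5];
          [:: alpha 2; - alpha 5; alpha 1; alpha 3; - alpha 4];
          [:: alpha 1; - alpha 3; alpha 5; - alpha 4; alpha 2]] i)`_j.

End Defs.

(* Main.v *)
(* Applying Euler's q-exponential identity to one of the three indices reduces each
   component of U, V, U* and V* to a double sum over a Bailey pair, and Bailey's lemma
   (in bilateral form) turns that double sum into an infinite product times a series
   sum_r (-1)^r s^(11 r^2 + d r), d in {1, 3, 5, 7, 9}.  For U and V, s is a rational power of
   q; for U* and V*, which come from changing the sign of q^(1/2), resp. of q,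
   s^2 is - q^(1/2), resp. - q, and the signs of the theta series have period 4 in r.

   The theta series are shifts theta_a(x) = sum_r (-1)^r exp(- a (r + x)^2) by odd multiples
   of 1/22 (1/44 for the starred vectors).  The inversion a -> pi^2 / a, for complex
   a with positive real part, is obtained by expanding Riemann sums of the Gaussian in
   a finite Fourier series and passing to the limit with Tannery's theorem.  Folding
   the inverted series modulo 11 (resp. 22) produces the cosines that are the entries
   of S.  By the pentagonal number theorem the infinite products are quotients of the
   same theta functions with 11 replaced by 3, so that they transform by the same
   inversion.  The Gaussian integrals I(a) which it introduces cancel by
   I(r^2 a) = I(a) / r.

   The last two identities follow by addition, as g^vee = V + V* and 2 g = U + U*. *)
Require Import Defs.
From mathcomp Require Import all_boot all_order all_algebra.
From mathcomp Require Import complex.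
From mathcomp Require Import all_classical all_reals all_analysis.
From mathcomp Require Import ring lra zify.
Import Order.TTheory GRing.Theory Num.Theory.
Import numFieldNormedType.Exports.
Local Open Scope ring_scope.
Local Open Scope complex_scope.
Local Notation Re := complex.Re.
Local Notation Im := complex.Im.
Set Implicit Arguments.
Unset Strict Implicit.
Unset Printing Implicit Defensive.

(** The constant 11 is 3 + 4 + 4: the bilateral sequences carry r^2 with coefficient 3, and each of
    the two applications of Bailey's lemma adds 4, either because powers are counted in q^(1/4) or
    because the sequence sits at the even positions 2 r. Since 1/(q;q)_n is extended by 0 to
    negative n and the sequences are bilateral, one sequence serves several bases q^c; which
    correction terms vanish is decided by its antisymmetry under r -> - c - r.

    On the analytic side, neither contour integration nor a square root of a complex number occurs.
    Up to an error tending to 0, a theta value is a Riemann sum of the Gaussian times a dual theta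
    value. Dividing by a nonzero dual value shows that the Riemann sums converge, and a nonzero
    theta value shows that the limit I(a) is not 0. The pentagonal number theorem supplies both
    points, because its infinite product does not vanish. The scaling law is exact on nested grids
    when r is an integer, and reaches real r by continuity; the square roots of 2, 3 and 11/2 are
    the scale factors that occur. *)

Section Modulus.
Variable R : realType.
Implicit Types z w : R[i].

(* The main constants are given by opaque specifications: otherwise unification
   unfolds them down to the components of complex numbers. *)
Fact nrm_spec : {f : R[i] -> R | forall z, f z = Normc.normc z}.
Proof. by exists (@Normc.normc R). Qed.
Definition nrm : R[i] -> R := sval nrm_spec.
Lemma nrm_def z : nrm z = Normc.normc z.
Proof. exact: (svalP nrm_spec). Qed.

Lemma nrmE z : `|z| = (nrm z)%:C.
Proof. by rewrite nrm_def normc_def; case: z. Qed.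

Lemma nrm_inj (x : R) z : `|z| = x%:C -> nrm z = x.
Proof. by rewrite nrmE => -[]. Qed.

Lemma nrm_ge0 z : 0 <= nrm z.
Proof. by rewrite -ler0c -nrmE. Qed.

Lemma nrm0 : nrm 0 = 0.
Proof. by apply: nrm_inj; rewrite normr0. Qed.

Lemma nrm1 : nrm 1 = 1.
Proof. by apply: nrm_inj; rewrite normr1. Qed.

Lemma nrmM z w : nrm (z * w) = nrm z * nrm w.
Proof. by rewrite !nrm_def Normc.normcM. Qed.

Lemma nrmV z : nrm z^-1 = (nrm z)^-1.
Proof. by rewrite !nrm_def Normc.normcV. Qed.

Lemma nrmN z : nrm (- z) = nrm z.
Proof. by apply: nrm_inj; rewrite normrN nrmE. Qed.

Lemma nrmX z n : nrm (z ^+ n) = nrm z ^+ n.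
Proof. by elim: n => [|n IH]; rewrite ?expr0 ?nrm1// !exprS nrmM IH. Qed.

Lemma nrm_exprz z (n : int) : nrm (z ^ n) = nrm z ^ n.
Proof. by case: n => n; rewrite ?NegzE -?exprnN -?exprnP ?nrmV nrmX. Qed.

Lemma nrm_triangle z w : nrm (z + w) <= nrm z + nrm w.
Proof. by rewrite -lecR rmorphD/= -!nrmE ler_normD. Qed.

Lemma nrmB_triangle z w : nrm (z - w) <= nrm z + nrm w.
Proof. by rewrite -(nrmN w) nrm_triangle. Qed.

Lemma nrm_sub_sym z w : nrm (z - w) = nrm (w - z).
Proof. by rewrite -nrmN opprB. Qed.

Lemma nrm_real (x : R) : nrm x%:C = `|x|.
Proof. by rewrite nrm_def /= expr0n addr0 sqrtr_sqr. Qed.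

Lemma nrm_nat (n : nat) : nrm n%:R = n%:R.
Proof. by apply: nrm_inj; rewrite normr_nat rmorph_nat. Qed.

Lemma nrm_eq0 z : (nrm z == 0) = (z == 0).
Proof.
by apply/eqP/eqP => [|->]; [rewrite nrm_def; exact: Normc.eq0_normc | exact: nrm0].
Qed.

Lemma nrm_gt0 z : z != 0 -> 0 < nrm z.
Proof. by move=> z0; rewrite lt_def nrm_eq0 z0 nrm_ge0. Qed.

Lemma Re_le_nrm z : `|Re z| <= nrm z.
Proof. by have := normc_ge_Re z; rewrite nrmE lecR. Qed.

Lemma Im_le_nrm z : `|Im z| <= nrm z.
Proof.
have := Re_le_nrm (z * 'i); rewrite ReiNIm normrN nrmM.
by rewrite [X in _ * X]nrm_def/= expr0n/= add0r expr1n sqrtr1 mulr1.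
Qed.

Lemma nrm_le_ReIm z : nrm z <= `|Re z| + `|Im z|.
Proof.
have {1}-> : z = (Re z)%:C + 'i * (Im z)%:C by exact: complexE.
apply: (le_trans (nrm_triangle _ _)); rewrite nrmM !nrm_real.
by rewrite [X in X * _]nrm_def/= expr0n/= add0r expr1n sqrtr1 mul1r.
Qed.

Lemma nrm_sum (I : Type) (s : seq I) (P : pred I) (F : I -> R[i]) :
  nrm (\sum_(i <- s | P i) F i) <= \sum_(i <- s | P i) nrm (F i).
Proof.
elim/big_rec2 : _ => [|i x y _ le]; first by rewrite nrm0.
by apply: (le_trans (nrm_triangle _ _)); rewrite lerD2l.
Qed.

Lemma nrm_prod (I : Type) (s : seq I) (P : pred I) (F : I -> R[i]) :
  nrm (\prod_(i <- s | P i) F i) = \prod_(i <- s | P i) nrm (F i).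
Proof. by rewrite (big_morph nrm nrmM nrm1). Qed.

Lemma Re_add z w : Re (z + w) = Re z + Re w. Proof. by case: z; case: w. Qed.
Lemma Im_add z w : Im (z + w) = Im z + Im w. Proof. by case: z; case: w. Qed.
Lemma Re_mul z w : Re (z * w) = Re z * Re w - Im z * Im w.
Proof. by case: z => a b; case: w. Qed.
Lemma Im_mul z w : Im (z * w) = Re z * Im w + Im z * Re w.
Proof. by case: z => a b; case: w. Qed.

End Modulus.

(** * Unconditional complex sums *)

Section SequenceLimits.
Variable R : realType.
Implicit Types (u v : nat -> R[i]) (l m : R[i]).

Definition ctends u l :=
  forall e : R, 0 < e -> exists N : nat, forall n, (N <= n)%N -> nrm (u n - l) < e.

Lemma ctends_uniq u l m : ctends u l -> ctends u m -> l = m.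
Proof.
move=> ul um; apply/eqP; rewrite -subr_eq0 -nrm_eq0; apply/negPn/negP => ne.
have e0 : 0 < nrm (l - m) / 2 by rewrite divr_gt0// lt_def ne nrm_ge0.
have [N hN] := ul _ e0; have [M hM] := um _ e0.
have := hN _ (leq_maxl N M); have := hM _ (leq_maxr N M).
set n := maxn N M => h1 h2.
have : nrm (l - m) <= nrm (u n - m) + nrm (u n - l).
  by rewrite (_ : l - m = (u n - m) - (u n - l)) ?nrmB_triangle//; ring.
by lra.
Qed.

Lemma ctends_cst l : ctends (fun=> l) l.
Proof. by move=> e e0; exists 0%N => n _; rewrite subrr nrm0. Qed.

Lemma eq_ctends u v l : u =1 v -> ctends u l -> ctends v l.
Proof.
by move=> uv ul e e0; have [N hN] := ul e e0; exists N => n /hN; rewrite uv.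
Qed.

Lemma ctendsD u v l m :
  ctends u l -> ctends v m -> ctends (fun n => u n + v n) (l + m).
Proof.
move=> ul vm e e0; have e20 : 0 < e / 2 by rewrite divr_gt0.
have [N hN] := ul _ e20; have [M hM] := vm _ e20.
exists (maxn N M) => n; rewrite geq_max => /andP[/hN h1 /hM h2].
rewrite (_ : _ - _ = (u n - l) + (v n - m)); last by ring.
by apply: (le_lt_trans (nrm_triangle _ _)); lra.
Qed.

Lemma ctendsZ (c : R[i]) u l : ctends u l -> ctends (fun n => c * u n) (c * l).
Proof.
move=> ul e e0; have c0 : 0 < nrm c + 1 by rewrite ltr_wpDl ?nrm_ge0.
have [N hN] := ul _ (divr_gt0 e0 c0); exists N => n /hN h.
rewrite -mulrBr nrmM; apply: (le_lt_trans (y := (nrm c + 1) * nrm (u n - l))).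
  by rewrite ler_wpM2r ?nrm_ge0// lerDl.
by rewrite mulrC -ltr_pdivlMr.
Qed.

Lemma ctendsB u v l m :
  ctends u l -> ctends v m -> ctends (fun n => u n - v n) (l - m).
Proof.
move=> ul vm; have := ctendsD ul (ctendsZ (-1) vm).
by rewrite mulN1r; apply: eq_ctends => n; rewrite mulN1r.
Qed.

Lemma ctends_bounded u l : ctends u l -> exists2 M, 0 < M & forall n, nrm (u n) <= M.
Proof.
move=> /(_ 1 ltr01) [N hN].
exists (1 + nrm l + \sum_(i < N) nrm (u i)).
  by rewrite ltr_wpDr ?sumr_ge0// => [i _|]; rewrite ?nrm_ge0// ltr_wpDr ?nrm_ge0.
move=> n; have [nN|Nn] := ltnP n N.
  rewrite (bigD1 (Ordinal nN))//= addrCA lerDl addr_ge0 ?addr_ge0 ?nrm_ge0//.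
  by rewrite sumr_ge0// => i _; rewrite nrm_ge0.
have := hN n Nn => h; have := nrm_triangle (u n - l) l; rewrite subrK => h2.
have : 0 <= \sum_(i < N) nrm (u i) by rewrite sumr_ge0// => i _; rewrite nrm_ge0.
by lra.
Qed.

Lemma ctendsM u v l m :
  ctends u l -> ctends v m -> ctends (fun n => u n * v n) (l * m).
Proof.
move=> ul vm; have [M M0 hM] := ctends_bounded vm.
have H : ctends (fun n => (u n - l) * v n) 0.
  move=> e e0; have [N hN] := ul _ (divr_gt0 e0 M0); exists N => n /hN h.
  rewrite subr0 nrmM; apply: (le_lt_trans (y := nrm (u n - l) * M)).
    by rewrite ler_wpM2l ?nrm_ge0.
  by rewrite -ltr_pdivlMr.
have := ctendsD H (ctendsZ l vm); rewrite add0r.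
by apply: eq_ctends => n; ring.
Qed.

Lemma ctends_comp u l (k : nat -> nat) :
  (forall n, (n <= k n)%N) -> ctends u l -> ctends (fun n => u (k n)) l.
Proof.
move=> kn ul e e0; have [N hN] := ul e e0; exists N => n Nn.
by apply: hN; exact: leq_trans Nn (kn n).
Qed.

Lemma ctends_shift u l (k : nat) :
  ctends (fun n => u (n + k)%N) l -> ctends u l.
Proof.
move=> ul e e0; have [N hN] := ul e e0; exists (N + k)%N => n Nn.
have := hN (n - k)%N; rewrite subnK; last by lia.
by apply; lia.
Qed.

Lemma ctends_le u l (M : R) : ctends u l -> (forall n, nrm (u n) <= M) -> nrm l <= M.
Proof.
move=> ul uM; rewrite leNgt; apply/negP => Ml.
have e0 : 0 < nrm l - M by rewrite subr_gt0.
have [N /(_ N (leqnn _)) h] := ul _ e0.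
have := nrm_triangle (l - u N) (u N); rewrite subrK nrm_sub_sym => h2.
by have := uM N; lra.
Qed.

Lemma ctends_ge u l (M : R) : ctends u l -> (forall n, M <= nrm (u n)) -> M <= nrm l.
Proof.
move=> ul uM; rewrite leNgt; apply/negP => Ml.
have e0 : 0 < M - nrm l by rewrite subr_gt0.
have [N /(_ N (leqnn _)) h] := ul _ e0.
have := nrm_triangle (u N - l) l; rewrite subrK => h2.
by have := uM N; lra.
Qed.

Lemma ctends_of_inv u l (K : R) :
  (forall n, nrm (u n - l) <= K / n.+1%:R) -> ctends u l.
Proof.
move=> h e e0; pose N := Num.bound (`|K| / e); exists N => n Nn.
apply: (le_lt_trans (h n)); rewrite ltr_pdivrMr ?ltr0n//.
apply: (le_lt_trans (ler_norm K)).
have : `|K| / e < n.+1%:R.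
  have := archi_boundP (x := `|K| / e) (divr_ge0 (normr_ge0 _) (ltW e0)).
  by move=> h1; apply: (lt_le_trans h1); rewrite ler_nat; exact: leqW.
by rewrite ltr_pdivrMr// mulrC.
Qed.

Lemma ctends_dist0 u l (w : nat -> R[i]) :
  ctends (fun n => u n - w n) 0 -> ctends w l -> ctends u l.
Proof.
by move=> h1 h2; have := ctendsD h1 h2; rewrite add0r; apply: eq_ctends => n; rewrite subrK.
Qed.

End SequenceLimits.

(** * Sums of nonnegative families *)

Section NonnegativeSums.
Variable R : realType.
Section OneType.
Variable T : choiceType.
Implicit Types (f g h : T -> R).

(** [fine] sends [+oo] to 0, so the value is meaningful only together with [summ]. *)
Definition nsum f : R := fine (\esum_(x in [set: T]) (f x)%:E).

Definition summ f : Prop := (\esum_(x in [set: T]) (f x)%:E < +oo)%E.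

Lemma nsumE f : (forall x, 0 <= f x) -> summ f ->
  (\esum_(x in [set: T]) (f x)%:E)%E = (nsum f)%:E.
Proof.
move=> f0 fs; rewrite /nsum fineK// ge0_fin_numE// esum_ge0// => x _.
by rewrite lee_fin.
Qed.

Lemma eq_nsum f g : f =1 g -> nsum f = nsum g.
Proof. by move=> fg; rewrite /nsum; congr fine; apply: eq_esum => x _; rewrite fg. Qed.

Lemma eq_summ f g : f =1 g -> summ f -> summ g.
Proof. by move=> fg; rewrite /summ; under eq_esum do rewrite fg. Qed.

Lemma summ_le f g : (forall x, f x <= g x) -> summ g -> summ f.
Proof.
move=> fg; apply: le_lt_trans; apply: le_esum => x _; rewrite lee_fin; exact: fg.
Qed.

Lemma nsum_ge0 f : (forall x, 0 <= f x) -> 0 <= nsum f.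
Proof. by move=> f0; rewrite fine_ge0// esum_ge0// => x _; rewrite lee_fin. Qed.

Lemma nsum_le f g : (forall x, 0 <= f x) -> (forall x, f x <= g x) -> summ g ->
  nsum f <= nsum g.
Proof.
move=> f0 fg sg; have sf := summ_le fg sg.
have g0 x : 0 <= g x by exact: le_trans (f0 x) (fg x).
by rewrite -lee_fin -!nsumE//; apply: le_esum => x _; rewrite lee_fin.
Qed.

Lemma summD f g : (forall x, 0 <= f x) -> (forall x, 0 <= g x) ->
  summ f -> summ g -> summ (fun x => f x + g x).
Proof.
move=> f0 g0 sf sg; rewrite /summ; under eq_esum do rewrite EFinD.
by rewrite esumD ?lte_add_pinfty// => x _; rewrite lee_fin.
Qed.

Lemma nsumD f g : (forall x, 0 <= f x) -> (forall x, 0 <= g x) ->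
  summ f -> summ g -> nsum (fun x => f x + g x) = nsum f + nsum g.
Proof.
move=> f0 g0 sf sg; apply: EFin_inj; rewrite EFinD -!nsumE//; last 2 first.
- by move=> x; rewrite addr_ge0.
- exact: summD.
by under eq_esum do rewrite EFinD; rewrite esumD// => x _; rewrite lee_fin.
Qed.

Lemma sum_le_nsum f (s : seq T) : (forall x, 0 <= f x) -> summ f -> uniq s ->
  \sum_(x <- s) f x <= nsum f.
Proof.
move=> f0 sf us; rewrite -lee_fin -nsumE// -sumEFin fsbig_seq//.
by apply: esum_ge; exists [set` s]%classic => //; split.
Qed.

Lemma summ_bound f (M : R) : (forall s : seq T, uniq s -> \sum_(x <- s) f x <= M) ->
  (\esum_(x in [set: T]) (f x)%:E <= M%:E)%E.
Proof.
move=> fM; apply: ge_ereal_sup => _ [A [finA _] <-].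
by rewrite fsbig_finite//= sumEFin lee_fin fM// finmap.fset_uniq.
Qed.

Lemma summ_of_bound f (M : R) :
  (forall s : seq T, uniq s -> \sum_(x <- s) f x <= M) -> summ f.
Proof. by move=> /summ_bound h; apply: le_lt_trans h _; rewrite ltry. Qed.

Lemma nsum_le_bound f (M : R) : (forall x, 0 <= f x) ->
  (forall s : seq T, uniq s -> \sum_(x <- s) f x <= M) -> nsum f <= M.
Proof.
move=> f0 h; rewrite -lee_fin -nsumE//; first exact: summ_bound.
exact: summ_of_bound h.
Qed.

Lemma nsum_approx f (e : R) : (forall x, 0 <= f x) -> summ f -> 0 < e ->
  exists2 s : seq T, uniq s & nsum f - e < \sum_(x <- s) f x.
Proof.
move=> f0 sf e0; have /(ub_ereal_sup_adherent e0) : \esum_(x in [set: T]) (f x)%:E \is a fin_num.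
  by rewrite nsumE.
move=> [_ [A [finA _] <-]]; rewrite -/(esum _ _) nsumE// fsbig_finite//= sumEFin.
by rewrite -EFinB lte_fin => h; exists (finmap.enum_fset (fset_set A)) => //; rewrite finmap.fset_uniq.
Qed.

Lemma summZ (c : R) f : 0 <= c -> (forall x, 0 <= f x) -> summ f ->
  summ (fun x => c * f x).
Proof.
move=> c0 f0 sf; apply: (@summ_of_bound _ (c * nsum f)) => s us.
by rewrite -mulr_sumr ler_wpM2l// sum_le_nsum.
Qed.

Lemma nsumZ (c : R) f : 0 <= c -> (forall x, 0 <= f x) -> summ f ->
  nsum (fun x => c * f x) = c * nsum f.
Proof.
move=> c0 f0 sf; have cf0 x : 0 <= c * f x by rewrite mulr_ge0.
apply/eqP; rewrite eq_le; apply/andP; split.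
  apply: nsum_le_bound => // s us.
  by rewrite -mulr_sumr ler_wpM2l// sum_le_nsum.
have [cz|cn] := eqVneq c 0.
  by rewrite {1}cz mul0r nsum_ge0.
have {}c0 : 0 < c by rewrite lt_def cn.
rewrite mulrC -ler_pdivlMr//; apply: nsum_le_bound => // s us.
rewrite ler_pdivlMr// mulrC mulr_sumr; apply: sum_le_nsum => //.
by apply: summZ => //; exact: ltW.
Qed.

(** Outside [s] the sum of [f] is at most the tail of the majorant [h]: this is [sum_le_nsum] for
    the nonnegative function [h - f]. *)
Lemma nsum_le_split f h (s : seq T) : (forall x, 0 <= f x) -> (forall x, f x <= h x) ->
  summ h -> uniq s -> nsum f <= \sum_(x <- s) f x + (nsum h - \sum_(x <- s) h x).
Proof.
move=> f0 fh sh us.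
have h0 x : 0 <= h x by exact: le_trans (f0 x) (fh x).
have g0 x : 0 <= h x - f x by rewrite subr_ge0.
have sf := summ_le fh sh.
have sg : summ (fun x => h x - f x).
  by apply: summ_le sh => x; rewrite gerBl.
have := sum_le_nsum g0 sg us; rewrite sumrB.
have -> : nsum h = nsum f + nsum (fun x => h x - f x).
  by rewrite -nsumD//; apply: eq_nsum => x; rewrite addrC subrK.
lra.
Qed.

End OneType.

Lemma summ_inj (T U : choiceType) (e : U -> T) (f : T -> R) :
  injective e -> (forall x, 0 <= f x) -> summ f -> summ (fun u => f (e u)).
Proof.
move=> ie f0 sf; apply: (@summ_of_bound _ _ (nsum f)) => s us.
by rewrite -(big_map e xpredT f) sum_le_nsum// map_inj_uniq.
Qed.

Lemma esum_supp (T U : choiceType) (e : U -> T) (f : T -> R) :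
  injective e -> (forall t, (forall u, e u <> t) -> f t = 0) ->
  (\esum_(x in [set: T]) (f x)%:E = \esum_(u in [set: U]) (f (e u))%:E)%E.
Proof.
move=> ie supp; rewrite -(@esum_image _ _ _ setT e (EFin \o f)); last by move=> x y _ _; exact: ie.
rewrite [RHS]esum_mkcond; apply: eq_esum => x _ /=.
case: ifPn => //; rewrite notin_setE /= => nx.
by rewrite supp// => u eu; apply: nx; exists u.
Qed.

Lemma summ_supp (T U : choiceType) (e : U -> T) (f : T -> R) :
  injective e -> (forall t, (forall u, e u <> t) -> f t = 0) ->
  summ (fun u => f (e u)) -> summ f.
Proof. by move=> ie supp; rewrite /summ (esum_supp ie supp). Qed.

Lemma nsum_supp (T U : choiceType) (e : U -> T) (f : T -> R) :
  injective e -> (forall t, (forall u, e u <> t) -> f t = 0) ->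
  nsum f = nsum (fun u => f (e u)).
Proof. by move=> ie supp; rewrite /nsum (esum_supp ie supp). Qed.

Lemma esum_pair (T U : choiceType) (f : T * U -> R) : (forall z, 0 <= f z) ->
  (\esum_(z in [set: T * U]) (f z)%:E =
   \esum_(x in [set: T]) \esum_(y in [set: U]) (f (x, y))%:E)%E.
Proof.
move=> f0; rewrite (@esum_esum _ _ _ setT (fun=> setT) (fun x y => (f (x, y))%:E)); last first.
  by move=> i j _ _; rewrite lee_fin.
have -> : ([set: T] `*`` (fun=> [set: U]) = [set: T * U])%classic.
  by apply/seteqP; split.
by apply: eq_esum => -[].
Qed.

Lemma summ_fiber (T U : choiceType) (f : T * U -> R) : (forall z, 0 <= f z) ->
  summ f -> forall x, summ (fun y => f (x, y)).
Proof.
by move=> f0 sf x; apply: (summ_inj (e := fun y => (x, y))) => // y y' [].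
Qed.

Lemma esum_pairE (T U : choiceType) (f : T * U -> R) : (forall z, 0 <= f z) ->
  summ f -> (\esum_(z in [set: T * U]) (f z)%:E =
   \esum_(x in [set: T]) (nsum (fun y => f (x, y)))%:E)%E.
Proof.
move=> f0 sf; rewrite esum_pair//; apply: eq_esum => x _; rewrite nsumE//.
exact: summ_fiber.
Qed.

Lemma summ_nsum (T U : choiceType) (f : T * U -> R) : (forall z, 0 <= f z) ->
  summ f -> summ (fun x => nsum (fun y => f (x, y))).
Proof. by move=> f0 sf; rewrite /summ -esum_pairE. Qed.

Lemma nsum_pair (T U : choiceType) (f : T * U -> R) : (forall z, 0 <= f z) ->
  summ f -> nsum f = nsum (fun x => nsum (fun y => f (x, y))).
Proof. by move=> f0 sf; rewrite {1}/nsum esum_pairE. Qed.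

Lemma summ_pair (T U : choiceType) (f : T * U -> R) : (forall z, 0 <= f z) ->
  (forall x, summ (fun y => f (x, y))) ->
  summ (fun x => nsum (fun y => f (x, y))) -> summ f.
Proof.
move=> f0 s1 s2; rewrite /summ esum_pair//.
by under eq_esum do rewrite nsumE//.
Qed.

Lemma summ_prod (T U : choiceType) (f : T -> R) (g : U -> R) :
  (forall x, 0 <= f x) -> (forall y, 0 <= g y) -> summ f -> summ g ->
  summ (fun z : T * U => f z.1 * g z.2).
Proof.
move=> f0 g0 sf sg; apply: summ_pair => [z|x|] /=; first by rewrite mulr_ge0.
  exact: summZ.
under [X in summ X]eq_fun do rewrite nsumZ// mulrC.
by apply: summZ => //; exact: nsum_ge0.
Qed.

Lemma sum_int_le (f : int -> R) (s : seq int) : (forall n, 0 <= f n) ->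
  summ (fun n : nat => f n%:Z) -> summ (fun n : nat => f (- n%:Z)) -> uniq s ->
  \sum_(n <- s) f n <= nsum (fun n : nat => f n%:Z) + nsum (fun n : nat => f (- n%:Z)).
Proof.
move=> f0 s1 s2 us.
rewrite (bigID (fun n : int => 0 <= n))/= lerD//.
  rewrite -big_filter.
  have -> : [seq i <- s | 0 <= i] = map Posz (map absz [seq i <- s | 0 <= i]).
    rewrite -map_comp -[LHS]map_id; apply/eq_in_map => n; rewrite mem_filter => /andP[n0 _] /=.
    by rewrite gez0_abs.
  rewrite big_map; apply: (sum_le_nsum _ s1) => //.
  rewrite map_inj_in_uniq ?filter_uniq// => m n.
  rewrite !mem_filter => /andP[m0 _] /andP[n0 _] mn.
  by rewrite -(gez0_abs m0) mn gez0_abs.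
rewrite -big_filter.
have -> : [seq i <- s | ~~ (0 <= i)] = map (fun n : nat => - n%:Z) (map absz [seq i <- s | ~~ (0 <= i)]).
  rewrite -map_comp -[LHS]map_id; apply/eq_in_map => n; rewrite mem_filter -ltNge => /andP[n0 _] /=.
  by rewrite ltz0_abs// opprK.
rewrite big_map; apply: (sum_le_nsum _ s2) => //.
rewrite map_inj_in_uniq ?filter_uniq// => m n.
rewrite !mem_filter -!ltNge => /andP[m0 _] /andP[n0 _] mn.
by apply: oppr_inj; rewrite -(ltz0_abs m0) mn ltz0_abs.
Qed.

Lemma summ_int (f : int -> R) : (forall n, 0 <= f n) ->
  summ (fun n : nat => f n%:Z) -> summ (fun n : nat => f (- n%:Z)) -> summ f.
Proof. by move=> f0 s1 s2; apply: summ_of_bound => s us; exact: sum_int_le. Qed.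

Lemma nsum_int_le (f : int -> R) : (forall n, 0 <= f n) ->
  summ (fun n : nat => f n%:Z) -> summ (fun n : nat => f (- n%:Z)) ->
  nsum f <= nsum (fun n : nat => f n%:Z) + nsum (fun n : nat => f (- n%:Z)).
Proof. by move=> f0 s1 s2; apply: nsum_le_bound => // s us; exact: sum_int_le. Qed.

Lemma sum_nat_le (f : nat -> R) (M : R) (s : seq nat) : (forall n, 0 <= f n) ->
  (forall n, \sum_(i < n) f i <= M) -> uniq s -> \sum_(i <- s) f i <= M.
Proof.
move=> f0 fM us.
apply: (le_trans _ (fM (\max_(i <- s) i).+1)).
set n := (\max_(i <- s) i).+1.
rewrite -(big_mkord xpredT f) /index_iota subn0.
apply: (le_trans (y := \sum_(x <- [seq i <- iota 0 n | i \in s]) f x)).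
  rewrite le_eqVlt; apply/orP; left; apply/eqP; apply: perm_big.
  apply: uniq_perm => //; first by rewrite filter_uniq// iota_uniq.
  move=> x; rewrite mem_filter mem_iota /= add0n; case xs: (x \in s) => //=.
  by rewrite ltnS (@leq_bigmax_seq _ _ xpredT (fun i : nat => i)).
by rewrite big_filter [leRHS](bigID (fun i => i \in s))/= lerDl sumr_ge0.
Qed.

Lemma sum_geo (x : R) n : (1 - x) * \sum_(i < n) x ^+ i = 1 - x ^+ n.
Proof. by rewrite -opprB mulNr -subrX1 opprB. Qed.

Lemma summ_nat (f : nat -> R) (M : R) : (forall n, 0 <= f n) ->
  (forall n, \sum_(i < n) f i <= M) -> summ f.
Proof. by move=> f0 fM; apply: (@summ_of_bound _ _ M) => s us; exact: sum_nat_le. Qed.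

Lemma sum_geo_le x n : 0 <= x -> x < 1 -> \sum_(i < n) x ^+ i <= (1 - x)^-1 :> R.
Proof.
move=> x0 x1; rewrite -[leRHS]mul1r ler_pdivlMr ?subr_gt0// mulrC sum_geo.
by rewrite gerBl exprn_ge0.
Qed.

Lemma summ_geo (x : R) : 0 <= x -> x < 1 -> summ (fun n : nat => x ^+ n).
Proof.
move=> x0 x1; apply: (@summ_nat _ (1 - x)^-1) => n; first by rewrite exprn_ge0.
exact: sum_geo_le.
Qed.

Lemma nsum_geo_le (x : R) : 0 <= x -> x < 1 -> nsum (fun n : nat => x ^+ n) <= (1 - x)^-1.
Proof.
move=> x0 x1; apply: nsum_le_bound => [n|s us]; first by rewrite exprn_ge0.
by apply: sum_nat_le us => [n|n]; [rewrite exprn_ge0|exact: sum_geo_le].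
Qed.

Lemma summ_geoz (x : R) : 0 <= x -> x < 1 -> summ (fun n : int => x ^+ `|n|%N).
Proof.
move=> x0 x1; apply: summ_int => [n||]; first by rewrite exprn_ge0.
  exact: summ_geo.
by under [X in summ X]eq_fun do rewrite abszN; exact: summ_geo.
Qed.

Lemma nsum_geoz_le (x : R) : 0 <= x -> x < 1 -> nsum (fun n : int => x ^+ `|n|%N) <= 2 / (1 - x).
Proof.
move=> x0 x1; have e : (fun n : nat => x ^+ `|- n%:Z|%N) = (fun n : nat => x ^+ n).
  by apply/funext => n; rewrite abszN.
have h := @nsum_int_le (fun n : int => x ^+ `|n|%N); rewrite /= e in h.
apply: (le_trans (h _ (summ_geo x0 x1) (summ_geo x0 x1))) => [n|]; first by rewrite exprn_ge0.
by have := nsum_geo_le x0 x1; lra.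
Qed.

Lemma summ_inv_sq : summ (fun n : int => (1 + (`|n|%N)%:R ^+ 2)^-1 : R).
Proof.
(* Telescoping majorant; the constant 4 makes 4 (1 + n^2) - (n + 1)(n + 2) = 3 n^2 - 3 n + 2
   positive. *)
have h (n : nat) : (1 + n%:R ^+ 2 : R)^-1 <= 4 * ((n.+1%:R)^-1 - (n.+2%:R)^-1).
  rewrite -[n.+2]addn2 -[n.+1]addn1 !natrD.
  have n1 : (0 : R) <= n%:R by rewrite ler0n.
  have p1 : (0:R) < n%:R + 1%:R by lra.
  have p2 : (0:R) < n%:R + 2%:R by lra.
  have p3 : (0:R) < 1 + n%:R ^+ 2 by nra.
  have -> : 4 * ((n%:R + 1%:R)^-1 - (n%:R + 2%:R)^-1) = 4 / ((n%:R + 1%:R) * (n%:R + 2%:R)) :> R.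
    by field; rewrite !gt_eqF.
  rewrite -[leLHS]div1r ler_pdivrMr// mulrAC ler_pdivlMr ?mulr_gt0//.
  by have := sqr_ge0 (n%:R - 2^-1 : R); nra.
have s : summ (fun n : nat => (1 + n%:R ^+ 2)^-1 : R).
  apply: (@summ_nat _ 4) => [n|n]; first by rewrite invr_ge0 addr_ge0// sqr_ge0.
  apply: (le_trans (ler_sum _ (fun (i : 'I_n) _ => h i))).
  rewrite -mulr_sumr.
  have -> : \sum_(i < n) ((i.+1%:R)^-1 - (i.+2%:R)^-1) = 1 - (n.+1%:R)^-1 :> R.
    elim: n => [|n IH]; first by rewrite big_ord0 invr1 subrr.
    by rewrite big_ord_recr/= IH addrA subrK.
  by rewrite ger_pMr// gerBl invr_ge0.
apply: summ_int => [n|//|]; first by rewrite invr_ge0 addr_ge0// sqr_ge0.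
by under [X in summ X]eq_fun do rewrite abszN.
Qed.

End NonnegativeSums.

(** * Absolutely summable complex families and Tannery's theorem *)

Section ComplexSums.
Variable R : realType.

Section RealSums.
Variable T : choiceType.
Implicit Types (f g a b : T -> R).

Definition rsum f : R :=
  nsum (fun x => Num.max (f x) 0) - nsum (fun x => Num.max (- f x) 0).

Lemma max0_ge0 (y : R) : 0 <= Num.max y 0.
Proof. by rewrite le_max lexx orbT. Qed.

Lemma max0_le_norm (y : R) : Num.max y 0 <= `|y|.
Proof. by rewrite ge_max ler_norm normr_ge0. Qed.

Lemma max0_sub (y : R) : Num.max y 0 - Num.max (- y) 0 = y.
Proof. by rewrite /Num.max; case: ifPn => h1; case: ifPn => h2; lra. Qed.

Lemma summ_pos f : summ (fun x => `|f x|) -> summ (fun x => Num.max (f x) 0).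
Proof. by apply: summ_le => x; exact: max0_le_norm. Qed.

Lemma summ_neg f : summ (fun x => `|f x|) -> summ (fun x => Num.max (- f x) 0).
Proof. by apply: summ_le => x; rewrite -normrN; exact: max0_le_norm. Qed.

Lemma rsum_sub a b : (forall x, 0 <= a x) -> (forall x, 0 <= b x) -> summ a -> summ b ->
  rsum (fun x => a x - b x) = nsum a - nsum b.
Proof.
move=> a0 b0 sa sb.
have ab x : `|a x - b x| <= a x + b x.
  by apply: (le_trans (ler_normB _ _)); rewrite !ger0_norm.
have s : summ (fun x => `|a x - b x|) by apply: summ_le ab _; exact: summD.
apply/eqP; rewrite /rsum subr_eq addrAC eq_sym subr_eq; apply/eqP.
rewrite -!nsumD//; last 4 first.
- by move=> x; exact: max0_ge0.
- exact: summ_pos s.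
- by move=> x; exact: max0_ge0.
- exact: summ_neg s.
by apply: eq_nsum => x; have := max0_sub (a x - b x); lra.
Qed.

Lemma eq_rsum f g : f =1 g -> rsum f = rsum g.
Proof. by move=> /funext ->. Qed.

Lemma rsumD f g : summ (fun x => `|f x|) -> summ (fun x => `|g x|) ->
  rsum (fun x => f x + g x) = rsum f + rsum g.
Proof.
move=> sf sg.
have -> : rsum (fun x => f x + g x) = rsum (fun x => (Num.max (f x) 0 + Num.max (g x) 0)
   - (Num.max (- f x) 0 + Num.max (- g x) 0)).
  by apply: eq_rsum => x; have := max0_sub (f x); have := max0_sub (g x); lra.
have F x : 0 <= Num.max (f x) 0 by exact: max0_ge0.
have G x : 0 <= Num.max (g x) 0 by exact: max0_ge0.
have F' x : 0 <= Num.max (- f x) 0 by exact: max0_ge0.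
have G' x : 0 <= Num.max (- g x) 0 by exact: max0_ge0.
have sF := summ_pos sf; have sG := summ_pos sg.
have sF' := summ_neg sf; have sG' := summ_neg sg.
rewrite rsum_sub; [|by move=> x; rewrite addr_ge0|by move=> x; rewrite addr_ge0|exact: summD|exact: summD].
by rewrite !nsumD// /rsum; lra.
Qed.

Lemma rsumN f : rsum (fun x => - f x) = - rsum f.
Proof.
by rewrite /rsum opprB; congr (_ - _); apply: eq_nsum => x; rewrite opprK.
Qed.

Lemma rsumZ (c : R) f : summ (fun x => `|f x|) -> rsum (fun x => c * f x) = c * rsum f.
Proof.
move=> sf; wlog c0 : c / 0 <= c => [H|].
  have [c0|c0] := leP 0 c; first exact: H.
  rewrite -[c]opprK mulNr -H ?oppr_ge0 ?ltW// -rsumN.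
  by apply: eq_rsum => x; rewrite mulNr.
have -> : rsum (fun x => c * f x) = rsum (fun x => c * Num.max (f x) 0 - c * Num.max (- f x) 0).
  by apply: eq_rsum => x; rewrite -mulrBr max0_sub.
have F x : 0 <= Num.max (f x) 0 by exact: max0_ge0.
have F' x : 0 <= Num.max (- f x) 0 by exact: max0_ge0.
have sF := summ_pos sf; have sF' := summ_neg sf.
rewrite rsum_sub; [|by move=> x; rewrite mulr_ge0|by move=> x; rewrite mulr_ge0|exact: summZ|exact: summZ].
by rewrite !nsumZ// /rsum mulrBr.
Qed.

Lemma rsum_le f : summ (fun x => `|f x|) -> `|rsum f| <= nsum (fun x => `|f x|).
Proof.
move=> sf.
have F x : 0 <= Num.max (f x) 0 by exact: max0_ge0.
have F' x : 0 <= Num.max (- f x) 0 by exact: max0_ge0.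
have h1 : nsum (fun x => Num.max (f x) 0) <= nsum (fun x => `|f x|).
  by apply: nsum_le => // x; exact: max0_le_norm.
have h2 : nsum (fun x => Num.max (- f x) 0) <= nsum (fun x => `|f x|).
  by apply: nsum_le => // x; rewrite -normrN; exact: max0_le_norm.
by rewrite ler_norml /rsum; have := nsum_ge0 F; have := nsum_ge0 F'; lra.
Qed.

End RealSums.

Lemma rsum_supp (T U : choiceType) (e : U -> T) (f : T -> R) :
  injective e -> (forall t, (forall u, e u <> t) -> f t = 0) ->
  rsum f = rsum (fun u => f (e u)).
Proof.
move=> ie supp; rewrite /rsum; congr (_ - _); apply: (nsum_supp ie) => t /supp ->.
  by rewrite maxxx.
by rewrite oppr0 maxxx.
Qed.

Lemma rsum_pair (T U : choiceType) (f : T * U -> R) : summ (fun z => `|f z|) ->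
  rsum f = rsum (fun x => rsum (fun y => f (x, y))).
Proof.
move=> sf.
have F x : 0 <= Num.max (f x) 0 by exact: max0_ge0.
have F' x : 0 <= Num.max (- f x) 0 by exact: max0_ge0.
have sF := summ_pos sf; have sF' := summ_neg sf.
rewrite /rsum (nsum_pair F sF) (nsum_pair F' sF') -[LHS]rsum_sub//.
- by move=> x; apply: nsum_ge0.
- by move=> x; apply: nsum_ge0.
- exact: (@summ_nsum R T U (fun z => Num.max (f z) 0)).
- exact: (@summ_nsum R T U (fun z => Num.max (- f z) 0)).
Qed.

Section OneType.
Variable T : choiceType.
Implicit Types f g : T -> R[i].

Fact csum_spec : {c : (T -> R[i]) -> R[i] | forall f,
  c f = rsum (fun x => Re (f x)) +i* rsum (fun x => Im (f x))}.
Proof. by eexists. Qed.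
Definition csum : (T -> R[i]) -> R[i] := sval csum_spec.
Lemma csumE f : csum f = rsum (fun x => Re (f x)) +i* rsum (fun x => Im (f x)).
Proof. exact: (svalP csum_spec). Qed.

Definition csmb f : Prop := summ (fun x => nrm (f x)).

Lemma csmb_Re f : csmb f -> summ (fun x => `|Re (f x)|).
Proof. by apply: summ_le => x; exact: Re_le_nrm. Qed.

Lemma csmb_Im f : csmb f -> summ (fun x => `|Im (f x)|).
Proof. by apply: summ_le => x; exact: Im_le_nrm. Qed.

Lemma eq_csum f g : f =1 g -> csum f = csum g.
Proof. by move=> /funext ->. Qed.

Lemma eq_csmb f g : f =1 g -> csmb f -> csmb g.
Proof. by move=> /funext ->. Qed.

Lemma csmb_le (g : T -> R) f : summ g -> (forall x, nrm (f x) <= g x) -> csmb f.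
Proof. by move=> sg fg; exact: summ_le fg sg. Qed.

Lemma csmbD f g : csmb f -> csmb g -> csmb (fun x => f x + g x).
Proof.
move=> sf sg; apply: (summ_le (fun x => nrm_triangle (f x) (g x))).
by apply: summD => // x; exact: nrm_ge0.
Qed.

Lemma csmbZ (c : R[i]) f : csmb f -> csmb (fun x => c * f x).
Proof.
move=> sf; apply: (eq_summ (f := fun x => nrm c * nrm (f x))) => [x|]; first by rewrite nrmM.
by apply: summZ => // [|x]; exact: nrm_ge0.
Qed.

Lemma csmbN f : csmb f -> csmb (fun x => - f x).
Proof. by move=> /(csmbZ (-1)); apply: eq_csmb => x; rewrite mulN1r. Qed.

Lemma csmbB f g : csmb f -> csmb g -> csmb (fun x => f x - g x).
Proof. by move=> sf /csmbN sg; exact: csmbD. Qed.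

Lemma csmb_mul_bounded (K : R) f g : (forall x, nrm (f x) <= K) -> csmb g ->
  csmb (fun x => f x * g x).
Proof.
move=> fK sg; have [x0|T0] := pselect (exists x : T, True).
  have [x _] := x0; have K0 : 0 <= K := le_trans (nrm_ge0 _) (fK x).
  apply: (@csmb_le (fun x => K * nrm (g x))) => [|y]; first by apply: summZ => // y; exact: nrm_ge0.
  by rewrite nrmM ler_wpM2r ?nrm_ge0.
by apply: eq_csmb sg => x; exfalso; apply: T0; exists x.
Qed.

Lemma csumD f g : csmb f -> csmb g -> csum (fun x => f x + g x) = csum f + csum g.
Proof.
move=> sf sg; rewrite !csumE.
under eq_rsum do rewrite Re_add.
under [X in _ +i* X]eq_rsum do rewrite Im_add.
by rewrite !rsumD//; [exact: csmb_Im|exact: csmb_Im|exact: csmb_Re|exact: csmb_Re].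
Qed.

Lemma csumZ (c : R[i]) f : csmb f -> csum (fun x => c * f x) = c * csum f.
Proof.
move=> sf; rewrite !csumE.
under eq_rsum do rewrite Re_mul.
under [X in _ +i* X]eq_rsum do rewrite Im_mul.
have sR := csmb_Re sf; have sI := csmb_Im sf.
have Z (d : R) (h : T -> R) : summ (fun x => `|h x|) -> summ (fun x => `|d * h x|).
  move=> sh; apply: (eq_summ (f := fun x => `|d| * `|h x|)) => [x|]; first by rewrite normrM.
  exact: summZ.
rewrite rsumD ?rsumN ?rsumZ//; [|exact: Z|].
  rewrite rsumD ?rsumZ//; [|exact: Z|exact: Z].
  by case: c => a b /=; rewrite -[RHS]/(_ +i* _).
by apply: eq_summ (Z (Im c) _ sI) => x; rewrite normrN.
Qed.

Lemma csumN f : csum (fun x => - f x) = - csum f.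
Proof.
rewrite !csumE; have -> : (fun x => Re (- f x)) = (fun x => - Re (f x)).
  by apply/funext => x; case: (f x).
have -> : (fun x => Im (- f x)) = (fun x => - Im (f x)).
  by apply/funext => x; case: (f x).
by rewrite !rsumN.
Qed.

Lemma csumB f g : csmb f -> csmb g -> csum (fun x => f x - g x) = csum f - csum g.
Proof. by move=> sf sg; rewrite csumD ?csumN//; exact: csmbN. Qed.

Lemma csumZr (c : R[i]) f : csmb f -> csum (fun x => f x * c) = csum f * c.
Proof. by move=> sf; rewrite mulrC -csumZ//; apply: eq_csum => x; rewrite mulrC. Qed.

(** The factor 2 comes from bounding real and imaginary parts separately; only the order of
    magnitude matters below. *)
Lemma nrm_csum_le f (g : T -> R) : (forall x, nrm (f x) <= g x) -> summ g ->
  nrm (csum f) <= 2 * nsum g.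
Proof.
move=> fg sg; apply: (le_trans (nrm_le_ReIm _)); rewrite csumE /=.
have sf := csmb_le sg fg.
have h1 := rsum_le (csmb_Re sf); have h2 := rsum_le (csmb_Im sf).
have : nsum (fun x => `|Re (f x)|) <= nsum g.
  by apply: nsum_le => // x; exact: le_trans (Re_le_nrm _) (fg x).
have : nsum (fun x => `|Im (f x)|) <= nsum g.
  by apply: nsum_le => // x; exact: le_trans (Im_le_nrm _) (fg x).
by lra.
Qed.

Lemma csum0 : csum (fun=> 0) = 0.
Proof.
have h : csum (fun=> 0) = - csum (fun=> 0) by rewrite -csumN; apply: eq_csum => x; rewrite oppr0.
apply/eqP; have /eqP := subrr (csum (fun=> 0)).
by rewrite {2}h opprK -mulr2n mulrn_eq0.
Qed.

Lemma csum_eq0 f : (forall x, f x = 0) -> csum f = 0.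
Proof. by move=> f0; rewrite (eq_csum f0) csum0. Qed.

Lemma csmb0 : csmb (fun=> 0).
Proof. by apply: (@summ_of_bound _ _ _ 0) => s us; rewrite nrm0 big1. Qed.

Lemma csmb_sum (I : Type) (s : seq I) (F : I -> T -> R[i]) :
  (forall i, csmb (F i)) -> csmb (fun x => \sum_(i <- s) F i x).
Proof.
move=> sF; elim: s => [|i s IH]; first by apply: eq_csmb csmb0 => x; rewrite big_nil.
by apply: eq_csmb (csmbD (sF i) IH) => x; rewrite big_cons.
Qed.

Lemma csum_sum (I : Type) (s : seq I) (F : I -> T -> R[i]) :
  (forall i, csmb (F i)) ->
  csum (fun x => \sum_(i <- s) F i x) = \sum_(i <- s) csum (F i).
Proof.
move=> sF; elim: s => [|i s IH].
  by rewrite big_nil; apply: csum_eq0 => x; rewrite big_nil.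
rewrite big_cons -IH -csumD//; last exact: csmb_sum.
by apply: eq_csum => x; rewrite big_cons.
Qed.

Lemma csmb_single (x0 : T) f : (forall x, x != x0 -> f x = 0) -> csmb f.
Proof.
move=> f0; apply: (@summ_of_bound _ _ _ (nrm (f x0))) => s us.
have [xs|xs] := boolP (x0 \in s).
  rewrite (bigD1_seq x0)//= big1 ?addr0// => x xx0; by rewrite f0// nrm0.
rewrite big_seq big1 ?nrm_ge0// => x xin; rewrite f0 ?nrm0//.
by apply: contraNneq xs => <-.
Qed.

Lemma csum_single (x0 : T) f : (forall x, x != x0 -> f x = 0) -> csum f = f x0.
Proof.
move=> f0; have h (g : T -> R) : (forall x, x != x0 -> g x = 0) -> rsum g = g x0.
  move=> g0; rewrite (@rsum_supp _ unit (fun=> x0)) => [|[] []//|t ut]; last first.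
    by apply: g0; apply/eqP => tx; apply: (ut tt).
  have n (y : R) : 0 <= y -> nsum (fun _ : unit => y) = y.
    move=> y0; apply: EFin_inj; rewrite /nsum.
    have -> : ([set: unit] = [set tt])%classic by apply/seteqP; split => // -[].
    by rewrite esum_set1.
  by rewrite /rsum !n ?max0_ge0// max0_sub.
rewrite csumE !h; first by case: (f x0).
  by move=> x /f0 ->.
by move=> x /f0 ->.
Qed.

Lemma csum_fin (s : seq T) f : uniq s -> (forall x, x \notin s -> f x = 0) ->
  csum f = \sum_(x <- s) f x.
Proof.
move=> us f0; have -> : f = fun x => \sum_(y <- s) (if x == y then f y else 0).
  apply/funext => x; have [xs|xs] := boolP (x \in s).
    by rewrite (bigD1_seq x)//= eqxx big1 ?addr0// => y yx; rewrite eq_sym (negPf yx).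
  rewrite f0// big_seq big1// => y ys; case: eqP => // xy; by rewrite xy ys in xs.
rewrite csum_sum => [|y]; last first.
  by apply: (@csmb_single y) => x xy; rewrite (negPf xy).
rewrite big_seq [RHS]big_seq; apply: eq_bigr => y ys.
rewrite (@csum_single y) => [|x xy]; last by rewrite (negPf xy).
rewrite eqxx (bigD1_seq y)//= eqxx big1 ?addr0// => z zy.
by rewrite eq_sym (negPf zy).
Qed.

Lemma csmb_fin (s : seq T) f : (forall x, x \notin s -> f x = 0) -> csmb f.
Proof.
move=> f0; apply: (@summ_of_bound _ _ _ (\sum_(x <- undup s) nrm (f x))) => r ur.
rewrite (bigID (fun x => x \in s))/= [X in _ + X]big1 => [|x xs]; last by rewrite f0// nrm0.
rewrite addr0 -big_filter.
rewrite (perm_big [seq x <- undup s | x \in r]) /=.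
  rewrite big_filter [leRHS](bigID (fun x => x \in r))/= lerDl sumr_ge0// => x _; exact: nrm_ge0.
apply: uniq_perm; rewrite ?filter_uniq ?undup_uniq// => x.
by rewrite !mem_filter mem_undup andbC.
Qed.

(** A finite set [s] carries all but [e / 4] of the mass of [2 g], which dominates the differences;
    on [s] pointwise convergence gives another [e / 4], and [nrm_csum_le] doubles the total. *)
Lemma tannery (F : nat -> T -> R[i]) (l : T -> R[i]) (g : T -> R) :
  summ g -> (forall n x, nrm (F n x) <= g x) ->
  (forall x, ctends (fun n => F n x) (l x)) ->
  ctends (fun n => csum (F n)) (csum l).
Proof.
move=> sg Fg Fl e e0.
have lg x : nrm (l x) <= g x by apply: ctends_le (Fl x) _ => n; exact: Fg.
have g0 x : 0 <= g x by exact: le_trans (nrm_ge0 _) (lg x).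
pose h x := 2 * g x.
have h0 x : 0 <= h x by rewrite mulr_ge0.
have sh : summ h by exact: summZ.
have e4 : 0 < e / 4 by rewrite divr_gt0.
have [s us hs] := nsum_approx h0 sh e4.
have [N hN] : exists N, forall n, (N <= n)%N -> \sum_(x <- s) nrm (F n x - l x) < e / 4.
  have : forall d : R, 0 < d -> exists N, forall n, (N <= n)%N -> \sum_(x <- s) nrm (F n x - l x) < d.
    elim: (s) => [|x r IH] d d0; first by exists 0%N => n _; rewrite big_nil.
    have d2 : 0 < d / 2 by rewrite divr_gt0.
    have [N hN] := IH _ d2; have [M hM] := Fl x _ d2.
    exists (maxn N M) => n; rewrite geq_max => /andP[/hN h1 /hM h2].
    by rewrite big_cons; lra.
  exact.
exists N => n /hN hn.
have dh x : nrm (F n x - l x) <= h x.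
  by apply: (le_trans (nrmB_triangle _ _)); have := Fg n x; have := lg x; rewrite /h; lra.
rewrite -csumB; [|exact: csmb_le (Fg n)|exact: csmb_le lg].
have sd := summ_le dh sh.
apply: (le_lt_trans (nrm_csum_le (fun x => lexx _) sd)).
have := nsum_le_split (fun x => nrm_ge0 _) dh sh us.
by lra.
Qed.

End OneType.

Lemma csmb_inj (T U : choiceType) (e : U -> T) (f : T -> R[i]) :
  injective e -> csmb f -> csmb (fun u => f (e u)).
Proof. by move=> ie sf; apply: (@summ_inj R T U e (fun x => nrm (f x)) ie) => // x; exact: nrm_ge0. Qed.

Lemma csmb_supp (T U : choiceType) (e : U -> T) (f : T -> R[i]) :
  injective e -> (forall t, (forall u, e u <> t) -> f t = 0) ->
  csmb (fun u => f (e u)) -> csmb f.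
Proof. by move=> ie supp; apply: (@summ_supp R T U e (fun x => nrm (f x)) ie) => // t /supp ->; rewrite nrm0. Qed.

Lemma csum_supp (T U : choiceType) (e : U -> T) (f : T -> R[i]) :
  injective e -> (forall t, (forall u, e u <> t) -> f t = 0) ->
  csum f = csum (fun u => f (e u)).
Proof.
by move=> ie supp; rewrite !csumE; congr (_ +i* _); apply: (rsum_supp ie) => t /supp ->.
Qed.

Lemma csum_bij (T U : choiceType) (e : U -> T) (e' : T -> U) (f : T -> R[i]) :
  cancel e e' -> cancel e' e -> csum f = csum (fun u => f (e u)).
Proof.
move=> ee' e'e; apply: csum_supp; first exact: can_inj ee'.
by move=> t /(_ (e' t)); rewrite e'e.
Qed.

Lemma csmb_fiber (T U : choiceType) (f : T * U -> R[i]) : csmb f ->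
  forall x, csmb (fun y => f (x, y)).
Proof. by move=> sf x; apply: (csmb_inj (e := fun y => (x, y))) sf => y y' []. Qed.

Lemma csmb_csum (T U : choiceType) (f : T * U -> R[i]) : csmb f ->
  csmb (fun x => csum (fun y => f (x, y))).
Proof.
move=> sf; apply: (@csmb_le _ (fun x => 2 * nsum (fun y => nrm (f (x, y))))) => [|x].
  apply: summZ => // [x|]; first by apply: nsum_ge0 => y; exact: nrm_ge0.
  exact: (summ_nsum (fun z => nrm_ge0 (f z))).
by apply: nrm_csum_le => //; exact: csmb_fiber.
Qed.

Lemma csum_pair (T U : choiceType) (f : T * U -> R[i]) : csmb f ->
  csum f = csum (fun x => csum (fun y => f (x, y))).
Proof.
move=> sf; rewrite csumE rsum_pair ?rsum_pair; [|exact: csmb_Im|exact: csmb_Re].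
rewrite csumE; congr (_ +i* _); apply: eq_rsum => x; by rewrite csumE.
Qed.

Definition swap_pair (T U : Type) (z : T * U) : U * T := (z.2, z.1).

Lemma csmb_swap (T U : choiceType) (f : T * U -> R[i]) :
  csmb f -> csmb (fun z : U * T => f (z.2, z.1)).
Proof.
by move=> sf; apply: (csmb_inj (e := @swap_pair U T)) sf => -[a b] [c d] [-> ->].
Qed.

Lemma csum_swap (T U : choiceType) (f : T * U -> R[i]) : csmb f ->
  csum (fun x => csum (fun y => f (x, y))) = csum (fun y => csum (fun x => f (x, y))).
Proof.
move=> sf; rewrite -csum_pair// -(csum_pair (f := fun z => f (z.2, z.1)))//; last exact: csmb_swap.
by apply: (csum_bij (e := @swap_pair U T) (e' := @swap_pair T U)) => -[].
Qed.

Lemma csmb_prod (T U : choiceType) (f : T -> R[i]) (g : U -> R[i]) :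
  csmb f -> csmb g -> csmb (fun z : T * U => f z.1 * g z.2).
Proof.
move=> sf sg; apply: (eq_summ (f := fun z : T * U => nrm (f z.1) * nrm (g z.2))) => [z|].
  by rewrite nrmM.
by apply: (@summ_prod R T U (fun x => nrm (f x)) (fun y => nrm (g y))) => // x; exact: nrm_ge0.
Qed.

Lemma csum_nat (f : nat -> R[i]) : csmb f ->
  ctends (fun n => \sum_(0 <= i < n) f i) (csum f).
Proof.
move=> sf; apply: (@eq_ctends _ (fun n => csum (fun i => if (i < n)%N then f i else 0))).
  move=> n; rewrite (@csum_fin _ (index_iota 0 n)) ?iota_uniq//.
    rewrite big_seq [RHS]big_seq; apply: eq_bigr => i; rewrite mem_index_iota => /andP[_ ->]//.
  by move=> i; rewrite mem_index_iota /= => /negPf ->.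
apply: tannery sf _ _ => [n i|i]; first by case: ifP => // _; rewrite nrm0 nrm_ge0.
by move=> e e0; exists i.+1 => n ->; rewrite subrr nrm0.
Qed.

Lemma lim_csum (P : pred nat) (f : nat -> R[i]) : csmb (fun i => if P i then f i else 0) ->
  \big[+%R/0]_(0 <= i <oo | P i) f i = csum (fun i => if P i then f i else 0).
Proof.
move=> sf; apply/cvg_lim; first exact: norm_hausdorff.
apply/cvgrPdist_lt => e e0.
(* In [R[i]] the hypothesis [0 < e] forces [e] to be real. *)
have e1 : e = (Re e)%:C by move: e0; rewrite ltcE /= => /andP[/eqP]; case: (e) => a b /= ->.
have e2 : 0 < Re e by move: e0; rewrite {1}e1 ltcR.
have [N hN] := csum_nat sf e2; exists N => // n /hN h.
by rewrite /= distrC nrmE e1 ltcR big_mkcond.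
Qed.

End ComplexSums.

(** * Sums over the integers: shifts, reflections, residue classes *)

Section IntegerSums.
Variable R : realType.
Implicit Types f g : int -> R[i].

Lemma csum_shift (k : int) f : csum f = csum (fun n => f (n + k)).
Proof.
by apply: (csum_bij (e := fun n => n + k) (e' := fun n => n - k)) => n; rewrite ?addrK ?subrK.
Qed.

Lemma csum_refl (k : int) f : csum f = csum (fun n => f (k - n)).
Proof.
by apply: (csum_bij (e := fun n => k - n) (e' := fun n => k - n)) => n; rewrite subKr.
Qed.

Lemma csmb_shift (k : int) f : csmb f -> csmb (fun n => f (n + k)).
Proof. by apply: csmb_inj => m n; exact: addIr. Qed.

Lemma csmb_refl (k : int) f : csmb f -> csmb (fun n => f (k - n)).
Proof. by apply: csmb_inj => m n /addrI/oppr_inj. Qed.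

Lemma self_opp_eq0 (x : R[i]) : x = - x -> x = 0.
Proof. by move=> h; apply/eqP; have /eqP := subrr x; rewrite {2}h opprK -mulr2n mulrn_eq0. Qed.

(** The source of all cancellations below, both in Bailey sequences ([bp_anti]) and in theta series
    ([csum_sg_anti]). *)
Lemma csum_anti (k : int) f : (forall n, f (k - n) = - f n) -> csum f = 0.
Proof.
by move=> fk; apply: self_opp_eq0; rewrite {1}(csum_refl k) -csumN; apply: eq_csum.
Qed.

Definition zrange (lo hi : int) : seq int := [seq lo + i%:Z | i <- iota 0 `|hi - lo|%N.+1].

Lemma mem_zrange lo hi n : lo <= n <= hi -> n \in zrange lo hi.
Proof.
move=> /andP[l h]; apply/mapP; exists `|n - lo|%N; first by rewrite mem_iota; lia.
by lia.
Qed.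

Lemma csmb_range (lo hi : int) f : (forall n, f n != 0 -> lo <= n <= hi) -> csmb f.
Proof.
move=> h; apply: (@csmb_fin _ _ (zrange lo hi)) => n nin.
by apply/eqP/negPn/negP => /h /mem_zrange; apply/negP.
Qed.

Lemma csmb_box (lo hi lo' hi' : int) (f : int * int -> R[i]) :
  (forall m n, f (m, n) != 0 -> (lo <= m <= hi) && (lo' <= n <= hi')) -> csmb f.
Proof.
move=> h; apply: (@csmb_fin _ _ [seq (m, n) | m <- zrange lo hi, n <- zrange lo' hi']) => -[m n] nin.
apply/eqP/negPn/negP => /h /andP[/mem_zrange h1 /mem_zrange h2].
by move/negP: nin; apply; apply/allpairsP; exists (m, n).
Qed.

Lemma csum_fold (M : nat) f : (0 < M)%N -> csmb f ->
  csum f = \sum_(k < M) csum (fun r => f (M%:Z * r + (k : nat)%:Z)).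
Proof.
move=> M0 sf; pose e (z : 'I_M * int) : int := M%:Z * z.2 + (z.1 : nat)%:Z.
have Mp : (0 : int) < M by [].
have ie : injective e.
  move=> [k r] [k' r']; rewrite /e /= => h.
  have hk := ltn_ord k; have hk' := ltn_ord k'.
  have rr : r = r' by nia.
  by rewrite rr in h *; congr (_, _); apply: val_inj => /=; lia.
have se : csmb (fun z => f (e z)) by exact: csmb_inj.
rewrite (csum_supp (e := e))//; last first.
  move=> t ht; exfalso.
  have Mn : M%:Z != 0 by rewrite gt_eqF.
  have h : (`|(t %% M)%Z| < M)%N by have := ltz_pmod t Mp; have := modz_ge0 t Mn; lia.
  apply: (ht (Ordinal h, (t %/ M)%Z)); rewrite /e /= gez0_abs ?modz_ge0//.
  by rewrite mulrC -divz_eq.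
rewrite csum_pair// (csum_fin (s := index_enum 'I_M)) ?index_enum_uniq//.
by move=> k; rewrite mem_index_enum.
Qed.

End IntegerSums.

(** * Estimates for real powers and products *)

Section RealPowers.
Variable R : realType.
Implicit Types x : R.

Lemma expr_le_inv x n : 0 <= x -> x < 1 -> x ^+ n <= (1 - x)^-1 / n.+1%:R.
Proof.
move=> x0 x1; rewrite ler_pdivlMr ?ltr0n//; apply: le_trans (sum_geo_le n.+1 x0 x1).
rewrite mulr_natr -[n.+1 in leLHS]card_ord -sumr_const; apply: ler_sum => i _.
by apply: ler_wiXn2l => //; [exact: ltW | rewrite -ltnS].
Qed.

Lemma exprz_le x (m n : int) : 0 < x -> x <= 1 -> n <= m -> x ^ m <= x ^ n.
Proof.
move=> x0 x1 nm; rewrite -(subrK n m) expfzDr ?gt_eqF//.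
rewrite ger_pMl ?exprz_gt0//; have : 0 <= m - n by lia.
by case: (m - n) => // k _; rewrite -exprnP exprn_ile1// ltW.
Qed.

Lemma summ_quad x (B : int) : 0 < x -> x < 1 -> summ (fun j : int => x ^ (j * j + B * j)).
Proof.
(* With t = |j| and m = |B| + 1, the inequality j^2 + B j >= t - m^2 follows from t^2 - m t + m^2 >=
   0. *)
move=> x0 x1; pose C : int := - (`|B| + 1) * (`|B| + 1).
apply: (@summ_le _ _ _ (fun j : int => x ^ C * x ^+ `|j|%N)).
  move=> j; rewrite exprnP -expfzDr ?gt_eqF//; apply: exprz_le => //; first exact: ltW.
  by rewrite /C; nia.
by apply: summZ => [|j|]; rewrite ?exprz_ge0 ?exprn_ge0 ?(ltW x0)//; apply: summ_geoz => //; exact: ltW.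
Qed.

(** 1/(1 - y) = 1 + y/(1 - y) <= 1 + y/(1 - r) <= exp(y/(1 - r)). *)
Lemma expR_ge_inv (y r : R) : 0 <= y -> y <= r -> r < 1 -> expR (- (y / (1 - r))) <= 1 - y.
Proof.
move=> y0 yr r1; have p : 0 < 1 - y by lra.
have p1 : 0 < 1 - r by lra.
rewrite expRN -[leRHS]invrK lef_pV2 ?posrE ?expR_gt0 ?invr_gt0//.
apply: le_trans (expR_ge1Dx _).
rewrite -div1r ler_pdivrMr// mulrDl mul1r -[leLHS](subrK y) lerD2l.
by rewrite mulrAC ler_pdivlMr//; nra.
Qed.

(** The bound is uniform in [n]; through it infinite products stay away from 0. *)
Lemma prod_lower (r : R) n : 0 <= r -> r < 1 ->
  expR (- ((1 - r)^-1 * (1 - r)^-1)) <= \prod_(k < n) (1 - r ^+ k.+1).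
Proof.
move=> r0 r1; apply: (le_trans (y := \prod_(k < n) expR (- (r ^+ k.+1 / (1 - r))))).
  rewrite -expR_sum ler_expR sumrN lerN2 -mulr_suml ler_wpM2r//.
    by rewrite invr_ge0; lra.
  apply: le_trans (sum_geo_le n r0 r1); apply: ler_sum => i _.
  by apply: ler_wiXn2l => //; exact: ltW.
apply: ler_prod => i _; rewrite expR_ge0/=; apply: expR_ge_inv => //; first by rewrite exprn_ge0.
by rewrite -[leRHS]expr1; apply: ler_wiXn2l => //; exact: ltW.
Qed.

Lemma prod_upper (r : R) n : 0 <= r -> r < 1 ->
  \prod_(k < n) (1 + r ^+ k) <= expR ((1 - r)^-1).
Proof.
move=> r0 r1; apply: (le_trans (y := \prod_(k < n) expR (r ^+ k))).
  by apply: ler_prod => i _; rewrite expR_ge1Dx andbT addr_ge0// exprn_ge0.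
by rewrite -expR_sum ler_expR; exact: sum_geo_le.
Qed.

End RealPowers.

(** * Infinite products and Bailey pairs *)

Section InfiniteProducts.
Variable R : realType.
Variable q : R[i].
Hypotheses (q0 : q != 0) (q1 : nrm q < 1).
Implicit Types a : R[i].

Lemma nrm_q_gt0 : 0 < nrm q. Proof. exact: nrm_gt0. Qed.

Lemma nrm_expr_lt1 n : (0 < n)%N -> nrm (q ^+ n) < 1.
Proof. by move=> n0; rewrite nrmX exprn_ilt1 ?nrm_ge0 -?lt0n. Qed.

Lemma sub_expr_neq0 n : (0 < n)%N -> 1 - q ^+ n != 0.
Proof.
move=> n0; rewrite subr_eq0; apply/eqP => h.
by have := nrm_expr_lt1 n0; rewrite -h nrm1 ltxx.
Qed.

Lemma ctends_expr : ctends (fun n => q ^+ n) 0.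
Proof.
apply: (@ctends_of_inv _ _ _ ((1 - nrm q)^-1)) => n; rewrite subr0 nrmX.
by apply: expr_le_inv => //; exact: nrm_ge0.
Qed.

Lemma qpochS a p n : qpoch a p n.+1 = qpoch a p n * (1 - a * p ^+ n).
Proof. by rewrite /qpoch big_nat_recr. Qed.

Lemma qpoch0 a p : qpoch a p 0 = 1. Proof. by rewrite /qpoch big_geq. Qed.

Lemma nrm_qpoch_ge (r : R) a n : r < 1 -> nrm q <= r -> nrm a <= r ->
  expR (- ((1 - r)^-1 * (1 - r)^-1)) <= nrm (qpoch a q n).
Proof.
move=> r1 qr ar; have r0 : 0 <= r := le_trans (nrm_ge0 _) qr.
apply: (le_trans (prod_lower n r0 r1)).
rewrite /qpoch big_mkord nrm_prod; apply: ler_prod => i _.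
apply/andP; split; first by rewrite subr_ge0 exprn_ile1// ltW.
have h : nrm (a * q ^+ i) <= r ^+ i.+1.
  by rewrite nrmM nrmX exprS ler_pM ?exprn_ge0 ?nrm_ge0// lerXn2r ?nnegrE ?nrm_ge0.
have := nrm_triangle (1 - a * q ^+ i) (a * q ^+ i); rewrite subrK nrm1; lra.
Qed.

Lemma nrm_qpoch_le a n : nrm a <= 1 -> nrm (qpoch a q n) <= expR ((1 - nrm q)^-1).
Proof.
move=> a1; apply: le_trans (prod_upper n (nrm_ge0 q) q1).
rewrite /qpoch big_mkord nrm_prod; apply: ler_prod => i _; rewrite nrm_ge0/=.
apply: (le_trans (nrmB_triangle _ _)); rewrite nrm1 lerD2l nrmM nrmX.
by rewrite ger_pMl ?exprn_gt0// nrm_q_gt0.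
Qed.

Definition qbd : R := expR ((1 - nrm q)^-1 * (1 - nrm q)^-1).

Lemma qbd_ge0 : 0 <= qbd. Proof. exact: expR_ge0. Qed.

Lemma qpoch_neq0 (r : R) a n : r < 1 -> nrm q <= r -> nrm a <= r -> qpoch a q n != 0.
Proof.
move=> r1 qr ar; rewrite -nrm_eq0 gt_eqF//.
exact: lt_le_trans (expR_gt0 _) (nrm_qpoch_ge n r1 qr ar).
Qed.

Lemma qq_neq0 n : qpoch q q n != 0. Proof. exact: (@qpoch_neq0 (nrm q)). Qed.

Lemma nrm_qq_inv n : nrm (qpoch q q n)^-1 <= qbd.
Proof.
have h := nrm_qpoch_ge (a := q) n q1 (lexx _) (lexx _).
rewrite nrmV /qbd -[leRHS]invrK -expRN lef_pV2 ?posrE ?expR_gt0//.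
exact: lt_le_trans (expR_gt0 _) h.
Qed.

(** The product (a; q)_oo, introduced through Euler's series so that summing one index of a triple
    sum is a rewriting step; [qinf_lim] identifies it with the limit of the finite products. *)
Fact qinf_spec : {f : R[i] -> R[i] | forall a,
  f a = csum (fun i : nat => q ^+ 'C(i, 2) * (- a) ^+ i / qpoch q q i)}.
Proof. by eexists. Qed.
Definition qinf : R[i] -> R[i] := sval qinf_spec.
Lemma qinfE a : qinf a = csum (fun i : nat => q ^+ 'C(i, 2) * (- a) ^+ i / qpoch q q i).
Proof. exact: (svalP qinf_spec). Qed.

Lemma bin2_ge i : (i.-1 <= 'C(i, 2))%N.
Proof. by case: i => [|[|i]]//; rewrite bin2/= ; nia. Qed.

Lemma qinf_bound a i : nrm a <= 1 ->
  nrm (q ^+ 'C(i, 2) * (- a) ^+ i / qpoch q q i) <= qbd / nrm q * nrm q ^+ i.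
Proof.
move=> a1; rewrite !nrmM !nrmX nrmN.
have x0 := nrm_q_gt0.
have h1 : nrm q ^+ 'C(i, 2) <= (nrm q)^-1 * nrm q ^+ i.
  case: i => [|i]; first by rewrite bin0n !expr0 mulr1 invf_ge1// ltW.
  rewrite exprS mulKf ?gt_eqF//; apply: ler_wiXn2l; rewrite ?nrm_ge0 ?ltW//.
  exact: bin2_ge.
have h2 : nrm a ^+ i <= 1 by rewrite exprn_ile1// nrm_ge0.
have h3 := nrm_qq_inv i.
rewrite mulrC mulrAC -!mulrA; apply: ler_pM => //; rewrite ?nrm_ge0//.
  by rewrite mulr_ge0 ?exprn_ge0 ?nrm_ge0.
rewrite [leRHS]mulrC; apply: le_trans h1.
by rewrite ger_pMr// exprn_gt0.
Qed.

Lemma summ_qinf_bound : summ (fun i : nat => qbd / nrm q * nrm q ^+ i).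
Proof.
apply: summZ => [|i|]; rewrite ?exprn_ge0 ?nrm_ge0//.
  by rewrite divr_ge0 ?qbd_ge0 ?nrm_ge0.
by apply: summ_geo => //; exact: nrm_ge0.
Qed.

Lemma csmb_qinf a : nrm a <= 1 ->
  csmb (fun i : nat => q ^+ 'C(i, 2) * (- a) ^+ i / qpoch q q i).
Proof. by move=> a1; apply: csmb_le summ_qinf_bound _ => i; exact: qinf_bound. Qed.

Lemma csum_recl (f : nat -> R[i]) : csmb f -> csum f = f 0%N + csum (fun i => f i.+1).
Proof.
move=> sf; pose g i := if i == 0%N then 0 else f i.
have -> : csum (fun i => f i.+1) = csum g.
  by rewrite [RHS](csum_supp (e := S)) => [//|i j []//|[//|i] h]; case: (h i).
rewrite -[f 0%N in RHS](@csum_single _ _ 0%N (fun i => if i == 0%N then f i else 0)); last by move=> i /negPf ->.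
rewrite -csumD; first by apply: eq_csum => i; rewrite /g; case: ifP => _; rewrite ?addr0 ?add0r.
  by apply: (@csmb_single _ _ 0%N) => i /negPf ->.
apply: (csmb_le sf) => i; rewrite /g; case: ifP => _; last exact: lexx.
by rewrite nrm0 nrm_ge0.
Qed.

(** Coefficientwise, 1 - q^(i+1) cancels the last factor of (q;q)_(i+1), so the series at [a] minus
    the series at [a * q] is [- a] times the latter. *)
Lemma qinf_rec a : nrm a <= 1 -> qinf a = (1 - a) * qinf (a * q).
Proof.
move=> a1; have aq1 : nrm (a * q) <= 1.
  by rewrite nrmM -[1]mulr1 ler_pM ?nrm_ge0// ltW.
have s1 := csmb_qinf a1; have s2 := csmb_qinf aq1.
have h : qinf a - qinf (a * q) = - a * qinf (a * q).
  rewrite !qinfE -(csumB s1 s2) csum_recl; last exact: (csmbB s1 s2).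
  rewrite bin0n !expr0 subrr add0r -csumZ//; apply: eq_csum => i.
  have := sub_expr_neq0 (ltn0Sn i); have := qq_neq0 i.
  rewrite binS bin1 exprD qpochS !exprS -[- (a * q)]mulNr exprMn.
  move: (qpoch q q i) (q ^+ i) (q ^+ 'C(i, 2)) ((- a) ^+ i) => x y z t x0 y0.
  by field; rewrite x0 y0.
by rewrite mulrBl mul1r -mulNr -h addrC subrK.
Qed.

Lemma nrm_mulX_le a n : nrm a <= 1 -> nrm (a * q ^+ n) <= 1.
Proof.
move=> a1; rewrite nrmM nrmX -[1]mulr1 ler_pM ?exprn_ge0 ?nrm_ge0//.
by rewrite exprn_ile1 ?nrm_ge0// ltW.
Qed.

Lemma qinf_poch a n : nrm a <= 1 -> qinf a = qpoch a q n * qinf (a * q ^+ n).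
Proof.
move=> a1; elim: n => [|n IH]; first by rewrite qpoch0 mul1r expr0 mulr1.
rewrite IH qpochS [in LHS]qinf_rec; last exact: nrm_mulX_le.
by rewrite mulrA -(mulrA a) -exprSr.
Qed.

(** Iterating the recursion leaves the factor [qinf (a * q ^+ n)], which tends to 1 by Tannery's
    theorem: only the term i = 0 survives. The finite products are bounded, so they have the same
    limit as their product with that factor. *)
Lemma qinf_lim a : nrm a <= 1 -> ctends (fun n => qpoch a q n) (qinf a).
Proof.
move=> a1.
have h : ctends (fun n => qinf (a * q ^+ n)) 1.
  have -> : 1 = csum (fun i : nat => if i == 0%N then 1 else 0) :> R[i].
    by rewrite (@csum_single _ _ 0%N) => [|i /negPf ->].
  under [X in ctends X _]eq_fun do rewrite qinfE.
  apply: tannery summ_qinf_bound _ _ => [n i|[|i]].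
  - by apply: qinf_bound; exact: nrm_mulX_le.
  - by rewrite /=; apply: eq_ctends (ctends_cst 1) => n; rewrite bin0n !expr0 qpoch0 mulr1 invr1 mulr1.
  have := ctendsM (ctendsZ ((- a) ^+ i.+1 * q ^+ 'C(i.+1, 2) / qpoch q q i.+1) ctends_expr)
    (ctends_cst 1).
  rewrite mulr0 mul0r /= => h e e0; have [N hN] := h e e0; exists N => n /hN.
  rewrite !subr0; apply: le_lt_trans.
  rewrite mulr1 -mulNr exprMn !nrmM [leLHS](_ : _ = (nrm ((- a) ^+ i.+1) * nrm (q ^+ 'C(i.+1, 2)) *
     nrm (qpoch q q i.+1)^-1) * nrm ((q ^+ n) ^+ i.+1)); last by ring.
  rewrite ler_wpM2l ?mulr_ge0 ?nrm_ge0// exprSr nrmM ger_pMl ?nrm_gt0 ?expf_neq0//.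
  by rewrite !nrmX exprn_ile1 ?exprn_ge0 ?nrm_ge0// exprn_ile1 ?nrm_ge0// ltW.
apply: (@ctends_dist0 _ _ _ (fun=> qinf a)); last exact: ctends_cst.
have h2 : ctends (fun n => 1 - qinf (a * q ^+ n)) 0.
  by have := ctendsB (ctends_cst 1) h; rewrite subrr.
move=> e e0; pose K := expR ((1 - nrm q)^-1); have K0 : 0 < K := expR_gt0 _.
have [N hN] := h2 _ (divr_gt0 e0 K0); exists N => n /hN; rewrite !subr0 => hn.
rewrite (qinf_poch n a1) -[X in X - _]mulr1 -mulrBr nrmM.
apply: (le_lt_trans (y := K * nrm (1 - qinf (a * q ^+ n)))).
  by rewrite ler_wpM2r ?nrm_ge0// nrm_qpoch_le.
by rewrite mulrC -ltr_pdivlMr.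
Qed.

Lemma qinf_neq0 (r : R) a : r < 1 -> nrm q <= r -> nrm a <= r -> qinf a != 0.
Proof.
move=> r1 qr ar; rewrite -nrm_eq0 gt_eqF//.
have h : expR (- ((1 - r)^-1 * (1 - r)^-1)) <= nrm (qinf a).
  apply: (ctends_ge (qinf_lim _)) => [|n]; first by apply: le_trans ar _; exact: ltW.
  exact: nrm_qpoch_ge.
exact: lt_le_trans (expR_gt0 _) h.
Qed.

Lemma qqinf_neq0 : qinf q != 0. Proof. exact: (@qinf_neq0 (nrm q)). Qed.

(* [rq n] is $1/(q;q)_n$, extended by $0$ to negative [n]. *)
Definition rq (n : int) : R[i] := if n is Posz m then (qpoch q q m)^-1 else 0.

Lemma rq_neg n : n < 0 -> rq n = 0. Proof. by case: n. Qed.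

Lemma rq_neq0_ge0 n : rq n != 0 -> 0 <= n.
Proof. by case: n => //= n; rewrite eqxx. Qed.

Lemma rq0 : rq 0 = 1. Proof. by rewrite /= qpoch0 invr1. Qed.

(** Extension by 0 makes this hold for every integer: at n = 0 both sides vanish. Hence the
    recursions below have no boundary terms. *)
Lemma rq_rec n : rq n * (1 - q ^ n) = rq (n - 1).
Proof.
case: n => [[|n]|n]; rewrite ?expr0z ?subrr ?mulr0 ?mul0r//.
have -> : n.+1%:Z - 1 = n by lia.
rewrite /rq -exprnP qpochS -exprS /=; have h1 := sub_expr_neq0 (ltn0Sn n); have h2 := qq_neq0 n.
by field; rewrite h1 h2.
Qed.

Lemma nrm_rq n : nrm (rq n) <= qbd.
Proof. by case: n => n; [exact: nrm_qq_inv | rewrite nrm0; exact: qbd_ge0]. Qed.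

Lemma ctends_rq (j : int) : ctends (fun n : nat => rq (n%:Z - j)) (qinf q)^-1.
Proof.
have h : ctends (fun n : nat => rq n) (qinf q)^-1.
  have qn1 : nrm q <= 1 by exact: ltW.
  move=> e e0; have l0 := nrm_gt0 qqinf_neq0.
  have d0 : 0 < e * nrm (qinf q) / (qbd + 1).
    by rewrite divr_gt0 ?mulr_gt0// ltr_wpDl ?qbd_ge0.
  have [N hN] := qinf_lim qn1 d0; exists N => n /hN hn /=.
  have -> : (qpoch q q n)^-1 - (qinf q)^-1 =
     (qpoch q q n)^-1 * ((qinf q) - qpoch q q n) * (qinf q)^-1.
    by field; rewrite qq_neq0 qqinf_neq0.
  rewrite !nrmM nrmV (nrmV (qinf q)) ltr_pdivrMr// nrm_sub_sym -nrmV.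
  apply: (le_lt_trans (y := (qbd + 1) * nrm (qpoch q q n - qinf q))).
    rewrite ler_wpM2r ?nrm_ge0//; apply: le_trans (nrm_qq_inv n) _; by rewrite lerDl.
  by rewrite mulrC -ltr_pdivlMr// ltr_wpDl ?qbd_ge0.
move=> e e0; have [N hN] := h e e0; exists (N + `|j|)%N => n Nn.
have -> : n%:Z - j = `|n%:Z - j|%N by lia.
by apply: hN; lia.
Qed.

End InfiniteProducts.

Lemma quad_ge (c m : int) : - (`|c| * `|c|) <= m * m + c * m.
Proof. by nia. Qed.

(** * Bailey pairs and Bailey's lemma *)

Section Bailey.
Variable R : realType.
Variable q : R[i].
Hypotheses (q0 : q != 0) (q1 : nrm q < 1).
Implicit Types (g h w : int -> R[i]) (c k n r : int).
Local Notation rq := (rq q).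

Lemma qzD (m n : int) : q ^ (m + n) = q ^ m * q ^ n.
Proof. exact: expfzDr. Qed.

Lemma sub_exprz_neq0 n : 0 < n -> 1 - q ^ n != 0.
Proof. by case: n => // n; exact: sub_expr_neq0. Qed.

Lemma rq_recS n : rq (n + 1) * (1 - q ^ (n + 1)) = rq n.
Proof. by rewrite (rq_rec q0 q1) addrK. Qed.

(** The q-Vandermonde sum, by induction on [A] after multiplication by 1 - q^(A+1) = (1 - q^(A+1-j))
    + q^(A+1-j) (1 - q^j). The first part lowers the index of [rq (A + 1 - j)] and gives the case
    (A, B); the second lowers that of [rq j] and, after j -> j + 1, gives the case (A, B + 1). *)
Lemma vandermonde_nat (A : nat) (B : int) :
  csum (fun j : int => q ^ (j * j + B * j) * rq (A%:Z - j) * rq j * rq (j + B)) =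
  rq A * rq (A%:Z + B).
Proof.
have fin (A' : nat) B' (w : int -> R[i]) (x y : int -> int) : csmb (fun j : int => w j * rq (A'%:Z - j) * rq j * rq (j + B')).
  apply: (@csmb_range _ 0 A') => j; rewrite !mulf_eq0 !negb_or => /andP[/andP[/andP[_ h1] h2] _].
  by have := rq_neq0_ge0 h1; have := rq_neq0_ge0 h2; lia.
elim: A B => [|A IH] B.
  rewrite (@csum_single _ _ 0).
    have -> : rq 0%N = 1 by exact: rq0.
    by rewrite !mulr0 addr0 expr0z !mul1r !add0r.
  move=> j j0; have [jn|jp] := ltP j 0; first by rewrite (rq_neg _ jn) mulr0 mul0r.
  by rewrite (@rq_neg _ _ (0 - j)) ?mulr0 ?mul0r//; lia.
have A1 : 1 - q ^ A.+1 != 0 by apply: sub_exprz_neq0.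
apply: (mulfI A1); rewrite -csumZ; last exact: fin.
pose g (j : int) := q ^ (j * j + B * j) * rq (A%:Z - j) * rq j * rq (j + B).
pose h (j : int) := q ^ (A.+1%:Z - j + j * j + B * j) * rq (A.+1%:Z - j) * rq (j - 1) * rq (j + B).
have sg : csmb g by exact: fin.
have hS : (fun j => h (j + 1)) = (fun j => q ^ (A.+1%:Z + B) * (q ^ (j * j + (B + 1) * j) * rq (A%:Z - j) * rq j * rq (j + (B + 1)))).
  apply/funext => j; rewrite /h !mulrA -qzD addrK.
  rewrite (_ : A.+1%:Z - (j + 1) = A%:Z - j); last by lia.
  rewrite (_ : j + 1 + B = j + (B + 1)); last by ring.
  congr (q ^ _ * _ * _ * _); rewrite -[A.+1%:Z]/((A.+1)%:Z) -addn1 PoszD; ring.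
have sh : csmb h.
  have := csmb_shift (-1) (f := fun j => h (j + 1)); rewrite hS => H.
  apply: eq_csmb (H _) => [j|]; last by apply: csmbZ; exact: fin.
  by rewrite subrK.
have -> : (fun j => (1 - q ^ A.+1) * (q ^ (j * j + B * j) * rq (A.+1%:Z - j) * rq j * rq (j + B))) = (fun j => g j + h j).
  apply/funext => j; rewrite /g /h.
  have -> : rq (A%:Z - j) = rq (A.+1%:Z - j) * (1 - q ^ (A.+1%:Z - j)).
    by rewrite (rq_rec q0 q1); congr (rq _); lia.
  rewrite -(rq_rec q0 q1 j) (_ : A.+1%:Z - j + j * j + B * j = (A.+1%:Z - j) + (j * j + B * j)); last by ring.
  rewrite (qzD (A.+1%:Z - j) (j * j + B * j)).
  have -> : q ^ A.+1 = q ^ (A.+1%:Z - j) * q ^ j by rewrite -qzD subrK.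
  move: (q ^ (A.+1%:Z - j)) (q ^ j) (q ^ (j * j + B * j)) (rq _) (rq j) (rq _) => x y z t u v.
  by ring.
rewrite csumD// IH (csum_shift 1 h) hS csumZ ?IH; last exact: fin.
rewrite -(rq_recS A) -[A%:Z + 1]/((A + 1)%:Z) addn1.
have -> : A%:Z + (B + 1) = A.+1%:Z + B by lia.
have -> : rq (A%:Z + B) = rq (A.+1%:Z + B) * (1 - q ^ (A.+1%:Z + B)).
  by rewrite (rq_rec q0 q1); congr (rq _); lia.
move: (q ^ A.+1) (q ^ (A.+1%:Z + B)) (rq _) (rq _) => x y z t.
by ring.
Qed.

(** The shift k -> k + r reduces this to [vandermonde_nat] with A = n - r and B = 2 r + c. For n < r
    both sides vanish termwise. *)
Lemma vandermonde n r c :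
  csum (fun k => q ^ (k * k + c * k) * rq (n - k) * (rq (k - r) * rq (k + r + c))) =
  q ^ (r * r + c * r) * (rq (n - r) * rq (n + r + c)).
Proof.
have [nr|nr] := ltP (n - r) 0.
  rewrite (rq_neg _ nr) mul0r mulr0; apply: csum_eq0 => k.
  have [kn|kn] := ltP (n - k) 0; first by rewrite (rq_neg _ kn) mulr0 mul0r.
  by rewrite (@rq_neg _ _ (k - r)) ?mul0r ?mulr0//; lia.
rewrite (csum_shift r).
have := vandermonde_nat `|n - r|%N (r + r + c); rewrite gez0_abs// => h.
rewrite (_ : n + r + c = n - r + (r + r + c)); last by ring.
rewrite -h -csumZ; last first.
  apply: (@csmb_range _ 0 (n - r)) => j; rewrite !mulf_eq0 !negb_or => /andP[/andP[/andP[_ h1] h2] _].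
  by have := rq_neq0_ge0 h1; have := rq_neq0_ge0 h2; lia.
apply: eq_csum => j; rewrite addrK !mulrA -qzD.
rewrite (_ : n - (j + r) = n - r - j); last by ring.
rewrite (_ : j + r + r + c = j + (r + r + c)); last by ring.
by congr (q ^ _ * _ * _ * _); ring.
Qed.

Lemma csmb_quad c : csmb (fun k => q ^ (k * k + c * k)).
Proof.
apply: csmb_le (summ_quad c (nrm_gt0 q0) q1) _ => k.
by rewrite nrm_exprz.
Qed.

Lemma csmb_quad_rq c (u v : int -> int) :
  csmb (fun k => q ^ (k * k + c * k) * (rq (u k) * rq (v k))).
Proof.
apply: eq_csmb (csmb_mul_bounded (K := qbd q * qbd q) _ (csmb_quad c)).
  by move=> k; rewrite mulrC.
by move=> k; rewrite nrmM ler_pM ?nrm_ge0 ?nrm_rq.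
Qed.

(** The limit n -> oo of [vandermonde], by Tannery's theorem; one of the two factors 1/(q;q)_oo on
    the right cancels against the one on the left. *)
Lemma vandermonde_lim r c :
  csum (fun k => q ^ (k * k + c * k) * (rq (k - r) * rq (k + r + c))) =
  q ^ (r * r + c * r) / qinf q q.
Proof.
have Q0 := qqinf_neq0 q0 q1.
have lr := ctends_rq q0 q1.
have L : ctends (fun n : nat => csum (fun k => q ^ (k * k + c * k) * rq (n%:Z - k) * (rq (k - r) * rq (k + r + c))))
  (csum (fun k => (qinf q q)^-1 * (q ^ (k * k + c * k) * (rq (k - r) * rq (k + r + c))))).
  have sq : summ (fun k => qbd q * nrm (q ^ (k * k + c * k) * (rq (k - r) * rq (k + r + c)))).
    by apply: summZ => [|k|]; rewrite ?qbd_ge0 ?nrm_ge0//; exact: csmb_quad_rq.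
  apply: (tannery sq) => [n k|k].
    rewrite mulrAC mulrC nrmM; apply: ler_pM; rewrite ?nrm_ge0//; exact: nrm_rq.
  have := ctendsM (lr k) (ctends_cst (q ^ (k * k + c * k) * (rq (k - r) * rq (k + r + c)))).
  by apply: eq_ctends => n; rewrite mulrAC [RHS]mulrC.
have L2 : ctends (fun n : nat => q ^ (r * r + c * r) * (rq (n%:Z - r) * rq (n%:Z + r + c)))
  (q ^ (r * r + c * r) * ((qinf q q)^-1 * (qinf q q)^-1)).
  apply: ctendsZ; apply: ctendsM; first exact: lr.
  by apply: eq_ctends (lr (- r - c)) => n; congr (rq _); ring.
have := ctends_uniq (eq_ctends (fun n : nat => vandermonde n r c) L) L2.
rewrite csumZ; last exact: csmb_quad_rq.
by rewrite mulrCA => /(mulfI (invr_neq0 Q0)).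
Qed.

(** With m = k + r + c + 1, the identity 1/(q;q)_m = 1/(q;q)_(m-1) + q^m/(q;q)_m gives two instances
    of [vandermonde_lim], with parameters c and c + 1. *)
Lemma vandermonde_lim_mixed r c :
  csum (fun k => q ^ (k * k + c * k) * (rq (k - r) * rq (k + r + (c + 1)))) =
  (q ^ (r * r + c * r) + q ^ ((r + 1) * (r + 1 + c))) / qinf q q.
Proof.
have -> : (fun k => q ^ (k * k + c * k) * (rq (k - r) * rq (k + r + (c + 1)))) =
  (fun k => q ^ (k * k + c * k) * (rq (k - r) * rq (k + r + c)) +
    q ^ (r + c + 1) * (q ^ (k * k + (c + 1) * k) * (rq (k - r) * rq (k + r + (c + 1))))).
  apply/funext => k; have -> : rq (k + r + c) = rq (k + r + (c + 1)) * (1 - q ^ (k + r + (c + 1))).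
    by rewrite (rq_rec q0 q1); congr (rq _); ring.
  rewrite (_ : k * k + (c + 1) * k = k * k + c * k + k); last by ring.
  rewrite (_ : k + r + (c + 1) = k + (r + c + 1)); last by ring.
  rewrite (qzD (k * k + c * k) k) (qzD k (r + c + 1)).
  move: (q ^ (k * k + c * k)) (q ^ k) (q ^ (r + c + 1)) (rq _) (rq _) => x y z t u.
  by ring.
rewrite csumD ?csumZ; [|exact: csmb_quad_rq|exact: csmb_quad_rq|apply: csmbZ; exact: csmb_quad_rq].
rewrite !vandermonde_lim [RHS]mulrDl; congr (_ + _); rewrite [LHS]mulrA -qzD.
by congr (q ^ _ / _); ring.
Qed.

(* Bailey pairs relative to [q ^ c] in symmetric form: [bp g c] is the
   $\beta$-sequence attached to the bilateral $\alpha$-sequence [g]. *)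
Definition bp g c k := csum (fun r => g r * (rq (k - r) * rq (k + r + c))).

Lemma bp_supp g c k r : g r * (rq (k - r) * rq (k + r + c)) != 0 -> - k - c <= r <= k.
Proof.
rewrite !mulf_eq0 !negb_or => /andP[_ /andP[h1 h2]].
by have := rq_neq0_ge0 h1; have := rq_neq0_ge0 h2; lia.
Qed.

Lemma csmb_bp g c k : csmb (fun r => g r * (rq (k - r) * rq (k + r + c))).
Proof. by apply: (@csmb_range _ (- k - c) k) => r; exact: bp_supp. Qed.

Lemma bp_neg g c k : 2 * k + c < 0 -> bp g c k = 0.
Proof.
move=> kc; apply: csum_eq0 => r; apply/eqP/negPn/negP => /bp_supp; lia.
Qed.

Lemma bpD g h c k : bp (fun r => g r + h r) c k = bp g c k + bp h c k.
Proof.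
rewrite /bp -csumD; [|exact: csmb_bp|exact: csmb_bp].
by apply: eq_csum => r; rewrite mulrDl.
Qed.

Lemma bpZ (x : R[i]) g c k : bp (fun r => x * g r) c k = x * bp g c k.
Proof.
by rewrite /bp -csumZ; [apply: eq_csum => r; rewrite -mulrA|exact: csmb_bp].
Qed.

(** The reflection r -> - c - r exchanges the two factors [rq]. *)
Lemma bp_anti g c k : (forall r, g (- c - r) = - g r) -> bp g c k = 0.
Proof.
move=> ga; apply: (@csum_anti _ (- c)) => r; rewrite ga.
rewrite (_ : k - (- c - r) = k + r + c); last by ring.
rewrite (_ : k + (- c - r) + c = k - r); last by ring.
by rewrite mulNr [rq _ * rq (k - r)]mulrC.
Qed.

(** Change of base from q^c to q^(c+1). The correction vanishes when q^r g(r) is antisymmetric for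
    the new base, which is how one sequence comes to serve two bases. *)
Lemma bp_lift g c k :
  bp g c k = bp g (c + 1) k - q ^ (k + c + 1) * bp (fun r => q ^ r * g r) (c + 1) k.
Proof.
rewrite /bp -csumZ; last exact: csmb_bp.
rewrite -csumB; [|exact: csmb_bp|by apply: csmbZ; exact: csmb_bp].
apply: eq_csum => r.
have -> : rq (k + r + c) = rq (k + r + (c + 1)) * (1 - q ^ (k + r + (c + 1))).
  by rewrite (rq_rec q0 q1); congr (rq _); ring.
rewrite (_ : q ^ (k + r + (c + 1)) = q ^ (k + c + 1) * q ^ r); last by rewrite -qzD; congr (q ^ _); ring.
move: (q ^ (k + c + 1)) (q ^ r) (g r) (rq _) (rq _) => x y z t u.
by ring.
Qed.

Lemma bp_lift_anti g c k : (forall r, q ^ (- (c + 1) - r) * g (- (c + 1) - r) = - (q ^ r * g r)) ->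
  bp g c k = bp g (c + 1) k.
Proof. by move=> ga; rewrite bp_lift (bp_anti _ ga) mulr0 subr0. Qed.

(** Here the factor split off is 1 - q^(k-r): the index drops by 1 while the base rises. *)
Lemma bp_down g c k :
  bp (fun r => q ^ r * g r) c k - q ^ k * bp g c k = bp (fun r => q ^ r * g r) (c + 1) (k - 1).
Proof.
rewrite /bp -csumZ; last exact: csmb_bp.
rewrite -csumB; [|exact: csmb_bp|by apply: csmbZ; exact: csmb_bp].
apply: eq_csum => r.
rewrite (_ : k - 1 - r = k - r - 1); last by ring.
rewrite (_ : k - 1 + r + (c + 1) = k + r + c); last by ring.
rewrite -(rq_rec q0 q1 (k - r)) (_ : q ^ k = q ^ (k - r) * q ^ r); last by rewrite -qzD subrK.
move: (q ^ (k - r)) (q ^ r) (g r) (rq _) (rq _) => x y z t u.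
by ring.
Qed.

(** 1 - q^(2k) = (1 - q^(k-r)) + q^(k-r) (1 - q^(k+r)), each bracket lowering one of the two factors
    [rq]. This is the recursion in k from which [pentagonal] and [bpF_succ] draw their
    beta-sequences. *)
Lemma bp_succ g k :
  (1 - q ^ (2 * k)) * bp g 0 k =
  bp g 1 (k - 1) + q ^ k * bp (fun r => q ^ r * g (- r)) 1 (k - 1).
Proof.
have -> : bp (fun r => q ^ r * g (- r)) 1 (k - 1) =
    csum (fun r => q ^ (- r) * g r * (rq (k - r - 1 + 1) * rq (k + r - 1))).
  rewrite /bp (csum_refl 0); apply: eq_csum => r; rewrite sub0r opprK.
  rewrite (_ : k - 1 + r = k + r - 1); last by ring.
  rewrite (_ : k - 1 - r + 1 = k - r - 1 + 1); last by ring.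
  by rewrite [rq _ * rq (k + r - 1)]mulrC.
have s : csmb (fun r => q ^ (- r) * g r * (rq (k - r - 1 + 1) * rq (k + r - 1))).
  apply: eq_csmb (csmb_bp (fun r => q ^ (- r) * g r) (-1) k) => r.
  by rewrite (_ : k - r - 1 + 1 = k - r)//; ring.
rewrite /bp -(csumZ _ s) -(csumZ _ (csmb_bp g 0 k)).
rewrite -(csumD (csmb_bp g 1 (k - 1)) (csmbZ _ s)).
apply: eq_csum => r; rewrite subrK addr0.
rewrite (_ : k - 1 - r = k - r - 1); last by ring.
rewrite (_ : k - 1 + r + 1 = k + r); last by ring.
rewrite -!(rq_rec q0 q1) (_ : 2 * k = (k - r) + (k + r)); last by ring.
rewrite qzD (_ : q ^ (- r) = q ^ (k - r) * q ^ (- k)); last by rewrite -qzD; congr (q ^ _); ring.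
have e : q ^ k * q ^ (- k) = 1 by rewrite -qzD subrr expr0z.
move: (q ^ (k - r)) (q ^ (k + r)) (g r) (rq _) (rq _) => x y z t u.
rewrite [q ^ k * (_ * _)](_ : _ = x * (q ^ k * q ^ (- k)) * z * (t * (u * (1 - y)))); last first.
  by move: (q ^ k) (q ^ (- k)) => a b; ring.
by rewrite e; ring.
Qed.

(** Interchange of the sums; the inner one is [vandermonde]. This is Bailey's lemma with both free
    parameters sent to infinity. *)
Lemma bailey_step g c n :
  csum (fun k => q ^ (k * k + c * k) * rq (n - k) * bp g c k) =
  bp (fun r => q ^ (r * r + c * r) * g r) c n.
Proof.
pose f (z : int * int) := q ^ (z.1 * z.1 + c * z.1) * rq (n - z.1) * (g z.2 * (rq (z.1 - z.2) * rq (z.1 + z.2 + c))).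
have sf : csmb f.
  apply: (@csmb_box _ (- `|n| - `|c|) n (- `|n| - `|c|) n) => k r.
  rewrite /f /= mulf_eq0 negb_or => /andP[+ /bp_supp h].
  by rewrite mulf_eq0 negb_or => /andP[_ /rq_neq0_ge0 h2]; lia.
transitivity (csum (fun k => csum (fun r => f (k, r)))).
  by apply: eq_csum => k; rewrite /bp -csumZ//; exact: csmb_bp.
rewrite (csum_swap sf) /bp; apply: eq_csum => r.
rewrite [RHS](_ : _ = g r * (q ^ (r * r + c * r) * (rq (n - r) * rq (n + r + c)))); last first.
  by move: (q ^ _) (g r) (rq _) (rq _) => x y z t; ring.
rewrite -vandermonde -csumZ; last first.
  apply: (@csmb_range _ r n) => k; rewrite !mulf_eq0 !negb_or => /andP[/andP[_ /rq_neq0_ge0 h1] /andP[/rq_neq0_ge0 h2 _]].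
  by lia.
by apply: eq_csum => k; rewrite /f /=; move: (q ^ _) (g r) (rq _) (rq _) (rq _) => x y z t u; ring.
Qed.

(** [w] and [L] play the part of a conjugate Bailey pair; the two limit forms below are
    instances. *)
Lemma bailey_sum w g c (L : int -> R[i]) : csmb w -> csmb g ->
  (forall r, csum (fun n => w n * (rq (n - r) * rq (n + r + c))) = L r) ->
  csum (fun n => w n * bp g c n) = csum (fun r => L r * g r).
Proof.
move=> sw sg hL.
pose f (z : int * int) := w z.1 * (g z.2 * (rq (z.1 - z.2) * rq (z.1 + z.2 + c))).
have sf : csmb f.
  apply: eq_csmb (csmb_mul_bounded (K := qbd q * qbd q)
    (f := fun z : int * int => rq (z.1 - z.2) * rq (z.1 + z.2 + c)) _ (csmb_prod sw sg)).
    by move=> [n r]; rewrite /f /=; move: (w n) (g r) (rq _) (rq _) => x y z t; ring.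
  by move=> z; rewrite nrmM ler_pM ?nrm_ge0 ?nrm_rq.
transitivity (csum (fun n => csum (fun r => f (n, r)))).
  by apply: eq_csum => n; rewrite /bp -csumZ//; exact: csmb_bp.
rewrite (csum_swap sf); apply: eq_csum => r.
rewrite -hL -csumZr.
  by apply: eq_csum => n; rewrite /f /=; move: (w n) (g r) (rq _) (rq _) => x y z t; ring.
apply: eq_csmb (csmb_mul_bounded (K := qbd q * qbd q) _ sw).
  by move=> n; rewrite mulrC.
by move=> n; rewrite nrmM ler_pM ?nrm_ge0 ?nrm_rq.
Qed.

Lemma bailey_lim g c : csmb g ->
  csum (fun n => q ^ (n * n + c * n) * bp g c n) =
  (qinf q q)^-1 * csum (fun r => q ^ (r * r + c * r) * g r).
Proof.
move=> sg; rewrite (bailey_sum (csmb_quad c) sg (fun r => vandermonde_lim r c)).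
rewrite -csumZ; first by apply: eq_csum => r; rewrite mulrAC mulrC.
have [K hK] : exists K, forall r, nrm (q ^ (r * r + c * r)) <= K.
  exists (nrm q ^ (- (`|c| * `|c|))) => r; rewrite nrm_exprz.
  by apply: exprz_le; [exact: nrm_gt0|exact: ltW|exact: quad_ge].
exact: csmb_mul_bounded hK sg.
Qed.

Lemma bailey_lim_mixed g c : csmb g ->
  csum (fun n => q ^ (n * n + c * n) * bp g (c + 1) n) =
  (qinf q q)^-1 * csum (fun r => (q ^ (r * r + c * r) + q ^ ((r + 1) * (r + 1 + c))) * g r).
Proof.
move=> sg; rewrite (bailey_sum (csmb_quad c) sg (fun r => vandermonde_lim_mixed r c)).
rewrite -csumZ; first by apply: eq_csum => r; rewrite mulrAC mulrC.
have [K hK] : exists K, forall r, nrm (q ^ (r * r + c * r) + q ^ ((r + 1) * (r + 1 + c))) <= K.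
  exists (nrm q ^ (- (`|c| * `|c|)) + nrm q ^ (- (`|c| * `|c|))) => r.
  apply: (le_trans (nrm_triangle _ _)); rewrite !nrm_exprz.
  rewrite (_ : (r + 1) * (r + 1 + c) = (r + 1) * (r + 1) + c * (r + 1)); last by ring.
  by apply: lerD; (apply: exprz_le; [exact: nrm_gt0|exact: ltW|exact: quad_ge]).
exact: csmb_mul_bounded hK sg.
Qed.

End Bailey.

(** * Double sums over Bailey pairs *)

Section DoubleSums.
Variable R : realType.
Variable q : R[i].
Hypotheses (q0 : q != 0) (q1 : nrm q < 1).
Implicit Types (g b : int -> R[i]) (e f n k r : int).
Local Notation rq := (rq q).
Local Notation bp := (bp q).

(* The index n stands for j + k, where [rq (n - k)] is 1/(q;q)_j. *)
Definition ds e f b : R[i] :=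
  csum (fun n => q ^ (n * n + e * n) * csum (fun k => q ^ (k * k + f * k) * rq (n - k) * b k)).

Definition bnd b : Prop := exists K : R, forall k, nrm (b k) <= K.

Lemma bnd_bp g c : csmb g -> bnd (bp g c).
Proof.
move=> sg; exists (2 * nsum (fun r => qbd q * qbd q * nrm (g r))) => k.
apply: nrm_csum_le => [r|].
  by rewrite mulrC !nrmM ler_wpM2r ?nrm_ge0// ler_pM ?nrm_ge0 ?nrm_rq.
by apply: summZ => [|r|//]; rewrite ?mulr_ge0 ?qbd_ge0 ?nrm_ge0.
Qed.

Lemma csmb_ds e f b : bnd b ->
  csmb (fun z : int * int => q ^ (z.1 * z.1 + e * z.1) * (q ^ (z.2 * z.2 + f * z.2) * rq (z.1 - z.2) * b z.2)).
Proof.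
move=> [K hK].
apply: eq_csmb (csmb_mul_bounded (K := qbd q * K) (f := fun z : int * int => rq (z.1 - z.2) * b z.2) _
  (csmb_prod (csmb_quad q0 q1 e) (csmb_quad q0 q1 f))) => z /=.
  by move: (q ^ (z.1 * z.1 + e * z.1)) (q ^ _) (rq _) (b _) => x y t u; ring.
by rewrite nrmM ler_pM ?nrm_ge0 ?nrm_rq.
Qed.

Lemma csmb_ds_inner f b n : bnd b -> csmb (fun k => q ^ (k * k + f * k) * rq (n - k) * b k).
Proof.
move=> [K hK].
apply: eq_csmb (csmb_mul_bounded (K := qbd q * K) (f := fun k => rq (n - k) * b k) _ (csmb_quad q0 q1 f)) => k.
  by move: (q ^ _) (rq _) (b _) => y t u; ring.
by rewrite nrmM ler_pM ?nrm_ge0 ?nrm_rq.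
Qed.

Lemma ds_pair e f b : bnd b -> ds e f b =
  csum (fun z : int * int => q ^ (z.1 * z.1 + e * z.1) * (q ^ (z.2 * z.2 + f * z.2) * rq (z.1 - z.2) * b z.2)).
Proof.
move=> hb; rewrite csum_pair; last exact: csmb_ds.
by apply: eq_csum => n /=; rewrite csumZ//; exact: csmb_ds_inner.
Qed.

(** q^k - q^n = q^k (1 - q^(n-k)), and the bracket lowers [rq (n - k)]; then n is shifted by 1. Such
    contiguous relations bring the double sums to the exponents at which Bailey's lemma evaluates
    them. *)
Lemma ds_contig e f b : bnd b ->
  ds e (f + 1) b - ds (e + 1) f b = q ^ (1 + e) * ds (e + 2) (f + 1) b.
Proof.
move=> hb; rewrite !ds_pair// -csumB; [|exact: csmb_ds|exact: csmb_ds].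
rewrite -csumZ; last exact: csmb_ds.
rewrite [RHS](csum_bij (e := fun z : int * int => (z.1 - 1, z.2)) (e' := fun z => (z.1 + 1, z.2))); first last.
- by move=> [n k] /=; rewrite addrK.
- by move=> [n k] /=; rewrite subrK.
apply: eq_csum => -[n k] /=.
rewrite (_ : n - 1 - k = n - k - 1); last by ring.
rewrite -(rq_rec q0 q1) (qzD q0 n (- k)).
have -> : q ^ (1 + e) * (q ^ ((n - 1) * (n - 1) + (e + 2) * (n - 1)) *
  (q ^ (k * k + (f + 1) * k) * (rq (n - k) * (1 - q ^ n * q ^ (- k))) * b k)) =
  q ^ (1 + e) * q ^ ((n - 1) * (n - 1) + (e + 2) * (n - 1)) *
  (q ^ (k * k + (f + 1) * k) * (rq (n - k) * (1 - q ^ n * q ^ (- k))) * b k).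
  by rewrite mulrA.
rewrite -(qzD q0 (1 + e)).
rewrite (_ : 1 + e + ((n - 1) * (n - 1) + (e + 2) * (n - 1)) = n * n + e * n); last by ring.
rewrite (_ : n * n + (e + 1) * n = n * n + e * n + n); last by ring.
rewrite (_ : k * k + (f + 1) * k = k * k + f * k + k); last by ring.
rewrite (qzD q0 (n * n + e * n) n) (qzD q0 (k * k + f * k) k).
have e1 : q ^ k * q ^ (- k) = 1 by rewrite -(qzD q0) subrr expr0z.
move: (q ^ (n * n + e * n)) (q ^ (k * k + f * k)) (rq _) (b _) (q ^ n) e1 => x y z t u.
move: (q ^ k) (q ^ (- k)) => v w e1.
rewrite [RHS](_ : _ = x * y * z * t * v - x * y * z * t * u * (v * w)); last by ring.
by rewrite e1; ring.
Qed.

(** The factor 1 - q^(2k) turns [a k] into [b (k - 1)]; shifting both indices by 1 leaves n - k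
    unchanged. *)
Lemma ds_step e f a b : bnd a -> bnd b -> (forall k, (1 - q ^ (2 * k)) * a k = b (k - 1)) ->
  ds e f a - ds e (f + 2) a = q ^ (2 + e + f) * ds (e + 2) (f + 2) b.
Proof.
move=> ha hb hab; rewrite !ds_pair// -csumB; [|exact: csmb_ds|exact: csmb_ds].
rewrite -csumZ; last exact: csmb_ds.
rewrite [RHS](csum_bij (e := fun z : int * int => (z.1 - 1, z.2 - 1)) (e' := fun z => (z.1 + 1, z.2 + 1))); first last.
- by move=> [n k] /=; rewrite !addrK.
- by move=> [n k] /=; rewrite !subrK.
apply: eq_csum => -[n k] /=; rewrite -hab.
rewrite (_ : n - 1 - (k - 1) = n - k); last by ring.
have -> : q ^ (2 + e + f) * (q ^ ((n - 1) * (n - 1) + (e + 2) * (n - 1)) *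
  (q ^ ((k - 1) * (k - 1) + (f + 2) * (k - 1)) * rq (n - k) * ((1 - q ^ (2 * k)) * a k))) =
  q ^ (2 + e + f) * q ^ ((n - 1) * (n - 1) + (e + 2) * (n - 1)) *
  q ^ ((k - 1) * (k - 1) + (f + 2) * (k - 1)) * (rq (n - k) * ((1 - q ^ (2 * k)) * a k)).
  by rewrite !mulrA.
rewrite -!(qzD q0).
rewrite (_ : 2 + e + f + _ + _ = (n * n + e * n) + (k * k + f * k)); last by ring.
rewrite (_ : k * k + (f + 2) * k = k * k + f * k + 2 * k); last by ring.
rewrite (qzD q0 (n * n + e * n)) (qzD q0 (k * k + f * k) (2 * k)).
move: (q ^ (n * n + e * n)) (q ^ (k * k + f * k)) (q ^ (2 * k)) (rq _) (a _) => x y z t u.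
by ring.
Qed.

Lemma ds_bp e f g :
  ds e f (bp g f) = csum (fun n => q ^ (n * n + e * n) * bp (fun r => q ^ (r * r + f * r) * g r) f n).
Proof. by apply: eq_csum => n; rewrite (bailey_step q0 q1). Qed.

Lemma csmb_quad_mul c g : csmb g -> csmb (fun r => q ^ (r * r + c * r) * g r).
Proof.
apply: (csmb_mul_bounded (K := nrm q ^ (- (`|c| * `|c|)))) => r.
rewrite nrm_exprz; apply: exprz_le; [exact: nrm_gt0|exact: ltW|exact: quad_ge].
Qed.

(** Two Bailey steps at the same base, whence the doubled exponent r^2 + e r. *)
Lemma ds_diag e g : csmb g ->
  ds e e (bp g e) = (qinf q q)^-1 * csum (fun r => q ^ (2 * (r * r + e * r)) * g r).
Proof.
move=> sg; rewrite ds_bp (bailey_lim q0 q1); last exact: csmb_quad_mul.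
by congr (_ * _); apply: eq_csum => r; rewrite mulrA -(qzD q0) mulr2n mulrDl !mul1r.
Qed.

(** The second Bailey step is taken at a base one lower than the first. In both uses the second
    series vanishes by antisymmetry. *)
Lemma ds_mixed e g : csmb g ->
  ds e (e + 1) (bp g (e + 1)) = (qinf q q)^-1 *
   (csum (fun r => q ^ (2 * (r * r + e * r) + r) * g r) +
    csum (fun r => q ^ (2 * (r * r + e * r) + 3 * r + e + 1) * g r)).
Proof.
move=> sg; rewrite ds_bp (bailey_lim_mixed q0 q1); last exact: csmb_quad_mul.
congr (_ * _).
have s1 : csmb (fun r => q ^ (2 * (r * r + e * r) + r) * g r).
  apply: eq_csmb (csmb_quad_mul e (csmb_quad_mul (e + 1) sg)) => r.
  by rewrite mulrA -(qzD q0); congr (q ^ _ * _); ring.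
have s2 : csmb (fun r => q ^ (2 * (r * r + e * r) + 3 * r + e + 1) * g r).
  apply: eq_csmb (csmbZ (q ^ (e + 1)) (csmb_quad_mul (e + 2) (csmb_quad_mul (e + 1) sg))) => r.
  by rewrite !mulrA -!(qzD q0); congr (q ^ _ * _); ring.
rewrite -(csumD s1 s2); apply: eq_csum => r; rewrite -[RHS]mulrDl mulrA; congr (_ * _).
by rewrite [LHS]mulrDl -!(qzD q0); congr (q ^ _ + q ^ _); ring.
Qed.

(* The terms breaking the Bailey chain cancel between the two double sums. *)
Lemma ds_lattice g : csmb g ->
  ds 1 0 (bp g 0) + q * ds 2 1 (bp g 1) =
  (qinf q q)^-1 * csum (fun r => q ^ (2 * (r * r) + r) * g r).
Proof.
move=> sg; rewrite !ds_bp.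
pose h r := q ^ (r * r + 0 * r) * g r.
pose h' r := q ^ (r * r + 1 * r) * g r.
have sh : csmb h by exact: csmb_quad_mul.
have sh' : csmb h' by exact: csmb_quad_mul.
have hh' : h' = fun r => q ^ r * h r.
  by apply/funext => r; rewrite /h' /h mulrA -(qzD q0); congr (q ^ _ * _); ring.
have sb c k (u : int -> R[i]) : csmb u -> csmb (fun n => q ^ (n * n + c * n) * bp u k n).
  move=> su; have [K hK] := bnd_bp k su.
  by apply: eq_csmb (csmb_mul_bounded hK (csmb_quad q0 q1 c)) => n; rewrite mulrC.
have -> : csum (fun n => q ^ (n * n + 1 * n) * bp h 0 n) =
   csum (fun n => q ^ (n * n + 1 * n) * bp h 1 n) - q * csum (fun n => q ^ (n * n + 2 * n) * bp h' 1 n).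
  rewrite -csumZ; last exact: sb.
  rewrite -csumB; [|exact: sb|by apply: csmbZ; exact: sb].
  apply: eq_csum => n; rewrite (bp_lift q0 q1 h 0) -hh' mulrBr; congr (_ - _).
  rewrite [LHS]mulrA -(qzD q0) [RHS]mulrA (_ : q * q ^ (n * n + 2 * n) = q ^ (1 + (n * n + 2 * n))); last by rewrite (qzD q0 1) expr1z.
  rewrite add0r.
  by congr (q ^ _ * _); ring.
rewrite subrK (bailey_lim q0 q1 _ sh); congr (_ * _); apply: eq_csum => r.
by rewrite /h mulrA -(qzD q0); congr (q ^ _ * _); ring.
Qed.

(* The change of summation index [n = j + k]. *)
Section NaturalIndices.
Variables (a b : nat) (be : nat -> R[i]) (bz : int -> R[i]) (K : R).
Hypotheses (beK : forall k : nat, nrm (be k) <= K) (bzE : forall k : nat, bz k%:Z = be k).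
Hypothesis bz0 : forall k : int, k < 0 -> bz k = 0.

Let term (z : nat * nat) :=
  q ^+ (z.1 ^ 2 + 2 * z.1 * z.2 + 2 * z.2 ^ 2 + a * z.1 + b * z.2)%N * (qpoch q q z.1)^-1 * be z.2.
Let iterm (z : int * int) :=
  q ^ (z.1 * z.1 + a%:Z * z.1) * (q ^ (z.2 * z.2 + (b%:Z - a%:Z) * z.2) * rq (z.1 - z.2) * bz z.2).
Let ind (z : nat * nat) : int * int := (z.1%:Z + z.2%:Z, z.2%:Z).

Let bnd_bz : bnd bz.
Proof.
exists K => -[k|k]; first by rewrite bzE.
by rewrite bz0// nrm0; exact: le_trans (nrm_ge0 _) (beK 0%N).
Qed.

Let ind_inj : injective ind.
Proof. by move=> [j k] [j' k'] /= [h1 h2]; congr (_, _); lia. Qed.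

Let termE z : iterm (ind z) = term z.
Proof.
case: z => j k; rewrite /iterm /term /= bzE addrK /= mulrA mulrA -(qzD q0) exprnP.
congr (q ^ _ * _ * _).
by rewrite !PoszD -!mulnn !PoszM; ring.
Qed.

Lemma csmb_ds_nat : csmb term.
Proof. by apply: eq_csmb (csmb_inj ind_inj (csmb_ds a (b%:Z - a%:Z) bnd_bz)) => z; rewrite -termE. Qed.

Lemma ds_nat : csum term = ds a (b%:Z - a%:Z) bz.
Proof.
rewrite (ds_pair _ _ bnd_bz).
rewrite [RHS](csum_supp (e := ind)) => [||[n k] h /=].
- by apply: eq_csum => z; rewrite -termE.
- exact: ind_inj.
have [kn|kn] := ltP k 0; first by rewrite bz0// !mulr0.
have [nk|nk] := ltP (n - k) 0; first by rewrite (rq_neg _ nk) mulr0 mul0r mulr0.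
exfalso; apply: (h (`|n - k|%N, `|k|%N)); rewrite /ind /=.
by congr (_, _); lia.
Qed.

End NaturalIndices.

End DoubleSums.

Section Signs.
Variable R : realType.
Implicit Types (m n : int).
Local Notation sg n := ((-1 : R[i]) ^ n).

Lemma sgD m n : sg (m + n) = sg m * sg n.
Proof. by apply: expfzDr; rewrite oppr_eq0 oner_eq0. Qed.

Lemma sg_sq n : sg n * sg n = 1.
Proof. by rewrite -sgD -[n + n]mulr2n -mulr_natl -exprz_exp -exprnP sqrrN expr1n exp1rz. Qed.

Lemma sgN n : sg (- n) = sg n.
Proof.
have h : sg (- n) * sg n = 1 by rewrite -sgD addNr expr0z.
have n0 : sg n != 0 by rewrite expfz_neq0// oppr_eq0 oner_eq0.
by apply: (mulIf n0); rewrite h sg_sq.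
Qed.

Lemma sg1 : sg 1 = -1. Proof. by rewrite expr1z. Qed.

Lemma nrm_sg n : nrm (sg n) = 1.
Proof. by rewrite nrm_exprz nrmN nrm1 exp1rz. Qed.

Lemma sg_refl n : sg (- 1 - n) = - sg n.
Proof. by rewrite sgD sgN sgN sg1 mulN1r. Qed.

Lemma csmb_sg_pow (s : R[i]) (e : int -> int) (C : int) : s != 0 -> nrm s < 1 ->
  (forall r, `|r| - C <= e r) -> csmb (fun r => sg r * s ^ e r).
Proof.
move=> s0 s1 he; have n0 := nrm_gt0 s0.
apply: (@csmb_le _ _ (fun r => nrm s ^ (- C) * nrm s ^+ `|r|%N)).
  apply: summZ => [|r|]; rewrite ?exprz_ge0 ?exprn_ge0 ?nrm_ge0//.
  by apply: summ_geoz => //; exact: nrm_ge0.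
move=> r; rewrite nrmM nrm_sg mul1r nrm_exprz exprnP -expfzDr ?gt_eqF//.
apply: exprz_le => //; first exact: ltW.
by have := he r; lia.
Qed.

Lemma csum_sg_anti (s : R[i]) (a c : int) : s != 0 ->
  csum (fun r => sg r * s ^ (a * (r * r) + a * r + c)) = 0.
Proof.
move=> s0; apply: (csum_anti (k := -1)) => r; rewrite sg_refl mulNr; congr (- (_ * s ^ _)).
by ring.
Qed.

End Signs.

Lemma pull_pow (F : fieldType) (x y : F) (a b : int) :
  x != 0 -> x ^ a * (y * x ^ b) = y * x ^ (a + b).
Proof. by move=> x0; rewrite mulrCA expfzDr. Qed.

(** * The pentagonal number theorem *)

Section Pentagonal.
Variable R : realType.
Variable p : R[i].
Hypotheses (p0 : p != 0) (p1 : nrm p < 1).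
Local Notation sg n := ((-1 : R[i]) ^ n).

(** [g] is the unit Bailey pair: both terms on the right of [bp_succ] vanish by antisymmetry, so its
    beta-sequence is 1 at k = 0 and 0 elsewhere. Bailey's lemma in the limit is then the theorem. *)
Lemma pentagonal :
  qinf (p ^+ 2) (p ^+ 2) = csum (fun r : int => sg r * p ^ (3 * (r * r) + r)).
Proof.
set q := p ^+ 2.
have q0 : q != 0 by rewrite expf_neq0.
have q1 : nrm q < 1 by exact: nrm_expr_lt1.
have qp (n : int) : q ^ n = p ^ (2 * n) by rewrite -exprz_exp.
pose g (r : int) := sg r * p ^ (r * r + r).
have sgm : csmb g by apply: (csmb_sg_pow (C := 1)) => // r; nia.
have anti1 : forall r, g (- 1 - r) = - g r.
  by move=> r; rewrite /g sg_refl mulNr; congr (- (_ * p ^ _)); ring.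
have anti2 : forall r, q ^ (- 1 - r) * g (- (- 1 - r)) = - (q ^ r * g (- r)).
  move=> r; rewrite /g !qp !sgN sg_refl !pull_pow// mulNr.
  by congr (- (_ * p ^ _)); ring.
have gk (k : int) : k != 0 -> bp q g 0 k = 0.
  move=> k0; have [kn|kp] := ltP k 0; first by apply: (bp_neg q0 q1); lia.
  have k2 : 1 - q ^ (2 * k) != 0 by apply: sub_exprz_neq0 => //; lia.
  apply/eqP; rewrite -(mulrI_eq0 _ (mulfI k2)); apply/eqP.
  by rewrite (bp_succ q0 q1) (bp_anti _ _ anti1) (bp_anti _ _ anti2) mulr0 addr0.
have g0 : bp q g 0 0 = 1.
  rewrite /bp (@csum_single _ _ 0); first by rewrite /g !rq0 mulr0 !addr0 !expr0z !mulr1.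
  by move=> r r0; apply/eqP/negPn/negP => /(bp_supp q0 q1) h; lia.
have := bailey_lim q0 q1 0 sgm.
rewrite (@csum_single _ _ 0) => [|k /gk ->]; last by rewrite mulr0.
rewrite g0 !mulr0 addr0 expr0z => h.
have Q0 := qqinf_neq0 q0 q1; apply: (mulfI (invr_neq0 Q0)).
rewrite mul1r in h; apply: (etrans (mulVf Q0)); apply: (etrans h); congr (_ * _); apply: eq_csum => r.
by rewrite /g qp mulrCA -expfzDr//; congr (_ * p ^ _); ring.
Qed.

End Pentagonal.

(** * The Bailey pair behind F *)

Section PairF.
Variable R : realType.
Variable s : R[i].
Hypotheses (s0 : s != 0) (s1 : nrm s < 1).
Local Notation sg n := ((-1 : R[i]) ^ n).
Local Notation q := (s ^+ 4).

Let q0 : q != 0. Proof. exact: expf_neq0. Qed.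
Let q1 : nrm q < 1. Proof. exact: nrm_expr_lt1. Qed.

Lemma q4z (n : int) : q ^ n = s ^ (4 * n).
Proof. by rewrite -exprz_exp. Qed.

Lemma nrm_s_le n m : (n <= m)%N -> nrm (s ^+ m) <= nrm (s ^+ n).
Proof. by move=> nm; rewrite !nrmX; apply: ler_wiXn2l => //; [exact: nrm_ge0|exact: ltW]. Qed.

(** Here s = q^(1/4), the smallest power of q that makes the exponents (3 r^2 + r)/4 integral. *)
Definition gamF (r : int) := sg r * s ^ (3 * (r * r) + r).
Definition denF (k : nat) := qpoch (s ^+ 8) (s ^+ 8) k.
(** 1/((q^2;q^2)_k (-q^(1/2);q)_k): what remains of the k-dependence of F once the index i is summed
    by Euler's identity with u = 1. The variant [betF'] belongs to u = q. *)
Definition betF (k : int) : R[i] :=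
  if k is Posz m then (denF m * qpoch (- s ^+ 2) q m)^-1 else 0.
Definition betF' (k : int) : R[i] :=
  if k is Posz m then (denF m * qpoch (- s ^+ 2) q m.+1)^-1 else 0.

Lemma denF_neq0 k : denF k != 0.
Proof. by apply: qq_neq0; exact: nrm_expr_lt1. Qed.

Lemma qpF_neq0 k : qpoch (- s ^+ 2) q k != 0.
Proof.
apply: (@qpoch_neq0 _ _ (nrm (s ^+ 2))); rewrite ?nrmN//; first exact: nrm_expr_lt1.
exact: nrm_s_le.
Qed.

Lemma csmb_gamF : csmb gamF.
Proof. by apply: (csmb_sg_pow (C := 1)) => // r; nia. Qed.

Lemma csmb_gamFN : csmb (fun r => gamF (- r)).
Proof. by have := csmb_refl 0 csmb_gamF; apply: eq_csmb => r; rewrite sub0r. Qed.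

Lemma q_gamF r : q ^ r * gamF r = sg r * s ^ (3 * (r * r) + 5 * r).
Proof. by rewrite /gamF q4z pull_pow//; congr (_ * s ^ _); ring. Qed.

Lemma q_gamFN r : q ^ r * gamF (- r) = sg r * s ^ (3 * (r * r) + 3 * r).
Proof. by rewrite /gamF sgN q4z pull_pow//; congr (_ * s ^ _); ring. Qed.

(** gamF(r) + q^(1/2) q^r gamF(r) changes sign under r -> - 1 - r, so the correction in [bp_lift] is
    itself a multiple of the sequence at base q. *)
Lemma bpF_half (k : int) : bp q gamF 0 k = (1 + s ^ (4 * k + 2)) * bp q gamF 1 k.
Proof.
rewrite (bp_lift q0 q1 gamF 0 k) add0r.
have h : bp q (fun r => gamF r + s ^ 2 * (q ^ r * gamF r)) 1 k = 0.
  apply: bp_anti => r; rewrite !q_gamF /gamF sg_refl !pull_pow// !mulNr opprD addrC.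
  by congr (- (_ * s ^ _) - _ * s ^ _); ring.
have hz : bp q (fun r => s ^ 2 * (q ^ r * gamF r)) 1 k = s ^ 2 * bp q (fun r => q ^ r * gamF r) 1 k by exact: bpZ.
have hd : bp q (fun r => gamF r + s ^ 2 * (q ^ r * gamF r)) 1 k =
  bp q gamF 1 k + bp q (fun r => s ^ 2 * (q ^ r * gamF r)) 1 k by exact: bpD.
move: h; rewrite hd hz => /eqP; rewrite addr_eq0 => /eqP h.
rewrite [in RHS]mulrDl mul1r; congr (_ + _).
rewrite h mulrN; congr (- _); rewrite mulrA -expfzDr// q4z.
by congr (s ^ _ * _); ring.
Qed.

Lemma bpF_succ (k : int) : (1 - q ^ (2 * k)) * bp q gamF 0 k = bp q gamF 1 (k - 1).
Proof.
rewrite (bp_succ q0 q1) [X in q ^ k * X]bp_anti ?mulr0 ?addr0// => r.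
rewrite !q_gamFN sg_refl mulNr.
by congr (- (_ * s ^ _)); ring.
Qed.

(** Joint induction: [bpF_half] passes from base 1 to base q at the same k, and [bpF_succ] from base
    q at k to base 1 at k + 1. *)
Lemma bpF_nat (k : nat) : bp q gamF 0 k = betF k /\ bp q gamF 1 k = betF' k.
Proof.
have half (m : nat) : bp q gamF 0 m = betF m -> bp q gamF 1 m = betF' m.
  rewrite bpF_half /betF /betF' qpochS => h.
  have e : 1 - - s ^+ 2 * q ^+ m = 1 + s ^ (4 * m%:Z + 2).
    by rewrite mulNr opprK [in RHS]addrC expfzDr// -q4z -!exprnP addrC mulrC.
  have := qpF_neq0 m.+1; rewrite qpochS e mulf_eq0 negb_or => /andP[n1 n2].
  apply: (mulfI n2); rewrite h; have n3 := denF_neq0 m.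
  by field; rewrite n1 n2 n3.
suff h : bp q gamF 0 k = betF k by split=> //; exact: half.
elim: k => [|k IH].
  rewrite /bp (@csum_single _ _ 0).
    by rewrite /gamF /betF /denF !qpoch0 !rq0 mulr0 !addr0 !expr0z !mulr1 invr1.
  by move=> r r0; apply/eqP/negPn/negP => /(bp_supp q0 q1) h; lia.
have k2 : 1 - q ^ (2 * k.+1%:Z) != 0 by apply: sub_exprz_neq0 => //; lia.
apply: (mulfI k2); rewrite bpF_succ (_ : k.+1%:Z - 1 = k); last by lia.
rewrite (half _ IH) /betF' /betF /denF (qpochS (s ^+ 8)).
have e : 1 - s ^+ 8 * (s ^+ 8) ^+ k = 1 - q ^ (2 * k.+1%:Z).
  by rewrite -exprS -exprM q4z exprnP; congr (1 - s ^ _); lia.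
rewrite e; have := denF_neq0 k; rewrite /denF => n1; have n2 := qpF_neq0 k.+1.
move: (qpoch (s ^+ 8) (s ^+ 8) k) (qpoch (- s ^+ 2) q k.+1) (q ^ _) k2 n1 n2 => x y z *.
by field; apply/and3P; split.
Qed.

Lemma bpF (k : int) : bp q gamF 0 k = betF k.
Proof.
case: k => k; first by have [] := bpF_nat k.
by rewrite (bp_neg q0 q1) //; lia.
Qed.

Lemma bpF' (k : int) : bp q gamF 1 k = betF' k.
Proof.
case: k => k; first by have [] := bpF_nat k.
by rewrite (bp_neg q0 q1) //; lia.
Qed.

(** Relative to base 1 a reflection of the sequence changes nothing, and the reflected sequence
    lifts to base q without correction. This second representation of [betF] yields the theta series
    with d = 3 and d = 7. *)
Lemma bpF'' (k : int) : bp q (fun r => gamF (- r)) 1 k = betF k.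
Proof.
rewrite -bpF -[1]add0r -(bp_lift_anti q0 q1).
  rewrite /bp (csum_refl 0); apply: eq_csum => r; rewrite sub0r opprK !addr0.
  by rewrite [rq _ (k + r) * _]mulrC.
move=> r; rewrite add0r !q_gamFN sg_refl mulNr.
by congr (- (_ * s ^ _)); ring.
Qed.

Lemma bnd_betF : bnd betF.
Proof. by have [K hK] := bnd_bp q1 0 csmb_gamF; exists K => k; rewrite -bpF. Qed.

Lemma bnd_betF' : bnd betF'.
Proof. by have [K hK] := bnd_bp q1 1 csmb_gamF; exists K => k; rewrite -bpF'. Qed.

Lemma betF_step (k : int) : (1 - q ^ (2 * k)) * betF k = betF' (k - 1).
Proof. by rewrite -bpF -bpF' bpF_succ. Qed.

Definition thF (d : int) : R[i] := csum (fun r : int => sg r * s ^ (11 * (r * r) + d * r)).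

Lemma ds_betF_1 : ds q 0 0 betF = (qinf q q)^-1 * thF 1.
Proof.
rewrite -[betF](funext bpF) (ds_diag q0 q1 _ csmb_gamF); congr (_ * _); apply: eq_csum => r.
by rewrite /gamF q4z mulrCA -expfzDr//; congr (_ * s ^ _); ring.
Qed.

Lemma ds_betF_3 : ds q 0 1 betF = (qinf q q)^-1 * thF 3.
Proof.
rewrite -[betF](funext bpF'') -[1]add0r (ds_mixed q0 q1 _ csmb_gamFN) !add0r; congr (_ * _).
have -> : csum (fun r => q ^ (2 * (r * r + 0 * r) + 3 * r + 0 + 1) * gamF (- r)) = 0.
  apply: (etrans _ (csum_sg_anti 11 4 s0)); apply: eq_csum => r.
  by rewrite /gamF sgN q4z mulrCA -expfzDr//; congr (_ * s ^ _); ring.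
rewrite addr0; apply: eq_csum => r.
by rewrite /gamF sgN q4z mulrCA -expfzDr//; congr (_ * s ^ _); ring.
Qed.

Lemma ds_betF_5 : ds q 1 0 betF + q * ds q 2 1 betF' = (qinf q q)^-1 * thF 5.
Proof.
rewrite -[betF](funext bpF) -[betF'](funext bpF') (ds_lattice q0 q1 csmb_gamF).
congr (_ * _); apply: eq_csum => r.
by rewrite /gamF q4z mulrCA -expfzDr//; congr (_ * s ^ _); ring.
Qed.

Lemma ds_betF_7 : ds q 1 1 betF = (qinf q q)^-1 * thF 7.
Proof.
rewrite -[betF](funext bpF'') (ds_diag q0 q1 _ csmb_gamFN); congr (_ * _); apply: eq_csum => r.
by rewrite /gamF sgN q4z mulrCA -expfzDr//; congr (_ * s ^ _); ring.
Qed.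

Lemma ds_betF_9 : ds q 1 1 betF' = (qinf q q)^-1 * thF 9.
Proof.
rewrite -[betF'](funext bpF') (ds_diag q0 q1 _ csmb_gamF); congr (_ * _); apply: eq_csum => r.
by rewrite /gamF q4z mulrCA -expfzDr//; congr (_ * s ^ _); ring.
Qed.

(** In [Vstar] both sums occur with exponents (1, 2), while [ds_lattice] evaluates (1, 0) and (2,
    1). Passing from one form to the other by [ds_step], resp. [ds_contig], costs the same term q^3
    [ds q 3 2 betF'] in either sum. *)
Lemma ds_betF_5' : ds q 1 2 betF + q * ds q 1 2 betF' = (qinf q q)^-1 * thF 5.
Proof.
rewrite -ds_betF_5; have h1 := ds_step q0 q1 1 0 bnd_betF bnd_betF' betF_step.
have h2 := ds_contig q0 q1 1 1 bnd_betF'.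
have e2 : (1 : int) + 1 = 2 by []. have e3 : (1 : int) + 2 = 3 by [].
have e4 : (2 : int) + 1 + 0 = 3 by [].
rewrite !e2 !e3 add0r e4 in h1 h2.
have -> : ds q 1 0 betF = ds q 1 2 betF + q ^ 3 * ds q 3 2 betF' by rewrite -h1 addrC subrK.
have -> : ds q 1 2 betF' = ds q 2 1 betF' + q ^ 2 * ds q 3 2 betF' by rewrite -h2 addrC subrK.
rewrite mulrDr mulrA -exprnP -exprS -addrA; congr (_ + _); rewrite addrC; congr (_ + _).
Qed.

End PairF.

(** * The Bailey pair behind G *)

Section PairG.
Variable R : realType.
Variable q : R[i].
Hypotheses (q0 : q != 0) (q1 : nrm q < 1).
Local Notation sg n := ((-1 : R[i]) ^ n).

Definition gamG (r : int) : R[i] :=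
  if (2 %| r)%Z then sg (r %/ 2)%Z * q ^ (3 * ((r %/ 2)%Z * (r %/ 2)%Z) + (r %/ 2)%Z) else 0.
(** With q replaced by q^2 this is, up to an infinite product, what Euler's identity leaves of the
    terms of G with i = 2 k and w = 1; [betG'] corresponds to i = 2 k + 1 and w = q. *)
Definition betG (k : int) : R[i] :=
  if k is Posz m then (qpoch q (q ^+ 2) m * qpoch q q m)^-1 else 0.
Definition betG' (k : int) : R[i] :=
  if k is Posz m then (qpoch q (q ^+ 2) m.+1 * qpoch q q m)^-1 else 0.

Lemma gamG_even (r : int) : gamG (2 * r) = sg r * q ^ (3 * (r * r) + r).
Proof. by rewrite /gamG dvdz_mulr// mulKz. Qed.

Variant parity_spec : int -> Type :=
  | ParityEven r of gamG (2 * r) = sg r * q ^ (3 * (r * r) + r) : parity_spec (2 * r)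
  | ParityOdd r of gamG (2 * r + 1) = 0 : parity_spec (2 * r + 1).

Lemma parityP (r : int) : parity_spec r.
Proof.
have [h|h] := boolP (2 %| r)%Z.
  by rewrite -(divzK h) mulrC; constructor; exact: gamG_even.
have e : r = 2 * (r %/ 2)%Z + 1.
  by have := divz_eq r 2; have := modz_ge0 r (isT : (2 : int) != 0); have := ltz_pmod r (isT : 0 < 2 :> int); move: h; rewrite dvdz_eq; lia.
rewrite e; constructor; rewrite /gamG -e; by rewrite (negPf h).
Qed.

Lemma gamG_odd (r : int) : gamG (2 * r + 1) = 0.
Proof. by rewrite /gamG ifN//; apply/negP => /dvdzP[k hk]; lia. Qed.

Lemma csum_gamG (w : int -> R[i]) :
  csum (fun r => w r * gamG r) = csum (fun r : int => sg r * (w (2 * r) * q ^ (3 * (r * r) + r))).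
Proof.
rewrite (csum_supp (e := fun r : int => 2 * r)).
- by apply: eq_csum => r; rewrite gamG_even mulrCA.
- by move=> m n h; lia.
move=> t h; rewrite /gamG ifN ?mulr0//; apply/negP => /dvdzP[k hk].
by apply: (h k); rewrite hk mulrC.
Qed.

Lemma csmb_gamG : csmb gamG.
Proof.
apply: (csmb_supp (e := fun r : int => 2 * r)).
- by move=> m n h; lia.
- move=> t h; rewrite /gamG ifN//; apply/negP => /dvdzP[k hk].
  by apply: (h k); rewrite hk mulrC.
apply: eq_csmb (csmb_sg_pow (C := 1) (e := fun r => 3 * (r * r) + r) q0 q1 _) => [r|r]; last by nia.
by rewrite gamG_even.
Qed.

Lemma gamG_anti2 (r : int) : q ^ (- 2 - r) * gamG (- 2 - r) = - (q ^ r * gamG r).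
Proof.
case: (parityP r) => {}r -> .
  rewrite (_ : - 2 - 2 * r = 2 * (- 1 - r)); last by ring.
  rewrite gamG_even sg_refl !pull_pow// mulNr.
  by congr (- (_ * q ^ _)); ring.
rewrite (_ : - 2 - (2 * r + 1) = 2 * (- 2 - r) + 1); last by ring.
by rewrite gamG_odd !mulr0 oppr0.
Qed.

Lemma gamG_anti0 (r : int) : (q ^ (- (- r)) - 1) * gamG (- r) = - ((q ^ (- r) - 1) * gamG r).
Proof.
case: (parityP r) => {}r ->.
  rewrite (_ : - (2 * r) = 2 * (- r)); last by ring.
  rewrite gamG_even sgN !mulrBl !mul1r !pull_pow// opprB.
  by congr (_ * q ^ _ - _ * q ^ _); ring.
rewrite (_ : - (2 * r + 1) = 2 * (- 1 - r) + 1); last by ring.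
by rewrite gamG_odd !mulr0 oppr0.
Qed.

(** By antisymmetry relative to q^2 the right-hand side of [bp_down] is 0, so the correction in
    [bp_lift] is q^(2k+1) times the sequence itself. *)
Lemma bpG_odd (k : int) : bp q gamG 0 k = (1 - q ^ (2 * k + 1)) * bp q gamG 1 k.
Proof.
rewrite (bp_lift q0 q1 gamG 0 k) add0r mulrBl mul1r; congr (_ - _).
have z : bp q (fun r => q ^ r * gamG r) (1 + 1) (k - 1) = 0 by apply: bp_anti => r; exact: gamG_anti2.
have /eqP := bp_down q0 q1 gamG 1 k; rewrite z.
rewrite subr_eq0 => /eqP ->; rewrite mulrA -expfzDr//.
by congr (q ^ _ * _); ring.
Qed.

(** Lowering [rq (k - r)] needs the factor 1 - q^(k-r); it differs from 1 - q^k by a multiple of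
    q^(-r) - 1, and (q^(-r) - 1) gamG(r) is odd. *)
Lemma bpG_succ (k : int) : (1 - q ^ k) * bp q gamG 0 k = bp q gamG 1 (k - 1).
Proof.
have h : bp q (fun r => (q ^ (- r) - 1) * gamG r) 0 k = 0.
  by apply: bp_anti => r; rewrite oppr0 add0r gamG_anti0.
rewrite -[LHS]subr0 -[X in _ - X](mulr0 (q ^ k)) -h /bp -!csumZ; [|exact: csmb_bp|exact: csmb_bp].
rewrite -csumB; [|by apply: csmbZ; exact: csmb_bp|by apply: csmbZ; exact: csmb_bp].
apply: eq_csum => r; rewrite addr0.
rewrite (_ : k - 1 - r = k - r - 1); last by ring.
rewrite (_ : k - 1 + r + 1 = k + r); last by ring.
rewrite -(rq_rec q0 q1 (k - r)) (expfzDr k (- r) q0).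
move: (q ^ k) (q ^ (- r)) (gamG r) (rq _ _) (rq _ _) => x y z t u.
by ring.
Qed.

Lemma qpG_neq0 k : qpoch q (q ^+ 2) k != 0.
Proof.
apply: (@qpoch_neq0 _ _ (nrm q)) => //.
by rewrite nrmX exprS expr1 ger_pMl ?nrm_gt0// ltW.
Qed.

Lemma bpG_nat (k : nat) : bp q gamG 0 k = betG k /\ bp q gamG 1 k = betG' k.
Proof.
have half (m : nat) : bp q gamG 0 m = betG m -> bp q gamG 1 m = betG' m.
  rewrite bpG_odd /betG /betG' qpochS => h.
  have e : 1 - q * (q ^+ 2) ^+ m = 1 - q ^ (2 * m%:Z + 1).
    by rewrite -exprM -exprS -addn1 -[2 * m%:Z + 1]/((2 * m + 1)%:Z).
  have := qpG_neq0 m.+1; rewrite qpochS e mulf_eq0 negb_or => /andP[n1 n2].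
  apply: (mulfI n2); rewrite h; have n3 := qq_neq0 q1 m.
  by field; rewrite n1 n2 n3.
suff h : bp q gamG 0 k = betG k by split=> //; exact: half.
elim: k => [|k IH].
  rewrite /bp (@csum_single _ _ 0).
    have -> : gamG 0 = 1 by have := gamG_even 0; rewrite !mulr0 addr0 !expr0z mulr1.
    by rewrite /betG !qpoch0 !rq0 !mulr1 invr1.
  by move=> r r0; apply/eqP/negPn/negP => /(bp_supp q0 q1) h; lia.
have k2 : 1 - q ^ k.+1%:Z != 0 by apply: sub_exprz_neq0 => //; lia.
apply: (mulfI k2); rewrite bpG_succ (_ : k.+1%:Z - 1 = k); last by lia.
rewrite (half _ IH) /betG' /betG (qpochS q q) -exprS [q ^+ k.+1]exprnP.
have n1 := qq_neq0 q1 k; have n2 := qpG_neq0 k.+1.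
move: (qpoch q q k) (qpoch q (q ^+ 2) k.+1) (q ^ _) k2 n1 n2 => x y z *.
by field; apply/and3P; split.
Qed.

Lemma bpG (k : int) : bp q gamG 0 k = betG k.
Proof.
case: k => k; first by have [] := bpG_nat k.
by rewrite (bp_neg q0 q1) //; lia.
Qed.

Lemma bpG' (k : int) : bp q gamG 1 k = betG' k.
Proof.
case: k => k; first by have [] := bpG_nat k.
by rewrite (bp_neg q0 q1) //; lia.
Qed.

Lemma bpG'' (k : int) : bp q gamG 2 k = betG' k.
Proof.
have -> : bp q gamG 2 k = bp q gamG (1 + 1) k by [].
rewrite -bpG' -(bp_lift_anti q0 q1)// => r.
exact: gamG_anti2.
Qed.

Lemma bnd_betG : bnd betG.
Proof. by have [K hK] := bnd_bp q1 0 csmb_gamG; exists K => k; rewrite -bpG. Qed.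

Lemma bnd_betG' : bnd betG'.
Proof. by have [K hK] := bnd_bp q1 1 csmb_gamG; exists K => k; rewrite -bpG'. Qed.

Lemma betG_odd (k : int) : betG k = (1 - q ^ (2 * k + 1)) * betG' k.
Proof. by rewrite -bpG -bpG' bpG_odd. Qed.

Lemma ds_betG_1 : ds q 0 0 betG = (qinf q q)^-1 * thF q 1.
Proof.
rewrite -[betG](funext bpG) (ds_diag q0 q1 _ csmb_gamG) csum_gamG; congr (_ * _); apply: eq_csum => r.
by rewrite -expfzDr//; congr (_ * q ^ _); ring.
Qed.

(** The aim is the left side of [ds_lattice]. [ds_contig] rewrites the first sum, and [betG_odd]
    shows that the leftover in [betG] is the wanted term in [betG'] minus the second sum. *)
Lemma ds_betG_3 : ds q 0 1 betG + q ^+ 2 * ds q 2 3 betG' = (qinf q q)^-1 * thF q 3.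
Proof.
have <- : (qinf q q)^-1 * csum (fun r => q ^ (2 * (r * r) + r) * gamG r) = (qinf q q)^-1 * thF q 3.
  rewrite csum_gamG; congr (_ * _); apply: eq_csum => r.
  by rewrite -expfzDr//; congr (_ * q ^ _); ring.
rewrite -(ds_lattice q0 q1 csmb_gamG) (funext bpG) (funext bpG').
have h1 := ds_contig q0 q1 0 0 bnd_betG; rewrite !add0r addr0 expr1z in h1.
have -> : ds q 0 1 betG = ds q 1 0 betG + q * ds q 2 1 betG by rewrite -h1 addrC subrK.
rewrite -addrA; congr (_ + _).
have sd := csmb_ds q0 q1; have bG := bnd_betG; have bG' := bnd_betG'.
rewrite (ds_pair q0 q1 2 1 bG) (ds_pair q0 q1 2 3 bG') (ds_pair q0 q1 2 1 bG').
rewrite -!csumZ; [|exact: sd|exact: sd|exact: sd].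
rewrite -csumD; [|by apply: csmbZ; exact: sd|by apply: csmbZ; exact: sd].
apply: eq_csum => -[n k] /=; rewrite betG_odd.
rewrite (_ : k * k + 3 * k = (k * k + 1 * k) + 2 * k); last by ring.
rewrite (expfzDr (k * k + 1 * k) _ q0) (expfzDr (2 * k) 1 q0) expr1z.
move: (q ^ (n * n + 2 * n)) (q ^ (k * k + 1 * k)) (q ^ (2 * k)) (rq _ _) (betG' k) => x y z t u.
by ring.
Qed.

Lemma ds_betG_5 : ds q 1 1 betG' = (qinf q q)^-1 * thF q 5.
Proof.
rewrite -[betG'](funext bpG') (ds_diag q0 q1 _ csmb_gamG) csum_gamG; congr (_ * _); apply: eq_csum => r.
by rewrite -expfzDr//; congr (_ * q ^ _); ring.
Qed.

Lemma ds_betG_7 : ds q 1 2 betG' = (qinf q q)^-1 * thF q 7.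
Proof.
have -> : ds q 1 2 betG' = ds q 1 (1 + 1) (bp q gamG (1 + 1)).
  by congr (ds q 1 _ _); apply/funext => k; rewrite -bpG''.
rewrite (ds_mixed q0 q1 _ csmb_gamG); congr (_ * _).
rewrite !csum_gamG (_ : csum _ = thF q 7); last first.
  by apply: eq_csum => r; rewrite -expfzDr//; congr (_ * q ^ _); ring.
rewrite [X in _ + X](_ : _ = 0) ?addr0//; apply: (etrans _ (csum_sg_anti 11 2 q0)); apply: eq_csum => r.
by rewrite -expfzDr//; congr (_ * q ^ _); ring.
Qed.

Lemma ds_betG_9 : ds q 2 2 betG' = (qinf q q)^-1 * thF q 9.
Proof.
rewrite -[betG'](funext bpG'') (ds_diag q0 q1 _ csmb_gamG) csum_gamG; congr (_ * _); apply: eq_csum => r.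
by rewrite -expfzDr//; congr (_ * q ^ _); ring.
Qed.

End PairG.

(** * From triple sums to theta series *)

Section FiniteProducts.
Variable R : realType.
Implicit Types a p q : R[i].

Lemma qpoch_sqr a p n : qpoch a p n * qpoch (- a) p n = qpoch (a ^+ 2) (p ^+ 2) n.
Proof.
elim: n => [|n IH]; first by rewrite !qpoch0 mulr1.
rewrite !qpochS -IH -exprM mulnC exprM.
by move: (p ^+ n) (qpoch a p n) (qpoch (- a) p n) => x y z; ring.
Qed.

Lemma qpoch_double q n : qpoch q q (2 * n) = qpoch q (q ^+ 2) n * qpoch (q ^+ 2) (q ^+ 2) n.
Proof.
elim: n => [|n IH]; first by rewrite muln0 !qpoch0 mulr1.
rewrite (_ : (2 * n.+1 = (2 * n).+2)%N); last by lia.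
rewrite !qpochS IH -!exprM [q ^+ (2 * n).+1]exprS.
by move: (qpoch q _ n) (qpoch (q ^+ 2) _ n) (q ^+ (2 * n)) => x y z; ring.
Qed.

Lemma qpoch_doubleS q n :
  qpoch q q (2 * n).+1 = qpoch q (q ^+ 2) n.+1 * qpoch (q ^+ 2) (q ^+ 2) n.
Proof.
rewrite !qpochS qpoch_double -exprM.
by move: (qpoch q _ n) (qpoch (q ^+ 2) _ n) (q ^+ (2 * n)) => x y z; ring.
Qed.

End FiniteProducts.

Section InfiniteProductIdentities.
Variable R : realType.
Variable q : R[i].
Hypotheses (q0 : q != 0) (q1 : nrm q < 1).

Let q20 : q ^+ 2 != 0. Proof. exact: expf_neq0. Qed.
Let q21 : nrm (q ^+ 2) < 1. Proof. exact: nrm_expr_lt1. Qed.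
Let q40 : q ^+ 4 != 0. Proof. exact: expf_neq0. Qed.
Let q41 : nrm (q ^+ 4) < 1. Proof. exact: nrm_expr_lt1. Qed.

Lemma double_lim (u : nat -> R[i]) l : ctends u l -> ctends (fun n => u (2 * n)%N) l.
Proof. by apply: ctends_comp => n; lia. Qed.

Lemma qinf_double : qinf (q ^+ 2) q * qinf (q ^+ 2) (q ^+ 2) = qinf q q.
Proof.
have h1 := qinf_lim q20 q21 (ltW q1); have h2 := qinf_lim q20 q21 (ltW q21).
have h3 := double_lim (qinf_lim q0 q1 (ltW q1)).
apply: (ctends_uniq (ctendsM h1 h2)); apply: eq_ctends h3 => n.
by rewrite qpoch_double.
Qed.

Lemma qinf_sqr : qinf (q ^+ 2) q * qinf (q ^+ 2) (- q) = qinf (q ^+ 4) (q ^+ 2).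
Proof.
have nq : nrm (- q) <= 1 by rewrite nrmN ltW.
have h1 := qinf_lim q20 q21 (ltW q1); have h2 := qinf_lim q20 q21 nq.
have h3 := qinf_lim q40 q41 (ltW q21).
apply: (ctends_uniq (ctendsM h1 h2)); apply: eq_ctends h3 => n.
by rewrite qpoch_sqr -exprM.
Qed.

Lemma qinf_sqr1 : qinf (q ^+ 2) (q ^+ 2) * qinf (q ^+ 2) (- q ^+ 2) = qinf (q ^+ 4) (q ^+ 4).
Proof.
have nq : nrm (- q ^+ 2) <= 1 by rewrite nrmN ltW.
have h1 := qinf_lim q20 q21 (ltW q21); have h2 := qinf_lim q20 q21 nq.
have h3 := qinf_lim q40 q41 (ltW q41).
apply: (ctends_uniq (ctendsM h1 h2)); apply: eq_ctends h3 => n.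
by rewrite qpoch_sqr -!exprM.
Qed.

Local Notation E x := (qinf x x).

Lemma E2_neq0 : E (q ^+ 2) != 0. Proof. exact: qqinf_neq0. Qed.
Lemma pref_minus : qinf (q ^+ 2) q / E (q ^+ 2) = E q / E (q ^+ 2) ^+ 2.
Proof. by rewrite -qinf_double; have := E2_neq0 => h; field. Qed.

Lemma pref_minus_sq : qinf (q ^+ 2) (- q ^+ 2) / E (q ^+ 2) = E (q ^+ 4) / E (q ^+ 2) ^+ 2.
Proof. by rewrite -qinf_sqr1; have := E2_neq0 => h; field. Qed.

End InfiniteProductIdentities.

Section EtaQuotients.
Variable R : realType.
Variable q : R[i].
Hypotheses (q0 : q != 0) (q1 : nrm q < 1).
Local Notation E x := (qinf x x).

(** From (q;q^2)(-q;q^2) = (q^2;q^4) and two splittings of (x;x) into odd and even factors. *)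
Lemma pref_plus : qinf (q ^+ 2) (- q) / E (q ^+ 2) = E (q ^+ 2) / (E q * E (q ^+ 4)).
Proof.
have q20 : q ^+ 2 != 0 by exact: expf_neq0.
have q21 : nrm (q ^+ 2) < 1 by exact: nrm_expr_lt1.
have h1 := qinf_double q0 q1; have h2 := qinf_sqr q0 q1.
have h3 := qinf_double q20 q21; rewrite -exprM in h3.
have e : E (q ^+ 2) = qinf (q ^+ 2) q * qinf (q ^+ 2) (- q) * E (q ^+ 4) by rewrite h2.
have := E2_neq0 q0 q1; rewrite e !mulf_eq0 !negb_or => /andP[/andP[na nb] n4].
rewrite -h1 e; move: na nb n4; move: (qinf _ q) (qinf _ (- q)) (E (q ^+ 4)) => x y z *.
by field; do ?[apply/andP; split].
Qed.

End EtaQuotients.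

Lemma sq_ge (i : nat) : (i <= i ^ 2)%N.
Proof. by nia. Qed.

(** * Iterated limits as unconditional triple sums *)

Section TripleSums.
Variable R : realType.

Lemma lim_csumT (f : nat -> R[i]) : csmb f -> \big[+%R/0]_(0 <= i <oo) f i = csum f.
Proof. by move=> sf; exact: (@lim_csum _ xpredT). Qed.

Lemma csmb_if (T : choiceType) (P : pred T) (f : T -> R[i]) : csmb f ->
  csmb (fun x => if P x then f x else 0).
Proof.
by move=> sf; apply: (csmb_le sf) => x; case: ifP => _; [exact: lexx|rewrite nrm0 nrm_ge0].
Qed.

Lemma eq_lim (P : pred nat) (f g : nat -> R[i]) : f =1 g ->
  \big[+%R/0]_(0 <= i <oo | P i) f i = \big[+%R/0]_(0 <= i <oo | P i) g i.
Proof. by move=> /funext ->. Qed.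

Lemma triple_lim (P : pred nat) (t : nat -> nat -> nat -> R[i]) :
  csmb (fun z : nat * (nat * nat) => t z.1 z.2.1 z.2.2) ->
  \big[+%R/0]_(0 <= i <oo | P i) \big[+%R/0]_(0 <= j <oo) \big[+%R/0]_(0 <= k <oo) t i j k =
  csum (fun z : nat * (nat * nat) => if P z.1 then t z.1 z.2.1 z.2.2 else 0).
Proof.
move=> st; pose T (z : nat * (nat * nat)) := t z.1 z.2.1 z.2.2.
have e i : \big[+%R/0]_(0 <= j <oo) \big[+%R/0]_(0 <= k <oo) t i j k = csum (fun y => T (i, y)).
  have s2 : csmb (fun y => T (i, y)) by exact: (csmb_fiber st).
  rewrite (csum_pair s2) -lim_csumT; last exact: (csmb_csum s2).
  by apply: eq_lim => j; rewrite lim_csumT//; exact: (csmb_fiber s2 j).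
have s3 := csmb_if (fun z : nat * (nat * nat) => P z.1) st.
rewrite (csum_pair s3) (eq_lim P e) lim_csum; last exact: (csmb_if P (csmb_csum st)).
apply: eq_csum => i /=; case: ifP => // _; by rewrite csum_eq0.
Qed.

Lemma summ_geo3 (r : R) : 0 <= r -> r < 1 ->
  summ (fun z : nat * (nat * nat) => r ^+ z.1 * (r ^+ z.2.1 * r ^+ z.2.2)).
Proof.
move=> r0 r1; have g0 (i : nat) : 0 <= r ^+ i by rewrite exprn_ge0.
have sg := summ_geo r0 r1.
apply: (@summ_prod R _ _ (fun i : nat => r ^+ i) (fun y : nat * nat => r ^+ y.1 * r ^+ y.2)) => //.
  by move=> y; rewrite mulr_ge0.
exact: (@summ_prod R _ _ (fun i : nat => r ^+ i) (fun i : nat => r ^+ i)).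
Qed.

Lemma nrm_expr_le1 (x : R[i]) n : nrm x <= 1 -> nrm (x ^+ n) <= 1.
Proof. by move=> x1; rewrite nrmX exprn_ile1 ?nrm_ge0. Qed.

Lemma csmb_geo3 (x : R[i]) (K : R) (e : nat -> nat -> nat -> nat) (c : nat -> nat -> nat -> R[i]) :
  nrm x < 1 -> (forall i j k, (i + j + k <= e i j k)%N) -> (forall i j k, nrm (c i j k) <= K) ->
  csmb (fun z : nat * (nat * nat) => x ^+ e z.1 z.2.1 z.2.2 * c z.1 z.2.1 z.2.2).
Proof.
move=> x1 he hc; have K0 : 0 <= K := le_trans (nrm_ge0 _) (hc 0%N 0%N 0%N).
apply: (@csmb_le _ _ (fun z : nat * (nat * nat) => K * (nrm x ^+ z.1 * (nrm x ^+ z.2.1 * nrm x ^+ z.2.2)))).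
  apply: summZ => // [z|]; first by rewrite !mulr_ge0 ?exprn_ge0 ?nrm_ge0.
  by apply: summ_geo3 => //; exact: nrm_ge0.
move=> [i [j k]] /=; rewrite nrmM mulrC ler_pM ?nrm_ge0//.
rewrite nrmX mulrA -!exprD; apply: ler_wiXn2l; rewrite ?nrm_ge0 ?ltW//.
Qed.

End TripleSums.

Lemma expr_sq_bin (R : realType) (p : R[i]) (i : nat) : p ^+ (i ^ 2) = (p ^+ 2) ^+ 'C(i, 2) * p ^+ i.
Proof.
rewrite -exprM -exprD; congr (_ ^+ _); elim: i => // i IH.
by rewrite binS bin1; move: IH; rewrite -!mulnn; lia.
Qed.

(** * Reduction of F to theta series *)

Section FSums.
Variable R : realType.
Variable p : R[i].
Hypotheses (p0 : p != 0) (p1 : nrm p < 1).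
Implicit Types u v w : R[i].
Local Notation q := (p ^+ 2).

Let q0 : q != 0. Proof. exact: expf_neq0. Qed.
Let q1 : nrm q < 1. Proof. exact: nrm_expr_lt1. Qed.
Let r0 : p ^+ 4 != 0. Proof. exact: expf_neq0. Qed.
Let r1 : nrm (p ^+ 4) < 1. Proof. exact: nrm_expr_lt1. Qed.

Definition tF u v w (i j k : nat) : R[i] :=
  p ^+ (i ^ 2 + 2 * j ^ 2 + 4 * k ^ 2 + 2 * i * k + 4 * j * k)%N
       * u ^+ i * v ^+ j * w ^+ k
     / (qpoch q q i * qpoch q q j * qpoch (p ^+ 4) (p ^+ 4) k).

Lemma csmb_tF u v w : nrm u <= 1 -> nrm v <= 1 -> nrm w <= 1 ->
  csmb (fun z : nat * (nat * nat) => tF u v w z.1 z.2.1 z.2.2).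
Proof.
move=> u1 v1 w1.
pose c i j k := u ^+ i * v ^+ j * w ^+ k * ((qpoch q q i)^-1 * (qpoch q q j)^-1 * (qpoch (p ^+ 4) (p ^+ 4) k)^-1).
apply: (eq_csmb (f := fun z : nat * (nat * nat) =>
  p ^+ (z.1 ^ 2 + 2 * z.2.1 ^ 2 + 4 * z.2.2 ^ 2 + 2 * z.1 * z.2.2 + 4 * z.2.1 * z.2.2)%N * c z.1 z.2.1 z.2.2)).
  by move=> z; rewrite /tF /c !invfM !mulrA.
apply: (@csmb_geo3 _ _ (1 * 1 * 1 * (qbd q * qbd q * qbd (p ^+ 4))) (fun i j k => i ^ 2 + 2 * j ^ 2 + 4 * k ^ 2 + 2 * i * k + 4 * j * k)%N c) => //.
  by move=> i j k; have := sq_ge i; have := sq_ge j; have := sq_ge k; nia.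
move=> i j k; rewrite /c !nrmM !ler_pM ?mulr_ge0 ?nrm_ge0 ?nrm_expr_le1//; exact: nrm_qq_inv.
Qed.

Lemma FsumE P u v w : nrm u <= 1 -> nrm v <= 1 -> nrm w <= 1 ->
  Fsum P u v w p = csum (fun z : nat * (nat * nat) => if P z.1 then tF u v w z.1 z.2.1 z.2.2 else 0).
Proof. by move=> u1 v1 w1; rewrite -triple_lim//; exact: csmb_tF. Qed.

(** The index i is summed first: i^2/2 + i k is C(i,2) + i (1/2 + k), so its terms form Euler's
    series at - u p q^k. The last hypothesis says that the resulting product, over (p^4;p^4)_k, is a
    constant times a beta-sequence. *)
Lemma F_ds u (a b : nat) (be : nat -> R[i]) (bz : int -> R[i]) (C : R[i]) (K : R) :
  nrm u <= 1 -> (forall k : nat, nrm (be k) <= K) -> (forall k : nat, bz k%:Z = be k) ->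
  (forall k : int, k < 0 -> bz k = 0) ->
  (forall k, qinf q (- (u * p) * q ^+ k) / qpoch (p ^+ 4) (p ^+ 4) k = C * be k) ->
  F u (q ^+ a) (q ^+ b) p = C * ds q a (b%:Z - a%:Z) bz.
Proof.
move=> u1 hK hbz bz0 hC.
have v1 n : nrm (q ^+ n) <= 1 by apply: nrm_expr_le1; exact: ltW.
have sT := csmb_tF u1 (v1 a) (v1 b).
rewrite /F FsumE//= (csum_pair sT) (csum_swap sT) -(ds_nat q0 q1 a b hK hbz bz0) -csumZ; last first.
  exact: (csmb_ds_nat q0 q1 a b hK hbz bz0).
apply: eq_csum => -[j k] /=.
have a1 : nrm (- (u * p) * q ^+ k) <= 1.
  by rewrite mulNr nrmN !nrmM mulr_ile1 ?mulr_ge0 ?nrm_ge0 ?mulr_ile1 ?nrm_ge0 ?v1// ltW.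
rewrite (_ : C * _ = qinf q (- (u * p) * q ^+ k) * (q ^+ (j ^ 2 + 2 * j * k + 2 * k ^ 2 + a * j + b * k)%N /
   (qpoch q q j * qpoch (p ^+ 4) (p ^+ 4) k))); last first.
  by rewrite mulrCA -hC invfM; ring.
rewrite qinfE -csumZr; last exact: csmb_qinf.
apply: eq_csum => i; rewrite /tF mulNr opprK !exprMn -!exprM !invfM.
have -> : p ^+ (i ^ 2 + 2 * j ^ 2 + 4 * k ^ 2 + 2 * i * k + 4 * j * k)%N =
  p ^+ (2 * 'C(i, 2)) * p ^+ i * p ^+ (2 * k * i) * p ^+ (2 * (j ^ 2 + 2 * j * k + 2 * k ^ 2)).
  rewrite exprM -expr_sq_bin -!exprD; congr (_ ^+ _); ring.
have d n : p ^+ (2 * n) = p ^+ n * p ^+ n by rewrite mul2n -addnn exprD.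
have -> : p ^+ (j ^ 2 + 2 * j * k + 2 * k ^ 2 + a * j + b * k) =
  p ^+ (j ^ 2 + 2 * j * k + 2 * k ^ 2) * p ^+ (a * j) * p ^+ (b * k).
  by rewrite !exprD.
by rewrite -(mulnA 2 k i) !d; ring.
Qed.

End FSums.

Section FParity.
Variable R : realType.
Variable p : R[i].
Hypotheses (p0 : p != 0) (p1 : nrm p < 1).
Variables u v w : R[i].
Hypotheses (u1 : nrm u <= 1) (v1 : nrm v <= 1) (w1 : nrm w <= 1).

(** The exponent of p has the parity of i, and q is unaffected by p -> - p. Hence the parity parts
    of F are half the sum and half the difference of F at p and - p. *)
Lemma tF_opp i j k : tF (- p) u v w i j k = (-1) ^+ i * tF p u v w i j k.
Proof.
rewrite /tF sqrrN !(exprNn p).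
rewrite (_ : (-1) ^+ (i ^ 2 + _ + _ + _ + _)%N = (-1) ^+ i); last first.
  rewrite -signr_odd -[RHS]signr_odd; congr ((-1) ^+ _).
  have -> : (i ^ 2 + 2 * j ^ 2 + 4 * k ^ 2 + 2 * i * k + 4 * j * k =
    i * i + (j ^ 2 + 2 * k ^ 2 + i * k + 2 * j * k).*2)%N by rewrite -mul2n; ring.
  by rewrite oddD odd_double addbF oddM andbb.
rewrite (_ : (-1) ^+ 4 = 1); last by rewrite -signr_odd expr0.
by rewrite mul1r !mulrA.
Qed.

Lemma F_opp : F u v w (- p) = csum (fun z : nat * (nat * nat) => (-1) ^+ z.1 * tF p u v w z.1 z.2.1 z.2.2).
Proof.
have np0 : - p != 0 by rewrite oppr_eq0.
have np1 : nrm (- p) < 1 by rewrite nrmN.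
by rewrite /F FsumE//=; apply: eq_csum => z; rewrite tF_opp.
Qed.

Lemma csmb_tF_opp : csmb (fun z : nat * (nat * nat) => (-1) ^+ z.1 * tF p u v w z.1 z.2.1 z.2.2).
Proof.
apply: (csmb_mul_bounded (K := 1)) (csmb_tF p0 p1 u1 v1 w1) => z.
by rewrite nrmX nrmN nrm1 expr1n.
Qed.

Lemma Fpar0 : 2 * Fpar 0 u v w p = F u v w p + F u v w (- p).
Proof.
rewrite F_opp /F FsumE//= -(csumD (csmb_tF p0 p1 u1 v1 w1) csmb_tF_opp) /Fpar FsumE//.
rewrite -csumZ; last exact: (csmb_if (fun z : nat * (nat * nat) => z.1 == 0 %[mod 2]) (csmb_tF p0 p1 u1 v1 w1)).
apply: eq_csum => z; rewrite modn2 -signr_odd; case: (odd z.1) => /=.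
  by rewrite mulr0 expr1 mulN1r subrr.
by rewrite expr0 mul1r mulr_natl mulr2n.
Qed.

Lemma Fpar1 : 2 * Fpar 1 u v w p = F u v w p - F u v w (- p).
Proof.
rewrite F_opp /F FsumE//= -(csumB (csmb_tF p0 p1 u1 v1 w1) csmb_tF_opp) /Fpar FsumE//.
rewrite -csumZ; last exact: (csmb_if (fun z : nat * (nat * nat) => z.1 == 1 %[mod 2]) (csmb_tF p0 p1 u1 v1 w1)).
apply: eq_csum => z; rewrite modn2 -signr_odd; case: (odd z.1) => /=.
  by rewrite expr1 mulN1r opprK mulr_natl mulr2n.
by rewrite expr0 mul1r mulr0 subrr.
Qed.

End FParity.

Section FTheta.
Variable R : realType.
Variable s : R[i].
Hypotheses (s0 : s != 0) (s1 : nrm s < 1).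
Local Notation p := (s ^+ 2).
Local Notation q := (s ^+ 4).

Let p0 : p != 0. Proof. exact: expf_neq0. Qed.
Let p1 : nrm p < 1. Proof. exact: nrm_expr_lt1. Qed.
Let q0 : q != 0. Proof. exact: expf_neq0. Qed.
Let q1 : nrm q < 1. Proof. exact: nrm_expr_lt1. Qed.
Let pq : p ^+ 2 = q. Proof. by rewrite -exprM. Qed.
Let p4 : p ^+ 4 = s ^+ 8. Proof. by rewrite -exprM. Qed.
Let np1 : nrm (- p) <= 1. Proof. by rewrite nrmN ltW. Qed.

Lemma F_betF (a b : nat) : F 1 (q ^+ a) (q ^+ b) p = qinf q (- p) * ds q a (b%:Z - a%:Z) (betF s).
Proof.
have [K hK] := bnd_betF s0 s1.
have := @F_ds R p p0 p1 1 a b (fun k : nat => betF s k) (betF s) (qinf q (- p)) K.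
rewrite pq p4; apply => //; first by rewrite nrm1.
  by case.
move=> k; rewrite mul1r (qinf_poch q0 q1 k np1) /betF /denF.
have n1 := denF_neq0 s1 k; rewrite /denF in n1; have n2 := qpF_neq0 s1 k.
move: (qinf _ _) (qpoch _ _ k) (qpoch _ _ k) n1 n2 => x y z *.
by field; do ?[apply/andP; split].
Qed.

(** The extra factor q in [u] advances Euler's product by one step, whence the index k + 1 in
    [betF']. *)
Lemma F_betF' (a b : nat) : F q (q ^+ a) (q ^+ b) p = qinf q (- p) * ds q a (b%:Z - a%:Z) (betF' s).
Proof.
have [K hK] := bnd_betF' s0 s1.
have := @F_ds R p p0 p1 q a b (fun k : nat => betF' s k) (betF' s) (qinf q (- p)) K.
rewrite pq p4; apply => //; first exact: ltW.
  by case.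
move=> k; rewrite (qinf_poch q0 q1 k.+1 np1) /betF' /denF.
rewrite (_ : - (q * p) * q ^+ k = - p * q ^+ k.+1); last by rewrite [_ ^+ k.+1]exprS; ring.
have n1 := denF_neq0 s1 k; rewrite /denF in n1; have n2 := qpF_neq0 s1 k.+1.
move: (qinf _ _) (qpoch _ _ k) (qpoch _ _ k.+1) n1 n2 => x y z *.
by field; do ?[apply/andP; split].
Qed.

Local Notation c := (qinf q (- p) / qinf q q).

Lemma F_theta1 : F 1 1 1 p = c * thF s 1.
Proof. by have := F_betF 0 0; rewrite !expr0 subr0 (ds_betF_1 s0 s1) mulrA. Qed.

Lemma F_theta3 : F 1 1 q p = c * thF s 3.
Proof. by have := F_betF 0 1; rewrite expr0 expr1 subr0 (ds_betF_3 s0 s1) mulrA. Qed.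

Lemma F_theta5 : F 1 q q p + q * F q (q ^+ 2) (q ^+ 3) p = c * thF s 5.
Proof.
have := F_betF 1 1; rewrite !expr1 subrr => ->; rewrite (F_betF' 2 3) mulrCA -mulrDr.
by rewrite (_ : 3%:Z - 2%:Z = 1)// (ds_betF_5 s0 s1) mulrA.
Qed.

Lemma F_theta7 : F 1 q (q ^+ 2) p = c * thF s 7.
Proof. by have := F_betF 1 2; rewrite expr1 => ->; rewrite (_ : 2%:Z - 1%:Z = 1)// (ds_betF_7 s0 s1) mulrA. Qed.

Lemma F_theta9 : F q q (q ^+ 2) p = c * thF s 9.
Proof. by have := F_betF' 1 2; rewrite expr1 => ->; rewrite (_ : 2%:Z - 1%:Z = 1)// (ds_betF_9 s0 s1) mulrA. Qed.

End FTheta.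

(** * Reduction of the parity parts of G to theta series *)

Section GSums.
Variable R : realType.
Variable q : R[i].
Hypotheses (q0 : q != 0) (q1 : nrm q < 1).
Implicit Types u v w : R[i].
Local Notation Q := (q ^+ 2).

Let Q0 : Q != 0. Proof. exact: expf_neq0. Qed.
Let Q1 : nrm Q < 1. Proof. exact: nrm_expr_lt1. Qed.

Definition tG u v w (i j k : nat) : R[i] :=
  q ^+ (i ^ 2 + 2 * j ^ 2 + k ^ 2 + 2 * i * j + i * k)%N
       * u ^+ i * v ^+ j * w ^+ k
     / (qpoch q q i * qpoch Q Q j * qpoch Q Q k).

Lemma csmb_tG u v w : nrm u <= 1 -> nrm v <= 1 -> nrm w <= 1 ->
  csmb (fun z : nat * (nat * nat) => tG u v w z.1 z.2.1 z.2.2).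
Proof.
move=> u1 v1 w1.
pose c i j k := u ^+ i * v ^+ j * w ^+ k * ((qpoch q q i)^-1 * (qpoch Q Q j)^-1 * (qpoch Q Q k)^-1).
apply: (eq_csmb (f := fun z : nat * (nat * nat) =>
  q ^+ (z.1 ^ 2 + 2 * z.2.1 ^ 2 + z.2.2 ^ 2 + 2 * z.1 * z.2.1 + z.1 * z.2.2)%N * c z.1 z.2.1 z.2.2)).
  by move=> z; rewrite /tG /c !invfM !mulrA.
apply: (@csmb_geo3 _ _ (1 * 1 * 1 * (qbd q * qbd Q * qbd Q)) (fun i j k => i ^ 2 + 2 * j ^ 2 + k ^ 2 + 2 * i * j + i * k)%N c) => //.
  by move=> i j k; have := sq_ge i; have := sq_ge j; have := sq_ge k; nia.
move=> i j k; rewrite /c !nrmM !ler_pM ?mulr_ge0 ?nrm_ge0 ?nrm_expr_le1//; exact: nrm_qq_inv.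
Qed.

Lemma GsumE P u v w : nrm u <= 1 -> nrm v <= 1 -> nrm w <= 1 ->
  Gsum P u v w q = csum (fun z : nat * (nat * nat) => if P z.1 then tG u v w z.1 z.2.1 z.2.2 else 0).
Proof. by move=> u1 v1 w1; rewrite -triple_lim//; exact: csmb_tG. Qed.

Lemma Gpar_sum u v w : nrm u <= 1 -> nrm v <= 1 -> nrm w <= 1 ->
  G u v w q = Gpar 0 u v w q + Gpar 1 u v w q.
Proof.
move=> u1 v1 w1; have sG := csmb_tG u1 v1 w1.
rewrite /G /Gpar !GsumE//= -csumD; last 2 first.
- exact: (csmb_if (fun z : nat * (nat * nat) => z.1 == 0 %[mod 2]) sG).
- exact: (csmb_if (fun z : nat * (nat * nat) => z.1 == 1 %[mod 2]) sG).
by apply: eq_csum => z; rewrite modn2; case: (odd z.1) => /=; rewrite ?add0r ?addr0.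
Qed.

(** Now the third index is summed, by Euler's series in base q^2, and i = 2 k + sg makes k the
    Bailey index: i^2 + 2 i j + 2 j^2 is twice the exponent in [ds_nat] up to terms of lower degree,
    whose constant part gives the power of q in front. *)
Lemma Gpar_ds (sg : nat) (a b : nat) w (be : nat -> R[i]) (bz : int -> R[i]) (C : R[i]) (K : R) :
  (sg < 2)%N -> nrm w <= 1 -> (forall k : nat, nrm (be k) <= K) -> (forall k : nat, bz k%:Z = be k) ->
  (forall k : int, k < 0 -> bz k = 0) ->
  (forall k, qinf Q (- (w * q ^+ (2 * k + sg).+1)) / qpoch q q (2 * k + sg) = C * be k) ->
  Gpar sg (q ^+ a) (q ^+ (2 * b)) w q =
  q ^+ (sg * a.+1) * C * ds Q (b + sg)%:Z ((a + 2 * sg)%:Z - (b + sg)%:Z) bz.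
Proof.
move=> sg2 w1 hK hbz bz0 hC.
have v1 n : nrm (q ^+ n) <= 1 by apply: nrm_expr_le1; exact: ltW.
have sT := csmb_tG (v1 a) (v1 (2 * b)%N) w1.
have ie : injective (fun z : nat * (nat * nat) => ((2 * z.1 + sg)%N, z.2)).
  by move=> [m y] [m' y'] /= [h ->]; congr (_, _); lia.
have sT' := csmb_inj ie sT.
rewrite /Gpar GsumE//= (csum_supp ie); last first.
  move=> [i y] h /=; case: ifP => // /eqP hi; exfalso; apply: (h ((i %/ 2)%N, y)).
  rewrite (modn_small sg2) in hi; rewrite /=; congr (_, _).
  by rewrite {2}(divn_eq i 2) hi mulnC.
rewrite (_ : csum _ = csum (fun z : nat * (nat * nat) => tG (q ^+ a) (q ^+ (2 * b)) w (2 * z.1 + sg)%N z.2.1 z.2.2)); last first.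
  by apply: eq_csum => z /=; rewrite mulnC modnMDl eqxx.
(* The index summed by Euler's series has to be innermost, so the other two are grouped. *)
pose sh (z : nat * nat * nat) : nat * (nat * nat) := (z.1.2, (z.1.1, z.2)).
pose sh' (z : nat * (nat * nat)) : nat * nat * nat := ((z.2.1, z.1), z.2.2).
rewrite (csum_bij (e := sh) (e' := sh')); [|by case=> -[]|by case=> ? []].
have ish : injective sh by apply: (can_inj (g := sh')); case=> -[].
rewrite (csum_pair (csmb_inj ish sT')) -(ds_nat Q0 Q1 _ _ hK hbz bz0) -csumZ; last first.
  exact: (csmb_ds_nat Q0 Q1 _ _ hK hbz bz0).
apply: eq_csum => -[j k]; rewrite /sh /=; set i := (2 * k + sg)%N.
have a1 : nrm (- (w * q ^+ i.+1)) <= 1.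
  by rewrite nrmN nrmM mulr_ile1 ?nrm_ge0.
set X := (j ^ 2 + 2 * j * k + 2 * k ^ 2 + (b + sg) * j + (a + 2 * sg) * k)%N.
rewrite (_ : q ^+ (sg * a.+1) * C * _ = qinf Q (- (w * q ^+ i.+1)) *
   (q ^+ (sg * a.+1) * Q ^+ X / (qpoch Q Q j * qpoch q q i))); last first.
  rewrite (_ : q ^+ (sg * a.+1) * C * (Q ^+ X / qpoch Q Q j * be k) = q ^+ (sg * a.+1) * (Q ^+ X / qpoch Q Q j * (C * be k))); last by ring.
  by rewrite -hC invfM /i; ring.
rewrite qinfE -csumZr; last exact: csmb_qinf.
apply: eq_csum => l; rewrite /tG opprK -(exprM q 2 X) exprMn -!exprM !invfM.
have -> : q ^+ (i ^ 2 + 2 * j ^ 2 + l ^ 2 + 2 * i * j + i * l)%N =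
  q ^+ (2 * 'C(l, 2)) * q ^+ (i.+1 * l) * q ^+ (i ^ 2 + 2 * j ^ 2 + 2 * i * j).
  rewrite (_ : q ^+ (2 * 'C(l, 2)) * q ^+ (i.+1 * l) = q ^+ (l ^ 2) * q ^+ (i * l)).
    by rewrite -!exprD; congr (_ ^+ _); ring.
  by rewrite (expr_sq_bin q) -exprM -!exprD mulSn; congr (_ ^+ _); ring.
have e : q ^+ (i ^ 2 + 2 * j ^ 2 + 2 * i * j) * q ^+ (a * i) * q ^+ (2 * b * j) = q ^+ (sg * a.+1) * q ^+ (2 * X).
  rewrite -!exprD /i /X; congr (_ ^+ _).
  by case: (sg) sg2 => [|[|]]// _; ring.
rewrite [LHS](_ : _ = q ^+ (2 * 'C(l, 2)) * q ^+ (i.+1 * l) * w ^+ l * (qpoch Q Q l)^-1 *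
  (q ^+ (i ^ 2 + 2 * j ^ 2 + 2 * i * j) * q ^+ (a * i) * q ^+ (2 * b * j)) *
  ((qpoch Q Q j)^-1 * (qpoch q q i)^-1)); last by move: (q ^+ (2 * 'C(l, 2))) (q ^+ (i.+1 * l)) (w ^+ l) (qpoch Q Q l)^-1 (qpoch Q Q j)^-1 (qpoch q q i)^-1 (q ^+ _) (q ^+ _) => *; ring.
rewrite e (_ : (w * q ^+ i.+1) ^+ l = w ^+ l * q ^+ (i.+1 * l)); last by rewrite exprMn -exprM.
rewrite (_ : q ^+ (2 * 'C(l, 2)) = q ^+ 'C(l, 2) * q ^+ 'C(l, 2)); last by rewrite mul2n -addnn exprD.
by move: (q ^+ 'C(l, 2)) (q ^+ (i.+1 * l)) (w ^+ l) (qpoch Q Q l)^-1 (qpoch Q Q j)^-1 (qpoch q q i)^-1 (q ^+ _) (q ^+ _) => *; ring.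
Qed.

End GSums.

Section GTheta.
Variable R : realType.
Variable q : R[i].
Hypotheses (q0 : q != 0) (q1 : nrm q < 1).
Local Notation Q := (q ^+ 2).

Let Q0 : Q != 0. Proof. exact: expf_neq0. Qed.
Let Q1 : nrm Q < 1. Proof. exact: nrm_expr_lt1. Qed.
Let nq1 : nrm (- q) <= 1. Proof. by rewrite nrmN ltW. Qed.
Lemma qpoch_q_neq0 m : qpoch q Q m != 0.
Proof. by apply: qpoch_neq0 q1 _ (lexx _) => /=; rewrite nrmX -[leRHS]expr1; apply: ler_wiXn2l; rewrite ?nrm_ge0 ?ltW. Qed.

Lemma qpoch_nq_neq0 m : qpoch (- q) Q m != 0.
Proof. by apply: qpoch_neq0 q1 _ _; rewrite ?nrmN// nrmX -[leRHS]expr1; apply: ler_wiXn2l; rewrite ?nrm_ge0 ?ltW. Qed.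

(** (q;q)_(2k) splits into odd and even factors; the odd ones combine with the denominator (-q;Q)_k
    of Euler's product into (Q;Q^2)_k. *)
Lemma Gpar0_betG (a b : nat) : Gpar 0 (q ^+ a) (q ^+ (2 * b)) 1 q =
  qinf Q (- q) * ds Q b (a%:Z - b%:Z) (betG Q).
Proof.
have [K hK] := bnd_betG Q0 Q1.
have := @Gpar_ds R q q0 q1 0 a b 1 (fun k : nat => betG Q k) (betG Q) (qinf Q (- q)) K.
rewrite muln0 !addn0 mul0n expr0 mul1r; apply => //; first by rewrite nrm1.
  by case.
move=> k; rewrite addn0 mul1r (_ : q ^+ (2 * k).+1 = q * Q ^+ k); last by rewrite -exprM -exprS.
rewrite -mulNr (qinf_poch Q0 Q1 k nq1) qpoch_double /betG -(qpoch_sqr q Q k).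
have n1 := qpoch_q_neq0 k; have n2 := qpoch_nq_neq0 k; have n3 := qq_neq0 Q1 k.
move: (qinf _ _) (qpoch _ _ k) (qpoch _ _ k) (qpoch _ _ k) n1 n2 n3 => x y z t *.
by field; do ?[apply/andP; split].
Qed.

Lemma Gpar1_betG' (a b : nat) : Gpar 1 (q ^+ a) (q ^+ (2 * b)) q q =
  q ^+ a.+1 * qinf Q (- q) * ds Q b.+1%:Z (a.+2%:Z - b.+1%:Z) (betG' Q).
Proof.
have [K hK] := bnd_betG' Q0 Q1.
have := @Gpar_ds R q q0 q1 1 a b q (fun k : nat => betG' Q k) (betG' Q) (qinf Q (- q)) K.
rewrite mul1n muln1 addn1 addn2; apply => //; first exact: ltW.
  by case.
move=> k; rewrite addn1 -exprS (_ : q ^+ (2 * k).+3 = q * Q ^+ k.+1); last first.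
  by rewrite -exprM -exprS mulnS.
rewrite -mulNr (qinf_poch Q0 Q1 k.+1 nq1) qpoch_doubleS /betG' -(qpoch_sqr q Q k.+1).
have n1 := qpoch_q_neq0 k.+1; have n2 := qpoch_nq_neq0 k.+1; have n3 := qq_neq0 Q1 k.
move: (qinf _ _) (qpoch _ _ k.+1) (qpoch _ _ k.+1) (qpoch _ _ k) n1 n2 n3 => x y z t *.
by field; do ?[apply/andP; split].
Qed.

Local Notation c := (qinf Q (- q) / qinf Q Q).

Lemma V_theta1 : Gpar 0 1 1 1 q = c * thF Q 1.
Proof. by have := Gpar0_betG 0 0; rewrite muln0 !expr0 subr0 (ds_betG_1 Q0 Q1) mulrA. Qed.

Lemma V_theta3 : Gpar 0 q 1 1 q + Gpar 1 (q ^+ 3) (q ^+ 2) q q = c * thF Q 3.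
Proof.
have := Gpar0_betG 1 0; rewrite muln0 expr0 expr1 subr0 => ->; rewrite (Gpar1_betG' 3 1).
rewrite (_ : 5%:Z - 2%:Z = 3)// -[RHS]mulrA -(ds_betG_3 Q0 Q1) -exprM; move: (ds _ _ _ _) (ds _ _ _ _) (qinf _ _) => x y z.
by ring.
Qed.

Lemma V_theta5 : Gpar 1 1 1 q q = q * (c * thF Q 5).
Proof. by have := Gpar1_betG' 0 0; rewrite muln0 !expr0 => ->; rewrite (_ : 2%:Z - 1%:Z = 1)// (ds_betG_5 Q0 Q1) expr1 !mulrA. Qed.

Lemma V_theta7 : Gpar 1 q 1 q q = q ^+ 2 * (c * thF Q 7).
Proof. by have := Gpar1_betG' 1 0; rewrite muln0 expr0 expr1 => ->; rewrite (_ : 3%:Z - 1%:Z = 2)// (ds_betG_7 Q0 Q1) !mulrA. Qed.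

Lemma V_theta9 : Gpar 1 (q ^+ 2) (q ^+ 2) q q = q ^+ 3 * (c * thF Q 9).
Proof. by rewrite (Gpar1_betG' 2 1) (_ : 4%:Z - 2%:Z = 2)// (ds_betG_9 Q0 Q1) !mulrA. Qed.

(** With s^2 = - q the pair behind F acquires the base s^4 = q^2 and the factor (-s^2;s^4)_k =
    (q;q^2)_k, as required by the parity parts of G that make up [Vstar]. *)
Variable s : R[i].
Hypothesis (sq : s ^+ 2 = - q).

Let s4 : s ^+ 4 = Q. Proof. by rewrite (exprM s 2 2) sq sqrrN. Qed.
Let s0 : s != 0. Proof. by have := q0; rewrite -oppr_eq0 -sq expf_eq0. Qed.
Let s1 : nrm s < 1.
Proof. by have := q1; rewrite -nrmN -sq nrmX expr_lt1 ?nrm_ge0. Qed.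
Let nQ1 : nrm (- Q) <= 1. Proof. by rewrite nrmN ltW. Qed.
Let s8 : s ^+ 8 = Q ^+ 2. Proof. by rewrite (exprM s 4 2) s4. Qed.
Let qnQ m : qpoch (- Q) Q m != 0.
Proof. by apply: qpoch_neq0 Q1 (lexx _) _; rewrite nrmN. Qed.

Lemma Gpar0_betF (a b : nat) : Gpar 0 (q ^+ a) (q ^+ (2 * b)) q q =
  qinf Q (- Q) * ds Q b (a%:Z - b%:Z) (betF s).
Proof.
have [K hK] := bnd_betF s0 s1.
have := @Gpar_ds R q q0 q1 0 a b q (fun k : nat => betF s k) (betF s) (qinf Q (- Q)) K.
rewrite muln0 !addn0 mul0n expr0 mul1r; apply => //; first exact: ltW.
  by case.
move=> k; rewrite addn0 -exprS (_ : q ^+ (2 * k).+2 = Q * Q ^+ k); last by rewrite -exprM -exprD.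
rewrite -mulNr (qinf_poch Q0 Q1 k nQ1) qpoch_double /betF /denF s8 sq opprK s4 -(qpoch_sqr Q Q k).
have n1 := qpoch_q_neq0 k; have n2 := qnQ k; have n3 := qq_neq0 Q1 k.
move: (qinf _ _) (qpoch _ _ k) (qpoch _ _ k) (qpoch _ _ k) n1 n2 n3 => x y z t *.
by field; do ?[apply/andP; split].
Qed.

Lemma Gpar1_betF' (a b : nat) : Gpar 1 (q ^+ a) (q ^+ (2 * b)) 1 q =
  q ^+ a.+1 * qinf Q (- Q) * ds Q b.+1%:Z (a.+2%:Z - b.+1%:Z) (betF' s).
Proof.
have [K hK] := bnd_betF' s0 s1.
have := @Gpar_ds R q q0 q1 1 a b 1 (fun k : nat => betF' s k) (betF' s) (qinf Q (- Q)) K.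
rewrite mul1n muln1 addn1 addn2; apply => //; first by rewrite nrm1.
  by case.
move=> k; rewrite addn1 mul1r (_ : q ^+ (2 * k).+2 = Q * Q ^+ k); last by rewrite -exprM -exprD.
rewrite -mulNr (qinf_poch Q0 Q1 k nQ1) qpoch_doubleS /betF' /denF s8 sq opprK s4 -(qpoch_sqr Q Q k).
have n1 := qpoch_q_neq0 k.+1; have n2 := qnQ k; have n3 := qq_neq0 Q1 k.
move: (qinf _ _) (qpoch _ _ k.+1) (qpoch _ _ k) (qpoch _ _ k) n1 n2 n3 => x y z t *.
by field; do ?[apply/andP; split].
Qed.

Local Notation d := (qinf Q (- Q) / qinf Q Q).

Lemma Vstar_theta1 : Gpar 0 1 1 q q = d * thF s 1.
Proof.
by have := Gpar0_betF 0 0; have := ds_betF_1 s0 s1; rewrite s4 muln0 !expr0 subr0 => -> ->; rewrite mulrA.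
Qed.

Lemma Vstar_theta3 : Gpar 0 q 1 q q = d * thF s 3.
Proof.
by have := Gpar0_betF 1 0; have := ds_betF_3 s0 s1; rewrite s4 muln0 expr0 expr1 subr0 => -> ->; rewrite mulrA.
Qed.

Lemma Vstar_theta5 : Gpar 1 q 1 1 q + Gpar 0 (q ^+ 3) (q ^+ 2) q q = d * thF s 5.
Proof.
have := Gpar1_betF' 1 0; rewrite muln0 expr0 expr1 => ->; rewrite (Gpar0_betF 3 1).
have := ds_betF_5' s0 s1; rewrite s4 => e; rewrite -[RHS]mulrA -e.
rewrite (_ : 3%:Z - 1%:Z = 2)//; move: (ds _ _ _ _) (ds _ _ _ _) (qinf _ _) => x y z.
by ring.
Qed.

Lemma Vstar_theta7 : Gpar 0 (q ^+ 2) (q ^+ 2) q q = d * thF s 7.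
Proof.
by rewrite (Gpar0_betF 2 1) (_ : 2%:Z - 1%:Z = 1)//; have := ds_betF_7 s0 s1; rewrite s4 => ->; rewrite mulrA.
Qed.

Lemma Vstar_theta9 : Gpar 1 1 1 1 q = q * (d * thF s 9).
Proof.
have := Gpar1_betF' 0 0; rewrite muln0 !expr0 expr1 => ->.
by rewrite (_ : 2%:Z - 1%:Z = 1)//; have := ds_betF_9 s0 s1; rewrite s4 => ->; rewrite !mulrA.
Qed.

End GTheta.

(** * Theta inversion *)

Section ComplexExponential.
Variable R : realType.
Implicit Types z w : R[i].

Fact ce_spec : {f : R[i] -> R[i] | forall z, f z = cexp z}.
Proof. by exists (@cexp R). Qed.
Definition ce : R[i] -> R[i] := sval ce_spec.
Lemma ceE z : ce z = cexp z.
Proof. exact: (svalP ce_spec). Qed.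

Lemma ce_ReIm z : ce z = (expR (Re z) * cos (Im z)) +i* (expR (Re z) * sin (Im z)).
Proof. by rewrite ceE /cexp /=; congr (_ +i* _); rewrite mul0r ?subr0 ?addr0. Qed.

Lemma ceD z w : ce (z + w) = ce z * ce w.
Proof.
rewrite !ce_ReIm Re_add Im_add expRD cosD sinD; apply/eqP; rewrite eq_complex /=.
by apply/andP; split; apply/eqP; ring.
Qed.

Lemma ce0 : ce 0 = 1.
Proof. by rewrite ce_ReIm /= expR0 cos0 sin0 mulr1 mulr0. Qed.

Lemma nrm_ce z : nrm (ce z) = expR (Re z).
Proof.
rewrite ceE /cexp nrmM nrm_real ger0_norm ?expR_ge0// [X in _ * X]nrm_def /=.
by rewrite cos2Dsin2 sqrtr1 mulr1.
Qed.

Lemma ce_neq0 z : ce z != 0.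
Proof. by rewrite -nrm_eq0 nrm_ce gt_eqF ?expR_gt0. Qed.

Lemma ceN z : ce (- z) = (ce z)^-1.
Proof. by apply: (mulfI (ce_neq0 z)); rewrite -ceD subrr ce0 divff ?ce_neq0. Qed.

Lemma ceX n z : ce (n%:R * z) = ce z ^+ n.
Proof. by elim: n => [|n IH]; rewrite ?mul0r ?ce0// exprS -IH -ceD mulrS mulrDl mul1r. Qed.

Lemma ceXz (n : int) z : ce (n%:~R * z) = ce z ^ n.
Proof.
case: n => n; first exact: ceX.
by rewrite NegzE -exprnN mulrNz mulNr ceN ceX.
Qed.

Lemma ce_pi : ce (pi%:C * 'i) = -1.
Proof.
rewrite ce_ReIm; have -> : Re (pi%:C * 'i : R[i]) = 0 by rewrite Re_mul /=; ring.
have -> : Im (pi%:C * 'i : R[i]) = pi by rewrite Im_mul /=; ring.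
rewrite expR0 cospi sinpi mul1r mulr0; apply/eqP; rewrite eq_complex /=.
by rewrite oppr0 !eqxx.
Qed.

Lemma ce_2pi : ce (2 * (pi%:C * 'i)) = 1.
Proof. by rewrite (ceX 2) ce_pi sqrrN expr1n. Qed.

Lemma ce_2piz (n : int) : ce (n%:~R * (2 * (pi%:C * 'i))) = 1.
Proof. by rewrite ceXz ce_2pi exp1rz. Qed.

End ComplexExponential.

(** * Estimates for exponential, sine and cosine *)

Section RealEstimates.
Variable R : realType.
Implicit Types x y t : R.

Lemma expR_sub1_le x : expR x - 1 <= x * expR x.
Proof.
have h := expR_ge1Dx (- x); have e : expR x * expR (- x) = 1 by rewrite -expRD subrr expR0.
have := ler_wpM2l (expR_ge0 x) h; rewrite e mulrDr mulr1 mulrN [expR x * x]mulrC; lra.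
Qed.

Lemma norm_expR_sub1 x : `|expR x - 1| <= `|x| * expR `|x|.
Proof.
have h1 := expR_sub1_le x; have h2 := expR_ge1Dx x.
have [x0|x0] := leP 0 x.
  by rewrite (ger0_norm x0) ger0_norm; [exact: h1|lra].
have e1 : expR x <= 1 by rewrite -expR0 ler_expR ltW.
have e2 : 1 <= expR (- x) by rewrite -expR0 ler_expR oppr_ge0 ltW.
rewrite ler0_norm; last by lra.
have : - x * 1 <= - x * expR (- x) by rewrite ler_wpM2l// oppr_ge0 ltW.
by rewrite (ltr0_norm x0); lra.
Qed.

Lemma norm_expR_sub2 x : `|expR x - 1 - x| <= x ^+ 2 * expR `|x|.
Proof.
have h1 := expR_sub1_le x; have h2 := expR_ge1Dx x; have h3 := norm_expR_sub1 x.
rewrite ger0_norm; last by lra.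
apply: (le_trans (y := x * (expR x - 1))); first by rewrite mulrBr mulr1; lra.
apply: (le_trans (ler_norm _)); rewrite normrM -[in leRHS]real_normK ?num_real// expr2 -mulrA.
by rewrite ler_wpM2l.
Qed.

Lemma sin_mvt y : exists2 c, `|c| <= `|y| & sin y = y * cos c.
Proof.
wlog y0 : y / 0 <= y => [H|].
  have [y0|y0] := leP 0 y; first exact: H.
  have [|c h e] := H (- y); first by rewrite oppr_ge0 ltW.
  by exists c; rewrite ?normrN// in h *; move: e; rewrite sinN mulNr => /oppr_inj.
have cs : ({within `[0%R, y], continuous (@sin R)})%classic.
  by apply: continuous_subspaceT => x; exact: continuous_sin.
have [c] := MVT_segment (f := @sin R) (df := @cos R) y0 (fun x _ => is_derive_sin x) cs.
rewrite in_itv/= => /andP[c0 cy]; rewrite sin0 !subr0 => e.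
by exists c; [rewrite !ger0_norm|rewrite mulrC].
Qed.

Lemma norm_sin_le y : `|sin y| <= `|y|.
Proof.
have [c _ ->] := sin_mvt y; rewrite normrM -[leRHS]mulr1 ler_wpM2l//.
by rewrite ler_norml cos_geN1 cos_le1.
Qed.

Lemma one_sub_cos y : 1 - cos y = 2 * sin (y / 2) ^+ 2.
Proof.
have {1}-> : y = y / 2 + y / 2 by lra.
by rewrite cosD -!expr2 cos2sin2; ring.
Qed.

Lemma norm_cos_sub1_sq y : `|cos y - 1| <= y ^+ 2.
Proof.
rewrite distrC one_sub_cos ger0_norm; last by rewrite pmulr_rge0// sqr_ge0.
have h := norm_sin_le (y / 2).
have : sin (y / 2) ^+ 2 <= (y / 2) ^+ 2 by rewrite -[leLHS]real_normK ?num_real// -[leRHS]real_normK ?num_real// lerXn2r ?nnegrE ?normr_ge0.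
have := sqr_ge0 y; rewrite expr_div_n; lra.
Qed.

Lemma norm_cos_sub1 y : `|cos y - 1| <= `|y|.
Proof.
rewrite distrC one_sub_cos ger0_norm; last by rewrite pmulr_rge0// sqr_ge0.
have h := norm_sin_le (y / 2).
have s1 : `|sin (y / 2)| <= 1 by rewrite ler_norml sin_geN1 sin_le1.
have : sin (y / 2) ^+ 2 <= `|sin (y / 2)|.
  by rewrite -[leLHS]real_normK ?num_real// expr2 -[leRHS]mulr1 ler_wpM2l.
move: h; rewrite normrM (ger0_norm (x := 2^-1)) ?invr_ge0//; lra.
Qed.

Lemma norm_sin_sub y : `|sin y - y| <= y ^+ 2.
Proof.
have [c h ->] := sin_mvt y.
rewrite (_ : y * cos c - y = y * (cos c - 1)); last by ring.
rewrite normrM -[leRHS]real_normK ?num_real// expr2 ler_wpM2l//.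
exact: le_trans (norm_cos_sub1 c) h.
Qed.

(** sin y = 2 sin(y/2) cos(y/2), and sin(y/2) is y/2 times a cosine; both cosines are at least
    cos(pi/4), whose square is 1/2. *)
Lemma sin_ge_half y : 0 <= y -> y <= pi / 2 -> y / 2 <= sin y.
Proof.
move=> y0 y1; have p0 := pi_gt0 R.
have cge t : 0 <= t -> t <= pi / 4 -> cos (pi / 4) <= cos t.
  move=> t0 t1; case: (eqVneq t (pi / 4)) => [->//|ne].
  have lt : t < pi / 4 by rewrite lt_neqAle ne.
  by apply/ltW; rewrite ltr_cos // ?in_itv /=; lra.
have c4 : cos (pi / 4) ^+ 2 = 1 / 2 :> R.
  have := one_sub_cos (pi / 2 : R); rewrite cos_pihalf.
  rewrite (_ : pi / 2 / 2 = pi / 4); last by field.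
  have := cos2Dsin2 (pi / 4 : R); lra.
have c40 : 0 <= cos (pi / 4) :> R by apply: cos_ge0_pihalf; lra.
have hh : sin y = 2 * sin (y / 2) * cos (y / 2).
  have {1}-> : y = y / 2 + y / 2 by lra.
  by rewrite sinD; ring.
have [c h e] := sin_mvt (y / 2).
have y20 : 0 <= y / 2 by lra.
have : cos (pi / 4) <= cos `|c| by apply: cge => //; rewrite (le_trans h)// ger0_norm//; lra.
have -> : cos `|c| = cos c by case: (ger0P c) => // _; rewrite cosN.
have : cos (pi / 4) <= cos (y / 2) by apply: cge; lra.
move: e hh c4 c40; move: (cos (pi / 4)) (cos (y / 2)) (cos c) => C A B e hh c4 c40 hA hB.
rewrite hh e (_ : 2 * (y / 2 * B) * A = y * (B * A)); last by field.
rewrite (_ : y / 2 = y * (1 / 2)); last by field.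
by rewrite ler_wpM2l// -c4 expr2 ler_pM.
Qed.

End RealEstimates.

Section ComplexEstimates.
Variable R : realType.
Implicit Types z w : R[i].

Lemma nrm_ce_taylor1 z : nrm (ce z - 1) <= 3 * nrm z * expR (nrm z).
Proof.
have hx := Re_le_nrm z; have hy := Im_le_nrm z.
apply: (le_trans (nrm_le_ReIm _)); rewrite !Re_add !Im_add ce_ReIm /=.
move: hx hy; move: (Re z) (Im z) (nrm z) => x y r hx hy.
rewrite oppr0 addr0; set E := expR x; set M := expR r.
have r0 : 0 <= r by apply: le_trans hx.
have EM : E <= M by rewrite ler_expR; exact: le_trans (ler_norm x) hx.
have M1 : 1 <= M by rewrite -[1](expR0) ler_expR.
have h1 : `|E - 1| <= r * M.
  by apply: (le_trans (norm_expR_sub1 x)); apply: ler_pM => //; rewrite ler_expR.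
have h2 : `|cos y - 1| <= r := le_trans (norm_cos_sub1 y) hy.
have h3 : `|sin y| <= r := le_trans (norm_sin_le y) hy.
have c1 : `|cos y| <= 1 by rewrite ler_norml cos_geN1 cos_le1.
have E0 : 0 <= E by rewrite expR_ge0.
have rM : r <= r * M by rewrite -[leLHS]mulr1 ler_wpM2l.
have a1 : `|E * cos y - 1| <= r * M + r.
  rewrite (_ : E * cos y - 1 = (E - 1) * cos y + (cos y - 1)); last by ring.
  apply: (le_trans (ler_normD _ _)); rewrite lerD// normrM -[leRHS]mulr1.
  by rewrite ler_pM.
have a2 : `|E * sin y| <= r * M.
  by rewrite normrM (ger0_norm E0) mulrC ler_pM.
by lra.
Qed.

Lemma nrm_ce_taylor2 z : nrm (ce z - 1 - z) <= 4 * nrm z ^+ 2 * expR (nrm z).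
Proof.
have hx := Re_le_nrm z; have hy := Im_le_nrm z.
apply: (le_trans (nrm_le_ReIm _)); rewrite !Re_add !Im_add ce_ReIm.
have {1}-> : Re (- z) = - Re z by case: (z).
have -> : Im (- z) = - Im z by case: (z).
rewrite /=; move: hx hy; move: (Re z) (Im z) (nrm z) => x y r hx hy.
rewrite oppr0 addr0; set E := expR x; set M := expR r.
have r0 : 0 <= r by apply: le_trans hx.
have EM : E <= M by rewrite ler_expR; exact: le_trans (ler_norm x) hx.
have M1 : 1 <= M by rewrite -[1](expR0) ler_expR.
have sqle t : `|t| <= r -> t ^+ 2 <= r ^+ 2.
  by move=> tr; rewrite -[leLHS]real_normK ?num_real// lerXn2r ?nnegrE.
have r20 : 0 <= r ^+ 2 by rewrite sqr_ge0.
have h0 : `|E - 1 - x| <= r ^+ 2 * M.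
  apply: (le_trans (norm_expR_sub2 x)); apply: ler_pM => //; rewrite ?sqr_ge0 ?expR_ge0//; first exact: sqle.
  by rewrite ler_expR.
have h1 : `|E - 1| <= r * M.
  by apply: (le_trans (norm_expR_sub1 x)); apply: ler_pM => //; rewrite ler_expR.
have h2 : `|cos y - 1| <= r ^+ 2 := le_trans (norm_cos_sub1_sq y) (sqle _ hy).
have h3 : `|sin y| <= r := le_trans (norm_sin_le y) hy.
have h4 : `|sin y - y| <= r ^+ 2 := le_trans (norm_sin_sub y) (sqle _ hy).
have E0 : 0 <= E by rewrite expR_ge0.
have rM : r ^+ 2 <= r ^+ 2 * M by rewrite -[leLHS]mulr1 ler_wpM2l.
have a1 : `|E * cos y - 1 - x| <= r ^+ 2 * M + r ^+ 2 * M.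
  rewrite (_ : E * cos y - 1 - x = (E - 1 - x) + (cos y - 1) * E); last by ring.
  apply: (le_trans (ler_normD _ _)); rewrite lerD// normrM (ger0_norm E0).
  by rewrite ler_pM.
have a2 : `|E * sin y - y| <= r ^+ 2 * M + r ^+ 2.
  rewrite (_ : E * sin y - y = (E - 1) * sin y + (sin y - y)); last by ring.
  apply: (le_trans (ler_normD _ _)); rewrite lerD// normrM.
  by rewrite (_ : r ^+ 2 * M = (r * M) * r); [rewrite ler_pM|ring].
by lra.
Qed.

End ComplexEstimates.

(** * Decay and Taylor expansion of the complex Gaussian *)

Section GaussianEstimates.
Variable R : realType.
Variable a : R[i].
Hypothesis a0 : 0 < Re a.
Implicit Types y z w : R[i].

Definition gauss z : R[i] := ce (- a * z ^+ 2).

Lemma quad_le (A B C : R) : 0 < A -> exists L, forall t, - A * t ^+ 2 + B * t + C <= L - t.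
Proof.
move=> A0; exists (C + (B + 1) ^+ 2 / (4 * A)) => t.
have : 0 <= A * (t - (B + 1) / (2 * A)) ^+ 2 by rewrite mulr_ge0 ?sqr_ge0 ?ltW.
rewrite (_ : A * (t - (B + 1) / (2 * A)) ^+ 2 = A * t ^+ 2 - (B + 1) * t + (B + 1) ^+ 2 / (4 * A)).
  by lra.
by field; rewrite gt_eqF.
Qed.

Lemma nrm_gauss_le (Y : R) (x : R) y : nrm y <= Y ->
  nrm (gauss (x%:C + y)) <= expR (- Re a * `|x| ^+ 2 + 2 * nrm a * Y * `|x| + nrm a * Y ^+ 2).
Proof.
move=> yY; have Y0 : 0 <= Y := le_trans (nrm_ge0 _) yY.
rewrite /gauss nrm_ce ler_expR.
rewrite (_ : - a * (x%:C + y) ^+ 2 = (- (x ^+ 2))%:C * a + - (a * (2 * x%:C * y + y ^+ 2))); last first.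
  by rewrite rmorphN rmorphXn /=; move: (x%:C) => t; ring.
rewrite Re_add (_ : Re ((- (x ^+ 2))%:C * a) = - Re a * `|x| ^+ 2); last first.
  by rewrite real_normK ?num_real// Re_mul /=; ring.
rewrite -addrA lerD2l; apply: (le_trans (ler_norm _)); apply: (le_trans (Re_le_nrm _)).
rewrite nrmN nrmM [leRHS](_ : _ = nrm a * (2 * `|x| * Y + Y ^+ 2)); last by ring.
rewrite ler_wpM2l ?nrm_ge0//; apply: (le_trans (nrm_triangle _ _)).
rewrite nrmX 2!nrmM nrm_real (nrm_nat R 2).
apply: lerD; last by rewrite lerXn2r ?nnegrE ?nrm_ge0.
by rewrite ler_wpM2l// mulr_ge0.
Qed.

(** The free rate [B] lets the Gaussian absorb polynomial and exponential factors in |z|, uniformly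
    on a strip. *)
Lemma gauss_decay (B Y : R) : 0 <= B -> exists2 K, 0 <= K & forall (x : R) y, nrm y <= Y ->
  expR (B * nrm (x%:C + y)) * nrm (gauss (x%:C + y)) <= K * expR (- `|x|).
Proof.
move=> B0; have [L hL] := quad_le (B + 2 * nrm a * Y) (B * Y + nrm a * Y ^+ 2) a0.
exists (expR L) => [|x y yY]; first exact: expR_ge0.
apply: (le_trans (ler_wpM2l (expR_ge0 _) (nrm_gauss_le x yY))).
rewrite -!expRD ler_expR.
have h : B * nrm (x%:C + y) <= B * `|x| + B * Y.
  by rewrite -mulrDr ler_wpM2l// (le_trans (nrm_triangle _ _))// nrm_real lerD2l.
have := hL `|x|; lra.
Qed.

Lemma gauss_taylor (Y : R) : 0 <= Y -> exists2 K, 0 <= K & forall (x : R) y w, nrm y <= Y -> nrm w <= Y ->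
  nrm (gauss (x%:C + y + w) - gauss (x%:C + y) + 2 * a * (x%:C + y) * w * gauss (x%:C + y))
    <= K * nrm w ^+ 2 * expR (- `|x|).
Proof.
move=> Y0; pose A := nrm a; have A0 : 0 <= A by exact: nrm_ge0.
(* For u = 2 |z| + Y, the factor u^2 exp(Y A u) is at most exp((2 + Y A) u), which grows in |z| at
   the rate 2 (2 + Y A). *)
pose B := 2 * (2 + Y * A); have B0 : 0 <= B by rewrite mulr_ge0 ?addr_ge0 ?mulr_ge0.
have [K K0 hK] := @gauss_decay B Y B0.
pose C := 4 * A ^+ 2 * expR ((2 + Y * A) * Y) + A.
have C0 : 0 <= C by rewrite addr_ge0 ?mulr_ge0 ?sqr_ge0 ?expR_ge0.
exists (C * K) => [|x y w yY wY]; first by rewrite mulr_ge0.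
set z := x%:C + y; set zeta := - (2 * a * z * w) - a * w ^+ 2.
have -> : gauss (z + w) = gauss z * ce zeta.
  by rewrite /gauss -ceD; congr ce; rewrite /zeta; move: (z) => t; ring.
rewrite (_ : gauss z * ce zeta - gauss z + 2 * a * z * w * gauss z =
             gauss z * (ce zeta - 1 - zeta) - a * w ^+ 2 * gauss z); last first.
  by rewrite /zeta; move: (gauss z) (ce _) => g e; ring.
apply: (le_trans (nrmB_triangle _ _)); rewrite (nrmM (gauss z)) (nrmM (a * w ^+ 2)) (nrmM a) nrmX -/A.
set u := 2 * nrm z + Y; set W := nrm w.
have W0 : 0 <= W by exact: nrm_ge0.
have u0 : 0 <= u by rewrite addr_ge0 ?mulr_ge0 ?nrm_ge0.
have hz : nrm zeta <= W * (A * u).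
  apply: (le_trans (nrmB_triangle _ _)); rewrite nrmN (nrmM a (w ^+ 2)) nrmX !nrmM (nrm_nat R 2) -/A -/W.
  rewrite (_ : W * (A * u) = 2 * A * nrm z * W + A * (W * Y)); last by rewrite /u; ring.
  by rewrite lerD2l ler_wpM2l// expr2 ler_wpM2l.
have hz2 : nrm zeta <= Y * A * u.
  by apply: (le_trans hz); rewrite -mulrA ler_wpM2r// mulr_ge0.
have ub : u ^+ 2 * expR (Y * A * u) <= expR ((2 + Y * A) * Y) * expR (B * nrm z).
  have -> : expR ((2 + Y * A) * Y) * expR (B * nrm z) = expR u ^+ 2 * expR (Y * A * u).
    by rewrite expr2 -!expRD; congr expR; rewrite /u /B; ring.
  rewrite ler_wpM2r ?expR_ge0// lerXn2r ?nnegrE ?expR_ge0//.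
  by have := expR_ge1Dx u; lra.
have h1 : nrm (ce zeta - 1 - zeta) <= 4 * A ^+ 2 * W ^+ 2 * (u ^+ 2 * expR (Y * A * u)).
  apply: (le_trans (nrm_ce_taylor2 _)).
  rewrite (_ : 4 * A ^+ 2 * W ^+ 2 * (u ^+ 2 * expR (Y * A * u)) = 4 * (W * (A * u)) ^+ 2 * expR (Y * A * u)); last by ring.
  apply: ler_pM; rewrite ?ler_expR ?expR_ge0//; first by rewrite pmulr_rge0// exprn_ge0 ?nrm_ge0.
  by rewrite ler_wpM2l// lerXn2r ?nnegrE ?nrm_ge0 ?mulr_ge0.
have g0 := nrm_ge0 (gauss z).
have h2 : nrm (gauss z) * nrm (ce zeta - 1 - zeta) <=
    4 * A ^+ 2 * expR ((2 + Y * A) * Y) * W ^+ 2 * (expR (B * nrm z) * nrm (gauss z)).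
  apply: (le_trans (ler_wpM2l g0 h1)).
  rewrite [leRHS](_ : _ = nrm (gauss z) * (4 * A ^+ 2 * W ^+ 2 * (expR ((2 + Y * A) * Y) * expR (B * nrm z)))); last by ring.
  by rewrite ler_wpM2l// ler_wpM2l// mulr_ge0 ?sqr_ge0// mulr_ge0 ?sqr_ge0.
have h3 : A * W ^+ 2 * nrm (gauss z) <= A * W ^+ 2 * (expR (B * nrm z) * nrm (gauss z)).
  apply: ler_wpM2l; first by rewrite mulr_ge0 ?sqr_ge0.
  rewrite -[leLHS]mul1r ler_wpM2r// -[1]expR0 ler_expR mulr_ge0 ?nrm_ge0//.
apply: (le_trans (lerD h2 h3)).
have := ler_wpM2l (mulr_ge0 C0 (sqr_ge0 W)) (hK x y yY); rewrite -/z.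
rewrite /C; move: (expR (B * nrm z) * nrm (gauss z)) (expR (- `|x|)) (expR _) => p q r h; apply: le_trans (le_trans _ h) _.
  by rewrite le_eqVlt; apply/orP; left; apply/eqP; ring.
by rewrite le_eqVlt; apply/orP; left; apply/eqP; ring.
Qed.

End GaussianEstimates.

(** * Grids and Riemann sums of the Gaussian *)

Section Grid.
Variable R : realType.

Definition grid (N : nat) (m : int) : R := m%:~R / N.+1%:R.
Definition mesh (N : nat) : R := N.+1%:R^-1.

Lemma mesh_gt0 N : 0 < mesh N.
Proof. by rewrite invr_gt0 ltr0n. Qed.

Lemma mesh_le1 N : mesh N <= 1.
Proof. by rewrite invf_le1 ?ltr0n// ler1n. Qed.

Lemma meshK N : mesh N * N.+1%:R = 1.
Proof. by rewrite mulVf// pnatr_eq0. Qed.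

Lemma gridD N m k : grid N (m + k) = grid N m + grid N k.
Proof. by rewrite /grid intrD mulrDl. Qed.

Lemma grid1 N : grid N 1 = mesh N.
Proof. by rewrite /grid mul1r. Qed.

Lemma grid_mulN N (r : int) : grid N (N.+1%:Z * r) = r%:~R.
Proof. by rewrite /grid intrM mulrAC mulfV ?mul1r// pnatr_eq0. Qed.

Lemma grid_weight N m : expR (- `|grid N m|) = expR (- mesh N) ^+ `|m|%N.
Proof.
rewrite -expRM_natl; congr expR; rewrite /grid normrM -intr_norm normfV normr_nat -mulrN.
by congr (_ * _); rewrite -abszE.
Qed.

Let rat01 N : 0 <= expR (- mesh N) < 1.
Proof. by rewrite expR_ge0 expR_lt1 oppr_lt0 mesh_gt0. Qed.

Lemma summ_grid N : summ (fun m => expR (- `|grid N m|)).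
Proof.
have /andP[r0 r1] := rat01 N.
by apply: eq_summ (summ_geoz r0 r1) => m; rewrite grid_weight.
Qed.

Lemma nsum_grid N : nsum (fun m => expR (- `|grid N m|)) <= 4 * N.+1%:R.
Proof.
have /andP[r0 r1] := rat01 N; rewrite (eq_nsum (grid_weight N)).
apply: (le_trans (nsum_geoz_le r0 r1)); rewrite ler_pdivrMr ?subr_gt0//.
have h0 := mesh_gt0 N; have h1 := mesh_le1 N; have hk := meshK N.
have n0 : 0 < N.+1%:R :> R by rewrite ltr0n.
have h2 := expR_ge1Dx (mesh N).
have e : expR (mesh N) * expR (- mesh N) = 1 by rewrite -expRD subrr expR0.
have h3 : (1 + mesh N) * expR (- mesh N) <= 1 by rewrite -[leRHS]e ler_wpM2r.
have h4 : mesh N / 2 <= 1 - expR (- mesh N).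
  move: h3; move: (expR (- mesh N)) r0 r1 => r r0 r1 h3.
  have : 0 <= (1 - mesh N) * (1 - r) by rewrite mulr_ge0 ?subr_ge0// ltW.
  lra.
have := ler_wpM2l (ltW n0) h4; rewrite mulrA [N.+1%:R * mesh N]mulrC hk; lra.
Qed.

Lemma grid_csmb N (K : R) (f : int -> R[i]) : 0 <= K ->
  (forall m, nrm (f m) <= K * expR (- `|grid N m|)) -> csmb f.
Proof.
move=> K0 hf; apply: csmb_le hf; apply: (summZ K0 _ (summ_grid N)) => m.
exact: expR_ge0.
Qed.

Lemma grid_csum_le N (K : R) (f : int -> R[i]) : 0 <= K ->
  (forall m, nrm (f m) <= K * expR (- `|grid N m|)) -> nrm (csum f) <= 8 * K * N.+1%:R.
Proof.
move=> K0 hf; have e0 m : 0 <= expR (- `|grid N m|) by exact: expR_ge0.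
have sg := summ_grid N; apply: (le_trans (nrm_csum_le hf (summZ K0 e0 sg))).
by rewrite (nsumZ K0 e0 sg); have := ler_wpM2l K0 (nsum_grid N); lra.
Qed.

End Grid.

Section RiemannSums.
Variable R : realType.
Variable a : R[i].
Hypothesis a0 : 0 < Re a.
Implicit Types y z w : R[i].
Local Notation pt N m := ((grid R N m)%:C).
Local Notation h N := ((mesh R N)%:C).

Definition riemann (N : nat) y : R[i] := h N * csum (fun m => gauss a (pt N m + y)).

Lemma pt_succ N (m : int) y : pt N (m + 1) + y = pt N m + y + h N.
Proof. by rewrite gridD grid1 rmorphD /= addrAC. Qed.

Lemma nrm_h N : nrm (h N) = mesh R N.
Proof. by rewrite nrm_real gtr0_norm ?mesh_gt0. Qed.

Lemma csmb_gauss N y : csmb (fun m => gauss a (pt N m + y)).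
Proof.
have [K K0 hK] := gauss_decay a0 (nrm y) (lexx 0).
by apply: (@grid_csmb _ N K) => // m; have := hK (grid R N m) y (lexx _); rewrite mul0r expR0 mul1r.
Qed.

Lemma csmb_mul_gauss N y : csmb (fun m => (pt N m + y) * gauss a (pt N m + y)).
Proof.
have [K K0 hK] := gauss_decay a0 (nrm y) ler01.
apply: (@grid_csmb _ N K) => // m; apply: le_trans (hK (grid R N m) y (lexx _)).
rewrite nrmM mul1r ler_wpM2r ?nrm_ge0//; have := expR_ge1Dx (nrm (pt N m + y)); lra.
Qed.

Lemma riemann_bound y : exists2 K, 0 <= K & forall N, nrm (riemann N y) <= K.
Proof.
have [K K0 hK] := gauss_decay a0 (nrm y) (lexx 0).
exists (8 * K) => [|N]; first by rewrite mulr_ge0.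
rewrite /riemann nrmM nrm_h mulrC -ler_pdivlMr ?mesh_gt0// invrK.
by apply: grid_csum_le => // m; have := hK (grid R N m) y (lexx _); rewrite mul0r expR0 mul1r.
Qed.

(* The sum over the grid of f(z + h) - f(z) telescopes to 0, so the sum of f'
   is of order 1/h times smaller than its absolute value would suggest. *)
Lemma riemann_step (Y : R) : 1 <= Y -> exists2 C, 0 <= C & forall N y w, nrm y <= Y -> nrm w <= Y ->
  nrm (riemann N (y + w) - riemann N y) <= C * (nrm w ^+ 2 + nrm w * mesh R N).
Proof.
move=> Y1; have Y0 : 0 <= Y by exact: le_trans ler01 Y1.
have [K K0 hK] := gauss_taylor a0 Y0.
exists (8 * K) => [|N y w yY wY]; first by rewrite mulr_ge0.
pose f m := gauss a (pt N m + y); pose D := csum (fun m => (pt N m + y) * f m).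
have sf : csmb f by exact: csmb_gauss.
have sD : csmb (fun m => (pt N m + y) * f m) by exact: csmb_mul_gauss.
have taylor v : nrm v <= Y ->
    nrm (csum (fun m => gauss a (pt N m + (y + v))) - csum f + 2 * a * v * D) <= 8 * (K * nrm v ^+ 2) * N.+1%:R.
  move=> vY; rewrite -(csumB (csmb_gauss N (y + v)) sf) -(csumZ (2 * a * v) sD).
  rewrite -csumD; last exact: (csmbZ _ sD).
    apply: grid_csum_le => [|m]; first by rewrite mulr_ge0 ?sqr_ge0.
    have := hK (grid R N m) y v yY vY; rewrite -/(f m) addrA.
    by rewrite (_ : 2 * a * (pt N m + y) * v * f m = 2 * a * v * ((pt N m + y) * f m)); last by ring.
  exact: csmbB (csmb_gauss N (y + v)) sf.
have hD : nrm (2 * a * D) <= 8 * K.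
  have := taylor (h N); rewrite nrm_h => /(_ (le_trans (mesh_le1 R N) Y1)).
  rewrite (_ : csum (fun m => gauss a (pt N m + (y + h N))) = csum f); last first.
    rewrite [RHS](csum_shift 1); apply: eq_csum => m.
    by rewrite /f pt_succ addrA.
  rewrite subrr add0r (_ : 2 * a * h N * D = h N * (2 * a * D)); last by ring.
  rewrite nrmM nrm_h (_ : 8 * (K * mesh R N ^+ 2) * N.+1%:R = mesh R N * (8 * K * (mesh R N * N.+1%:R))); last by ring.
  by rewrite meshK mulr1 ler_pM2l ?mesh_gt0.
rewrite /riemann -mulrBr nrmM nrm_h.
have := taylor w wY; set S := _ - csum f => hS.
have {}hS : nrm S <= 8 * K * nrm w ^+ 2 * N.+1%:R + 8 * K * nrm w.
  rewrite (_ : S = (S + 2 * a * w * D) - w * (2 * a * D)); last by ring.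
  apply: (le_trans (nrmB_triangle _ _)); rewrite nrmM; have := ler_wpM2l (nrm_ge0 w) hD.
  by lra.
apply: (le_trans (ler_wpM2l (ltW (mesh_gt0 R N)) hS)).
rewrite (_ : mesh R N * _ = 8 * K * (nrm w ^+ 2 * (mesh R N * N.+1%:R) + nrm w * mesh R N)); last by ring.
by rewrite meshK mulr1.
Qed.

(** The shift is made in N + 1 equal steps, each costing O(1/N^2) by [riemann_step]. In the limit
    the Riemann sums do not notice a complex shift, which takes the place of moving the contour of a
    Gaussian integral. *)
Lemma riemann_shift (Y : R) : 1 <= Y -> exists2 C, 0 <= C & forall N y, nrm y <= Y ->
  nrm (riemann N y - riemann N 0) <= C / N.+1%:R.
Proof.
move=> Y1; have Y0 : 0 <= Y by exact: le_trans ler01 Y1.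
have [C C0 hC] := riemann_step Y1.
exists (C * (Y ^+ 2 + Y)) => [|N y yY]; first by rewrite mulr_ge0 ?addr_ge0 ?sqr_ge0.
rewrite -/(mesh R N); pose u k := riemann N (k%:R * h N * y).
have -> : riemann N y - riemann N 0 = \sum_(0 <= k < N.+1) (u k.+1 - u k).
  rewrite telescope_sumr// /u !mul0r; congr (riemann N _ - _).
  by rewrite -[LHS]mul1r; congr (_ * y); have := meshK R N => /(congr1 (fun x => x%:C)); rewrite rmorphM /= rmorph_nat => e; rewrite mulrC e.
apply: (le_trans (nrm_sum _ _ _)).
apply: (@le_trans _ _ (\sum_(0 <= k < N.+1) C * (Y ^+ 2 + Y) * mesh R N ^+ 2)).
  rewrite !big_nat; apply: ler_sum => k /andP[_ kN].
  have hy : nrm (h N * y) <= mesh R N * Y.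
    by rewrite nrmM nrm_h ler_wpM2l// ltW// mesh_gt0.
  have h0 := ltW (mesh_gt0 R N).
  have hyY : nrm (h N * y) <= Y.
    by apply: (le_trans hy); rewrite -[leRHS]mul1r ler_wpM2r// mesh_le1.
  have kY : nrm (k%:R * h N * y) <= Y.
    rewrite 2!nrmM nrm_nat nrm_h -[leRHS]mul1r ler_pM ?nrm_ge0 ?mulr_ge0//.
    by rewrite -[leRHS](meshK R N) [leLHS]mulrC ler_wpM2l// ler_nat ltnW.
  have := hC N _ _ kY hyY; rewrite -/(u k).
  rewrite (_ : k%:R * h N * y + h N * y = k.+1%:R * h N * y); last by rewrite -[k.+1]addn1 natrD; ring.
  move=> le; apply: (le_trans le); rewrite -mulrA ler_wpM2l//.
  rewrite (_ : (Y ^+ 2 + Y) * mesh R N ^+ 2 = (mesh R N * Y) ^+ 2 + mesh R N * Y * mesh R N); last by ring.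
  rewrite lerD//; first by rewrite lerXn2r ?nnegrE ?nrm_ge0// mulr_ge0.
  by rewrite ler_wpM2r.
rewrite sumr_const_nat subn0 -mulr_natr -mulrA expr2 -[mesh R N * mesh R N * _]mulrA meshK mulr1.
exact: lexx.
Qed.

End RiemannSums.

Lemma complete_square (K : fieldType) (a g z k p i : K) : a != 0 -> i * i = -1 ->
  - a * (g + z) ^+ 2 - k * (2 * (p * i)) * g =
  k * (2 * (p * i)) * z - (k * p) ^+ 2 / a + - a * (g + (z + k * (p * i) / a)) ^+ 2.
Proof.
move=> an i2.
rewrite (_ : - a * (g + (z + k * (p * i) / a)) ^+ 2 =
  - a * (g + z) ^+ 2 - 2 * k * p * i * (g + z) - (i * i) * (k * p) ^+ 2 / a); last by field.
by rewrite i2; ring.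
Qed.

(** * Finite Fourier series of the Gaussian *)

Section DiscreteFourier.
Variable R : realType.
Variable a : R[i].
Hypothesis a0 : 0 < Re a.
Variable z0 : R[i].
Local Notation pt N m := ((grid R N m)%:C).
Local Notation h N := ((mesh R N)%:C).
Local Notation tpi := (2 * (pi%:C * 'i) : R[i]).
Local Notation chi n x := (ce (- (n%:~R * tpi * x))).

Definition dft (N : nat) (n : int) : R[i] :=
  h N * csum (fun m => gauss a (pt N m + z0) * chi n (pt N m)).

(** Up to the factor [gauss a z0] this is the n-th term of the dual theta series; see [fcoefE]. *)
Definition fcoef (n : int) : R[i] := ce (n%:~R * tpi * z0 - (n%:~R * pi%:C) ^+ 2 / a).

Lemma nrm_chi (n : int) (x : R) : nrm (chi n x%:C) = 1.
Proof.
rewrite nrm_ce (_ : - (n%:~R * tpi * x%:C) = (- (n%:~R * (2 * pi) * x))%:C * 'i); last first.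
  by rewrite rmorphN !rmorphM /= rmorph_int rmorph_nat; ring.
by rewrite Re_mul /= mulr0 mul0r subr0 expR0.
Qed.

Lemma csmb_dft N n : csmb (fun m => gauss a (pt N m + z0) * chi n (pt N m)).
Proof.
apply: (csmb_le (csmb_gauss a0 N z0)) => m.
by rewrite nrmM nrm_chi mulr1.
Qed.

Lemma a_neq0 : a != 0.
Proof. by apply/eqP => e; move: a0; rewrite e ltxx. Qed.

(* Completing the square: the oscillating factor is a shift of the Gaussian by
   the imaginary amount i pi n / a. *)
Lemma dft_shift N n : dft N n = fcoef n * riemann a N (z0 + n%:~R * (pi%:C * 'i) / a).
Proof.
have an := a_neq0.
rewrite /dft /riemann (mulrCA (fcoef n) (h N)) -(csumZ (fcoef n) (csmb_gauss a0 N _)).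
congr (_ * _); apply: eq_csum => m; rewrite /gauss /fcoef -!ceD; congr ce.
by apply: complete_square => //; rewrite -expr2 sqrCi.
Qed.

Lemma pt_pred N (m : int) y : pt N (m - 1) + y = pt N m + y + - h N.
Proof. by rewrite gridD (_ : grid R N (-1) = - mesh R N) ?rmorphB /= 1?addrAC// /grid mulrNz mulNr mul1r. Qed.

Lemma chi_shift N n m : chi n (pt N (m - 1)) = ce (n%:~R * tpi * h N) * chi n (pt N m).
Proof.
rewrite -ceD; congr ce; have := pt_pred N m 0; rewrite !addr0 => ->; ring.
Qed.

Lemma chi_shift' N n m : chi n (pt N (m + 1)) = ce (- (n%:~R * tpi * h N)) * chi n (pt N m).
Proof.
rewrite -ceD; congr ce; have := @pt_succ R N m 0; rewrite !addr0 => ->; ring.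
Qed.

Lemma dft_bound0 : exists2 K, 0 <= K & forall N n, nrm (dft N n) <= K.
Proof.
have [K K0 hK] := gauss_decay a0 (nrm z0) (lexx 0).
exists (8 * K) => [|N n]; first by rewrite mulr_ge0.
rewrite /dft nrmM nrm_h mulrC -ler_pdivlMr ?mesh_gt0// invrK.
apply: grid_csum_le => // m; rewrite nrmM nrm_chi mulr1.
by have := hK (grid R N m) z0 (lexx _); rewrite mul0r expR0 mul1r.
Qed.

(* Summation by parts twice. *)
Lemma dft_second_difference : exists2 K, 0 <= K & forall N n,
  nrm (ce (n%:~R * tpi * h N) + ce (- (n%:~R * tpi * h N)) - 2) * nrm (dft N n) <= K * mesh R N ^+ 2.
Proof.
pose Y := nrm z0 + 1; have Y0 : 0 <= Y by rewrite addr_ge0 ?nrm_ge0.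
have [K K0 hK] := gauss_taylor a0 Y0.
exists (8 * (2 * K)) => [|N n]; first by rewrite !mulr_ge0.
set om := ce _; set om' := ce _; pose f m := gauss a (pt N m + z0).
pose S := csum (fun m => f m * chi n (pt N m)).
have s0 := csmb_dft N n; have e1 : csum (fun m => f (m + 1) * chi n (pt N m)) = om * S.
  rewrite /S -csumZ//; rewrite [RHS](csum_shift 1); apply: eq_csum => m.
  have := chi_shift N n (m + 1); rewrite addrK => ->; rewrite -/om.
  by move: (f _) (ce _) => x y; ring.
have e2 : csum (fun m => f (m - 1) * chi n (pt N m)) = om' * S.
  rewrite /S -csumZ//; rewrite [RHS](csum_shift (-1)); apply: eq_csum => m.
  have := chi_shift' N n (m - 1); rewrite subrK => ->; rewrite -/om'.
  by move: (f _) (ce _) => x y; ring.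
have c1 : csmb (fun m => f (m + 1) * chi n (pt N m)).
  apply: (csmb_le (csmb_gauss a0 N (z0 + h N))) => m.
  by rewrite nrmM nrm_chi mulr1 /f pt_succ addrA.
have c2 : csmb (fun m => f (m - 1) * chi n (pt N m)).
  apply: (csmb_le (csmb_gauss a0 N (z0 + - h N))) => m.
  by rewrite nrmM nrm_chi mulr1 /f pt_pred addrA.
rewrite -nrmM (_ : (om + om' - 2) * dft N n = h N * (om * S + om' * S - 2 * S)); last first.
  by rewrite /dft -/S; ring.
rewrite -e1 -e2 -(csumD c1 c2) -(csumZ 2 s0) -csumB; [|exact: csmbD|exact: csmbZ].
rewrite nrmM nrm_h; have hp := mesh_gt0 R N.
apply: (le_trans (ler_wpM2l (ltW hp) (@grid_csum_le R N (2 * K * mesh R N ^+ 2) _ _ _))).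
- by rewrite mulr_ge0 ?sqr_ge0// mulr_ge0.
- move=> m; set c := chi n (pt N m); rewrite -/(f m); set F := f m * c.
  have hw1 : nrm (h N) <= Y by rewrite nrm_h (le_trans (mesh_le1 R N))// lerDr nrm_ge0.
  have hw2 : nrm (- h N) <= Y by rewrite nrmN.
  have hz : nrm z0 <= Y by rewrite lerDl.
  have t1 := hK (grid R N m) z0 _ hz hw1; have t2 := hK (grid R N m) z0 _ hz hw2.
  rewrite nrmN nrm_h in t2; rewrite nrm_h in t1.
  rewrite (_ : f (m + 1) * c + f (m - 1) * c - 2 * F =
     ((gauss a (pt N m + z0 + h N) - gauss a (pt N m + z0) + 2 * a * (pt N m + z0) * h N * gauss a (pt N m + z0)) +
      (gauss a (pt N m + z0 + - h N) - gauss a (pt N m + z0) + 2 * a * (pt N m + z0) * - h N * gauss a (pt N m + z0))) * c); last first.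
    rewrite /F /f pt_succ pt_pred {F}.
    by move: c (gauss a (pt N m + z0)) (gauss a _) (gauss a _) => *; ring.
  rewrite nrmM nrm_chi mulr1; apply: (le_trans (nrm_triangle _ _)); lra.
rewrite (_ : mesh R N * _ = 8 * (2 * K) * mesh R N ^+ 2 * (mesh R N * N.+1%:R)); last by ring.
by rewrite meshK mulr1.
Qed.

Lemma chi_cos (t : R) : ce ((2 * t)%:C * 'i) + ce (- ((2 * t)%:C * 'i)) - 2 = (- 4 * sin t ^+ 2)%:C.
Proof.
have r s : Re (s%:C * 'i : R[i]) = 0 by rewrite Re_mul /= mulr0 mul0r subr0.
have i s : Im (s%:C * 'i : R[i]) = s by rewrite Im_mul /=; ring.
rewrite -mulNr -rmorphN !ce_ReIm !r !i expR0 !mul1r cosN sinN.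
rewrite (_ : 2 = 2%:C); last by rewrite rmorph_nat.
apply/eqP; rewrite eq_complex /=; apply/andP; split; apply/eqP; last by rewrite addrN subr0.
have := one_sub_cos (2 * t); rewrite (_ : 2 * t / 2 = t); last by field.
by lra.
Qed.

(** Up to half the sampling frequency the angle pi |n| / (N + 1) stays within [0, pi/2], where the
    sine is at least linear. *)
Lemma chi_lower N (n : int) : (2 * `|n| <= N.+1)%N ->
  (`|n|%N)%:R ^+ 2 * mesh R N ^+ 2 <= nrm (ce (n%:~R * tpi * h N) + ce (- (n%:~R * tpi * h N)) - 2).
Proof.
move=> hn; have hp := mesh_gt0 R N; pose t := pi * grid R N n.
rewrite (_ : n%:~R * tpi * h N = (2 * t)%:C * 'i); last first.
  by rewrite /t /grid -/(mesh R N) !rmorphM /= rmorph_int rmorph_nat; ring.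
rewrite chi_cos nrm_real mulNr normrN normrM (ger0_norm (x := 4))//.
rewrite ger0_norm ?sqr_ge0//.
have -> : sin t ^+ 2 = sin `|t| ^+ 2 by case: (ger0P t) => // _; rewrite sinN sqrrN.
have p2 := pi_ge2 R.
have nt : `|t| = pi * ((`|n|%N)%:R * mesh R N).
  rewrite /t normrM ger0_norm ?pi_ge0// /grid normrM normfV normr_nat -/(mesh R N).
  by rewrite -intr_norm -abszE.
have t1 : `|t| <= pi / 2.
  rewrite nt ler_wpM2l ?pi_ge0//.
  have : (2 * (`|n|%N)%:R) * mesh R N <= N.+1%:R * mesh R N.
    by rewrite ler_wpM2r ?(ltW hp)// -natrM ler_nat.
  by rewrite [leRHS]mulrC meshK; lra.
have := sin_ge_half (normr_ge0 t) t1; rewrite nt.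
set x := _%:R * mesh R N; have x0 : 0 <= x by rewrite mulr_ge0// ltW.
move=> le; have le' : x <= sin (pi * x).
  by apply: le_trans le; rewrite mulrAC -[leLHS]mul1r ler_wpM2r//; lra.
rewrite -exprMn -/x; apply: (le_trans (y := sin (pi * x) ^+ 2)).
  by rewrite lerXn2r ?nnegrE// (le_trans x0).
by have := sqr_ge0 (sin (pi * x)); lra.
Qed.

(** A majorant independent of [N], as Tannery's theorem requires: the uniform bound and the bound by
    second differences are added. *)
Lemma dft_bound : exists2 K, 0 <= K & forall N n, (2 * `|n| <= N.+1)%N ->
  nrm (dft N n) <= K * (1 + (`|n|%N)%:R ^+ 2)^-1.
Proof.
have [K K0 hK] := dft_second_difference; have [L L0 hL] := dft_bound0.
exists (L + K) => [|N n hn]; first by rewrite addr_ge0.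
have n2 : 0 <= (`|n|%N)%:R ^+ 2 :> R by rewrite sqr_ge0.
rewrite ler_pdivlMr; last by lra.
have h1 := hK N n; have h2 := chi_lower hn.
have := ler_wpM2r (nrm_ge0 (dft N n)) h2 => h3; have {h1 h3} := le_trans h3 h1.
rewrite mulrAC ler_pM2r; last by rewrite exprn_gt0 ?mesh_gt0.
by have := hL N n; lra.
Qed.

(** Orthogonality of characters modulo N + 1. Unless N + 1 divides m, the ratio [rho] of the
    geometric sum is not 1: otherwise [chi_cos] would give sin(pi r / (N + 1)) = 0 for the remainder
    0 < r < N + 1. *)
Lemma chi_sum N (M : int) (m : int) :
  \sum_(k < N.+1) chi ((k : nat)%:Z - M) (pt N m) = if (N.+1%:Z %| m)%Z then N.+1%:R else 0.
Proof.
have e r : pt N (N.+1%:Z * r) = r%:~R by rewrite grid_mulN rmorph_int.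
have hN : N.+1%:Z != 0 by [].
case: ifP => [/dvdzP[r ->]|hm].
  rewrite [r * _]mulrC (eq_bigr (fun=> 1)) ?sumr_const ?card_ord// => k _.
  rewrite e (_ : - _ = ((M - (k : nat)%:Z) * r)%:~R * tpi) ?ce_2piz//.
  by rewrite intrM !intrB; ring.
pose rho := chi 1 (pt N m).
have hk (k : nat) : chi (k%:Z - M) (pt N m) = ce (M%:~R * tpi * pt N m) * rho ^+ k.
  by rewrite -ceX -ceD; congr ce; rewrite intrB; ring.
rewrite (eq_bigr (fun k : 'I_N.+1 => ce (M%:~R * tpi * pt N m) * rho ^+ k)); last by move=> k _; exact: hk.
rewrite -mulr_sumr; suff : (rho - 1) * \sum_(k < N.+1) rho ^+ k = 0.
  move/eqP; rewrite mulf_eq0 => /orP[|/eqP->]; last by rewrite mulr0.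
  rewrite subr_eq0 => /eqP rho1; exfalso.
  pose r := (m %% N.+1%:Z)%Z.
  have r0 : 0 < r.
    by rewrite lt_def modz_ge0// andbT; apply/negP => /eqP r0; have /negP := negbT hm; apply; exact/dvdz_mod0P.
  have rN : r < N.+1%:Z by rewrite /r ltz_mod.
  have er : rho = ce (- ((2 * (pi * grid R N r))%:C * 'i)).
    have em : m = N.+1%:Z * (m %/ N.+1%:Z)%Z + r by rewrite mulrC -divz_eq.
    have ed : pt N m = (m %/ N.+1%:Z)%Z%:~R + pt N r by rewrite -e {1}em gridD rmorphD.
    rewrite /rho ed.
    rewrite (_ : - _ = (- (m %/ N.+1%:Z)%Z)%:~R * tpi + - ((2 * (pi * grid R N r))%:C * 'i)).
      by rewrite ceD ce_2piz mul1r.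
    by rewrite intrN !rmorphM /= rmorph_nat; ring.
  have := chi_cos (pi * grid R N r); rewrite -[ce (_ * 'i)]invrK -ceN -er rho1 invr1.
  rewrite (_ : 1 + 1 - 2 = 0 :> R[i]); last by ring.
  move=> /(congr1 (@complex.Re R)) /= /esym/eqP; rewrite mulf_eq0 oppr_eq0 pnatr_eq0 /= expf_eq0 /= => /eqP s0.
  have : 0 < sin (pi * grid R N r).
    apply: sin_gt0_pi; have p0 := pi_gt0 R.
    rewrite mulr_gt0 ?divr_gt0 ?ltr0z ?ltr0n//= -[ltRHS]mulr1 ltr_pM2l//.
    by rewrite /grid ltr_pdivrMr ?ltr0n// mul1r (_ : N.+1%:R = N.+1%:Z%:~R)// ltr_int.
  by rewrite s0 ltxx.
rewrite -subrX1 -ceX (_ : N.+1%:R * - (1%:~R * tpi * pt N m) = (- m)%:~R * tpi) ?ce_2piz ?subrr//.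
have := e 1; rewrite mulr1 mulr1z => e1; have en : N.+1%:R * pt N m = m%:~R.
  by rewrite -(rmorph_nat (real_complex R)) -rmorphM /= /grid mulrC divfK ?pnatr_eq0// rmorph_int.
by rewrite mul1r mulrN mulrCA en intrN; ring.
Qed.

(** A finite Poisson summation, exact for every [N]: summing over all frequencies keeps only the
    integer points of the grid. The frequencies are centred so as to stay in the range of
    [dft_bound]. *)
Lemma theta_dft N : csum (fun r : int => gauss a (r%:~R + z0)) =
  \sum_(k < N.+1) dft N ((k : nat)%:Z - (N.+1 %/ 2)%N%:Z).
Proof.
pose M : int := (N.+1 %/ 2)%N%:Z.
pose H m := gauss a (pt N m + z0) * (if (N.+1%:Z %| m)%Z then N.+1%:R else 0).
have -> : \sum_(k < N.+1) dft N ((k : nat)%:Z - M) = h N * csum H.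
  rewrite /dft -mulr_sumr; congr (_ * _); rewrite -csum_sum => [|k]; last exact: csmb_dft.
  by apply: eq_csum => m; rewrite /H -(chi_sum N M m) mulr_sumr.
rewrite (csum_supp (e := fun r : int => N.+1%:Z * r) (f := H)).
- rewrite -csumZ; last first.
    apply: (csmb_inj (e := fun r : int => N.+1%:Z * r) (f := H)) => [r r'|].
      by apply: mulfI.
    apply: (eq_csmb (f := fun m => (if (N.+1%:Z %| m)%Z then N.+1%:R else 0) * gauss a (pt N m + z0))).
      by move=> m; rewrite mulrC.
    apply: (csmb_mul_bounded (K := N.+1%:R)) (csmb_gauss a0 N z0) => m.
    by case: ifP => _; rewrite ?nrm_nat ?nrm0.
  apply: eq_csum => r; rewrite /H dvdz_mulr// grid_mulN rmorph_int mulrCA.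
  by have := meshK R N => /(congr1 (fun x => x%:C)); rewrite rmorphM /= rmorph_nat => ->; rewrite mulr1.
- by move=> r r'; apply: mulfI.
move=> m hm; rewrite /H; case: ifP => [/dvdzP[r e]|]; last by rewrite mulr0.
by case: (hm r); rewrite e mulrC.
Qed.

End DiscreteFourier.

(** * Theta functions, the Gaussian integral and inversion *)

Section Theta.
Variable R : realType.
Implicit Types a z : R[i].

Definition theta a z : R[i] := csum (fun m : int => gauss a (m%:~R + z)).

Lemma csmb_theta a z : 0 < Re a -> csmb (fun m : int => gauss a (m%:~R + z)).
Proof.
move=> a0; apply: eq_csmb (csmb_gauss a0 0 z) => m.
by rewrite /grid divr1 rmorph_int.
Qed.

Lemma Re_mulr_real (x : R) z : Re (x%:C * z) = x * Re z.
Proof. by rewrite Re_mul /= mul0r subr0. Qed.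

Lemma Re_inv_gt0 a : 0 < Re a -> 0 < Re a^-1.
Proof.
case: a => x y /= x0; rewrite divr_gt0// ltr_wpDr ?sqr_ge0// exprn_gt0//.
Qed.

Definition dual a : R[i] := (pi ^+ 2)%:C / a.

Lemma dual_gt0 a : 0 < Re a -> 0 < Re (dual a).
Proof.
by move=> a0; rewrite /dual Re_mulr_real mulr_gt0 ?Re_inv_gt0// exprn_gt0// pi_gt0.
Qed.

Lemma pi_neq0 : pi%:C != 0 :> R[i].
Proof. by rewrite -(rmorph0 (real_complex R)) (inj_eq (@complexI R)) gt_eqF// pi_gt0. Qed.

Lemma fcoefE a z (n : int) : 0 < Re a ->
  fcoef a z n = gauss a z * gauss (dual a) (n%:~R + - 'i * a * z / pi%:C).
Proof.
move=> a0; have an := a_neq0 a0; have pn := pi_neq0.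
rewrite /fcoef /gauss -ceD /dual rmorphXn /=; congr ce.
have := sqrCi R[i]; rewrite expr2; move: pn; move: (n%:~R : R[i]) (pi%:C) => k p pn i2.
rewrite [RHS](_ : _ = 2 * ('i * k * p * z) - (k * p) ^+ 2 / a - a * z ^+ 2 * ('i * 'i + 1)).
  by rewrite i2 addNr mulr0 subr0; ring.
by field; apply/andP.
Qed.

Lemma csmb_fcoef a z : 0 < Re a -> csmb (fcoef a z).
Proof.
move=> a0; apply: (eq_csmb (f := fun n => gauss a z * gauss (dual a) (n%:~R + - 'i * a * z / pi%:C))).
  by move=> n; rewrite fcoefE.
exact: (csmbZ _ (csmb_theta _ (dual_gt0 a0))).
Qed.

Lemma csum_fcoef a z : 0 < Re a ->
  csum (fcoef a z) = gauss a z * theta (dual a) (- 'i * a * z / pi%:C).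
Proof.
move=> a0; rewrite /theta -csumZ; last exact: (csmb_theta _ (dual_gt0 a0)).
by apply: eq_csum => n; rewrite fcoefE.
Qed.

(** Each coefficient is [fcoef] times a shifted Riemann sum, and the shift is negligible by
    [riemann_shift]. Tannery's theorem applies to the differences, because at this stage the Riemann
    sums are only known to be bounded. *)
Lemma theta_lim a z : 0 < Re a ->
  ctends (fun N => riemann a N 0 * csum (fcoef a z)) (theta a z).
Proof.
move=> a0; have sf := csmb_fcoef z a0.
pose M (N : nat) : nat := (N.+1 %/ 2)%N.
have hM N : (2 * M N <= N.+1)%N /\ (N <= 2 * M N)%N by rewrite /M; lia.
pose inr N (n : int) := (- (M N)%:Z <= n) && (n < N.+1%:Z - (M N)%:Z).
pose F N n := if inr N n then dft a z N n else 0.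
have eF N : csum (F N) = theta a z.
  pose s := [seq (k : nat)%:Z - (M N)%:Z | k <- iota 0 N.+1].
  rewrite (@csum_fin _ _ s).
  - rewrite /theta (theta_dft a0 z N) big_map -(big_mkord xpredT (fun k => dft a z N (k%:Z - (N.+1 %/ 2)%N%:Z))) /index_iota subn0.
    rewrite !big_seq; apply: eq_bigr => k; rewrite mem_iota => /andP[_ kN].
    by rewrite /F (_ : inr _ _)// /inr; lia.
  - by rewrite map_inj_uniq ?iota_uniq// => x y; lia.
  move=> n; rewrite /F; case: ifP => // /andP[h1 h2] /mapP[]; exists (absz ((n : int) + (M N)%:Z)).
    by rewrite mem_iota; lia.
  by lia.
have [K K0 hK] := dft_bound a0 z; have [B B0 hB] := riemann_bound a0 0.
have bF N n : nrm (F N n) <= K * (1 + (`|n|%N)%:R ^+ 2)^-1.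
  rewrite /F; case: ifP => [/andP[h1 h2]|_].
    by apply: hK; have := hM N; lia.
  by rewrite nrm0 mulr_ge0 ?invr_ge0 ?addr_ge0 ?sqr_ge0.
have sg : summ (fun n : int => K * (1 + (`|n|%N)%:R ^+ 2)^-1 + B * nrm (fcoef a z n)).
  have p0 (n : int) : 0 <= (1 + (`|n|%N)%:R ^+ 2 : R)^-1 by rewrite invr_ge0 addr_ge0 ?sqr_ge0.
  apply: summD => [n|n||]; rewrite ?mulr_ge0 ?nrm_ge0//.
    exact: (summZ K0 p0 (summ_inv_sq R)).
  by apply: (summZ B0 _ sf) => n; exact: nrm_ge0.
have h := @tannery R _ (fun N n => F N n - riemann a N 0 * fcoef a z n) (fun=> 0) _ sg.
have {}h : ctends (fun N => theta a z - riemann a N 0 * csum (fcoef a z)) 0.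
  rewrite csum0 in h; apply: (eq_ctends _ (h _ _)).
  - move=> N; rewrite csumB ?csumZ ?eF//; last exact: csmbZ.
    apply: (csmb_le _ (bF N)); apply: (summZ K0 _ (summ_inv_sq R)) => n.
    by rewrite invr_ge0 addr_ge0 ?sqr_ge0.
  - move=> N n; apply: (le_trans (nrmB_triangle _ _)); rewrite lerD// nrmM.
    by rewrite ler_wpM2r ?nrm_ge0.
  move=> n; pose y := z + n%:~R * (pi%:C * 'i) / a.
  have Y1 : 1 <= nrm y + 1 by rewrite lerDr nrm_ge0.
  have [C C0 hC] := riemann_shift a0 Y1.
  (* From this index on, [n] belongs to the range of frequencies. *)
  apply: (@ctends_shift _ _ _ (2 * `|n| + 2)%N).
  apply: (@ctends_of_inv _ _ _ (nrm (fcoef a z n) * C)) => N; set N' := (N + _)%N.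
  rewrite subr0 /F (_ : inr N' n); last by rewrite /inr; have := hM N'; lia.
  rewrite (dft_shift a0) -/y (mulrC (riemann a N' 0)) -mulrBr nrmM -mulrA ler_wpM2l ?nrm_ge0//.
  apply: (le_trans (hC N' y _)); first by rewrite lerDl.
  by rewrite ler_wpM2l// lef_pV2 ?posrE ?ltr0n// ler_nat /N'; lia.
have := ctendsB (ctends_cst (theta a z)) h; rewrite subr0; apply: eq_ctends => N.
by rewrite opprB addrC subrK.
Qed.

(** At this point the theta series is, up to an exponential, the sum of (-1)^r p^(3 r^2 + r) with p
    = exp(- a / 3), hence a nonvanishing infinite product. *)
Lemma theta_pentagonal a : 0 < Re a ->
  theta a (1 / 6 + pi%:C * 'i / (2 * a)) != 0.
Proof.
move=> a0; have an := a_neq0 a0.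
pose p := ce (- a / 3); have p0 : p != 0 by exact: ce_neq0.
have p1 : nrm p < 1.
  rewrite nrm_ce expR_lt1 (_ : - a / 3 = (- 3^-1)%:C * a); last first.
    by rewrite rmorphN fmorphV rmorph_nat mulNr [RHS]mulNr [_^-1 * a]mulrC.
  by rewrite Re_mulr_real nmulr_rlt0 ?oppr_lt0 ?invr_gt0.
set z := 1 / 6 + _.
have e : csum (fun r : int => (-1) ^ r * p ^ (3 * (r * r) + r)) = (gauss a z)^-1 * theta a z.
  rewrite /theta -csumZ; last exact: csmb_theta.
  apply: eq_csum => r; rewrite (_ : (-1) ^ r = ce (r%:~R * - (pi%:C * 'i))); last first.
    by rewrite ceXz ceN ce_pi invrN1.
  rewrite /p -ceXz /gauss -ceN -!ceD; congr ce; rewrite /z intrD !intrM /=.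
  by move: (r%:~R) (pi%:C) => x y; field.
rewrite -(pentagonal p0 p1) in e; apply/eqP => z0; move: e; rewrite z0 mulr0 => /eqP.
apply/negP; apply: qqinf_neq0; first exact: expf_neq0.
exact: nrm_expr_lt1.
Qed.

(* [gint a] is the integral of exp(- a x^2) over the real line, as a limit of
   Riemann sums; no branch of the square root of pi / a has to be chosen. *)
Fact gint_spec : {g : R[i] -> R[i] | forall a, 0 < Re a -> ctends (fun N => riemann a N 0) (g a)}.
Proof.
(* [w] is chosen so that the dual argument - i a w / pi is the point of [theta_pentagonal] for
   [dual a]; there [theta_lim] can be divided by the dual theta value. *)
exists (fun a => let z := 1 / 6 + pi%:C * 'i / (2 * dual a) in
  let w := 'i * pi%:C * z / a in
  theta a w / (gauss a w * theta (dual a) z)) => a a0.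
have an := a_neq0 a0; have pn := pi_neq0; rewrite /=.
set z := 1 / 6 + _; set w := 'i * pi%:C * z / a.
have tz : theta (dual a) z != 0 := theta_pentagonal (dual_gt0 a0).
have e : csum (fcoef a w) = gauss a w * theta (dual a) z.
  rewrite csum_fcoef//; congr (_ * theta _ _); rewrite /w.
  rewrite (_ : - 'i * a * ('i * pi%:C * z / a) / pi%:C = - 'i ^+ 2 * z).
    by rewrite sqrCi opprK mul1r.
  by move: pn; move: (z) (pi%:C) => x y yn; field; apply/andP.
have k0 : gauss a w * theta (dual a) z != 0 by rewrite mulf_neq0// ce_neq0.
have := ctendsZ (gauss a w * theta (dual a) z)^-1 (theta_lim w a0).
rewrite e [_^-1 * theta a w]mulrC; apply: eq_ctends => N.
by rewrite mulrC mulfK.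
Qed.

Definition gint : R[i] -> R[i] := sval gint_spec.
Lemma gint_lim a : 0 < Re a -> ctends (fun N => riemann a N 0) (gint a).
Proof. exact: (svalP gint_spec). Qed.

Lemma theta_dual a z : 0 < Re a ->
  theta a z = gint a * (gauss a z * theta (dual a) (- 'i * a * z / pi%:C)).
Proof.
move=> a0; rewrite -csum_fcoef//; apply: (ctends_uniq (theta_lim z a0)).
rewrite (mulrC (gint a)); apply: (eq_ctends _ (ctendsZ _ (gint_lim a0))) => N.
exact: mulrC.
Qed.

(** By inversion [gint a] is a factor of the nonzero value in [theta_pentagonal]. *)
Lemma gint_neq0 a : 0 < Re a -> gint a != 0.
Proof.
by move=> a0; have := theta_pentagonal a0; rewrite theta_dual// mulf_eq0 negb_or => /andP[].
Qed.

(** Refining the grid (k + 1)-fold and multiplying [a] by (k + 1)^2 leaves the sampled values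
    unchanged, so scaling is exact before any limit. *)
Lemma riemann_scale a (k N n : nat) : n.+1 = (k.+1 * N.+1)%N ->
  riemann (k.+1%:R ^+ 2 * a) n 0 = k.+1%:R^-1 * riemann a N 0.
Proof.
move=> en; rewrite /riemann /mesh en natrM invfM rmorphM /= -mulrA fmorphV rmorph_nat.
congr (_ * (_ * _)); apply: eq_csum => m; rewrite /gauss; congr ce.
rewrite !addr0 /grid en natrM invfM !rmorphM /= !fmorphV !rmorph_nat.
have k0 : k.+1%:R != 0 :> R[i] by rewrite pnatr_eq0.
have n0 : N.+1%:R != 0 :> R[i] by rewrite pnatr_eq0.
rewrite rmorph_int; move: k0 n0; move: (k.+1%:R) (N.+1%:R) (m%:~R) => x y t x0 y0.
by field; apply/andP.
Qed.

Lemma gint_scale_sq a (k : nat) : 0 < Re a -> gint (k.+1%:R ^+ 2 * a) = k.+1%:R^-1 * gint a.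
Proof.
move=> a0; have k0 : 0 < Re (k.+1%:R ^+ 2 * a).
  by rewrite -(rmorph_nat (real_complex R)) -rmorphXn /= Re_mulr_real mulr_gt0// exprn_gt0.
(* N + k (N + 1) is (k + 1)(N + 1) - 1, since the grid of index N has N + 1 points per unit. *)
apply: (ctends_uniq (u := fun N => riemann (k.+1%:R ^+ 2 * a) (N + k * N.+1)%N 0)).
  apply: (ctends_comp (k := fun N => (N + k * N.+1)%N)) (gint_lim k0) => N; nia.
by apply: (eq_ctends _ (ctendsZ _ (gint_lim a0))) => N; rewrite (@riemann_scale _ k N).
Qed.

Lemma nrm_gauss_real a (x : R) : nrm (gauss a x%:C) = expR (- Re a * x ^+ 2).
Proof.
rewrite nrm_ce (_ : - a * x%:C ^+ 2 = (- x ^+ 2)%:C * a); last first.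
  by rewrite rmorphN rmorphXn /=; ring.
by rewrite Re_mulr_real; congr expR; ring.
Qed.

(** Continuity in a real multiple of [a], which carries the scaling law from rational to real
    factors. *)
Lemma gint_lipschitz a : 0 < Re a -> exists2 D, 0 < D & exists2 C, 0 <= C &
  forall mu : R, `|mu - 1| <= D -> nrm (gint (mu%:C * a) - gint a) <= C * `|mu - 1|.
Proof.
move=> a0; set b := Re a in a0; have an := a_neq0 a0; have na : 0 < nrm a by exact: nrm_gt0.
have b2 : 0 < b / 2 by rewrite divr_gt0.
have [L hL] := quad_le 0 0 b2.
(* The first bound keeps |mu - 1| |a| x^2 below b x^2 / 4, so that two factors exp(b x^2 / 4) still
   leave a decay exp(- b x^2 / 2); the second keeps mu positive. *)
pose D := Num.min (b / (4 * nrm a)) (1 / 2).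
exists D; first by rewrite lt_min !divr_gt0// mulr_gt0.
(* 12 = 3 * 4: the 3 is from [nrm_ce_taylor1], the 4 from x^2 <= (4 / b) exp(b x^2 / 4). *)
pose K := 12 * nrm a / b * expR L.
have K0 : 0 <= K by rewrite mulr_ge0 ?expR_ge0// divr_ge0 ?ltW// mulr_gt0.
exists (8 * K) => [|mu]; first by rewrite mulr_ge0.
rewrite le_min => /andP[hmu hmu2]; set e := `|mu - 1|; have e0 : 0 <= e by exact: normr_ge0.
have muR : 0 < Re (mu%:C * a).
  rewrite Re_mulr_real mulr_gt0//; move: hmu2; rewrite ler_norml; lra.
apply: (ctends_le (ctendsB (gint_lim muR) (gint_lim a0))) => N.
have s1 := csmb_gauss muR N 0; have s2 := csmb_gauss a0 N 0.
rewrite /riemann -mulrBr -csumB// nrmM nrm_h mulrC -ler_pdivlMr ?mesh_gt0// invrK.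
rewrite -[8 * K * e]mulrA; apply: grid_csum_le => [|m]; first by rewrite mulr_ge0.
rewrite addr0; set x := grid R N m; set z := x%:C.
have -> : gauss (mu%:C * a) z - gauss a z = gauss a z * (ce (- ((mu - 1) * x ^+ 2)%:C * a) - 1).
  rewrite (_ : ((mu - 1) * x ^+ 2)%:C = (mu%:C - 1) * z ^+ 2).
    by rewrite mulrBr mulr1 -ceD; congr (ce _ - _); move: (z) => t; ring.
  by rewrite rmorphM /= rmorphB /= rmorphXn rmorph1.
rewrite nrmM nrm_gauss_real -/b.
have h1 := nrm_ce_taylor1 (- ((mu - 1) * x ^+ 2)%:C * a).
rewrite nrmM nrmN nrm_real normrM -/e (ger0_norm (sqr_ge0 x)) in h1.
have x20 : 0 <= x ^+ 2 by exact: sqr_ge0.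
have h2 : e * x ^+ 2 * nrm a <= b / 4 * x ^+ 2.
  rewrite mulrAC ler_wpM2r//; move: hmu; rewrite ler_pdivlMr ?mulr_gt0// -/e; lra.
have h3 : nrm (ce (- ((mu - 1) * x ^+ 2)%:C * a) - 1) <= 3 * (e * x ^+ 2 * nrm a) * expR (b / 4 * x ^+ 2).
  apply: (le_trans h1); apply: ler_wpM2l; last by rewrite ler_expR.
  by rewrite mulr_ge0// mulr_ge0 ?nrm_ge0// mulr_ge0.
apply: (le_trans (ler_wpM2l (expR_ge0 _) h3)).
have h4 : b / 4 * x ^+ 2 <= expR (b / 4 * x ^+ 2) by have := expR_ge1Dx (b / 4 * x ^+ 2); lra.
have h5 : e * x ^+ 2 * nrm a <= e * nrm a * (4 / b) * expR (b / 4 * x ^+ 2).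
  rewrite (_ : e * x ^+ 2 * nrm a = e * nrm a * (4 / b) * (b / 4 * x ^+ 2)); last by field; rewrite gt_eqF.
  apply: ler_wpM2l h4; apply: mulr_ge0; first by rewrite mulr_ge0 ?nrm_ge0.
  by rewrite divr_ge0// ltW.
have h6 : expR (- b * x ^+ 2) * expR (b / 4 * x ^+ 2) * expR (b / 4 * x ^+ 2) <= expR L * expR (- `|x|).
  rewrite -!expRD ler_expR; have := hL `|x|; rewrite real_normK ?num_real//; lra.
have h7 : 3 * (e * x ^+ 2 * nrm a) * expR (b / 4 * x ^+ 2) <= 3 * (e * nrm a * (4 / b) * expR (b / 4 * x ^+ 2)) * expR (b / 4 * x ^+ 2).
  by rewrite ler_wpM2r ?expR_ge0// ler_wpM2l.
apply: (le_trans (ler_wpM2l (expR_ge0 _) h7)).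
rewrite (_ : K * e * expR (- `|x|) = 12 * nrm a / b * e * (expR L * expR (- `|x|))); last by rewrite /K; ring.
rewrite [leLHS](_ : _ = 12 * nrm a / b * e * (expR (- b * x ^+ 2) * expR (b / 4 * x ^+ 2) * expR (b / 4 * x ^+ 2))).
  apply: ler_wpM2l h6; rewrite mulr_ge0// divr_ge0 ?(ltW a0)//.
  by rewrite mulr_ge0 ?nrm_ge0.
by field; rewrite gt_eqF.
Qed.

(** For the rationals [r n], which tend to [s] from above, the law follows from two integer
    scalings; [gint_lipschitz] gives the limit. *)
Lemma gint_scale a (s : R) : 0 < Re a -> 0 < s -> gint ((s ^+ 2)%:C * a) = s^-1%:C * gint a.
Proof.
move=> a0 s0; have s20 : 0 < s ^+ 2 by rewrite exprn_gt0.
have b0 : 0 < Re ((s ^+ 2)%:C * a) by rewrite Re_mulr_real mulr_gt0.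
have [D D0 [C C0 hC]] := gint_lipschitz b0.
pose k n := Num.truncn (n.+1%:R * s).
pose r n : R := (k n).+1%:R / n.+1%:R.
have n0 n : 0 < n.+1%:R :> R by rewrite ltr0n.
have er n : r n = (k n).+1%:R / n.+1%:R by [].
have hr n : s <= r n <= s + n.+1%:R^-1.
  have := @truncn_itv _ (n.+1%:R * s); rewrite mulr_ge0 ?(ltW s0) ?ler0n// => /(_ isT) /andP[h1 h2].
  rewrite /r ler_pdivlMr// ler_pdivrMr// mulrDl mulVf ?gt_eqF// ![s * _]mulrC (ltW h2) /=.
  by rewrite -[(_).+1]addn1 natrD lerD2r.
have rs n : gint ((r n ^+ 2)%:C * a) = (r n)^-1%:C * gint a.
  have r0 : 0 < Re ((r n ^+ 2)%:C * a).
    by rewrite Re_mulr_real mulr_gt0// exprn_gt0// divr_gt0// ltr0n.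
  have := gint_scale_sq n r0; rewrite (_ : n.+1%:R ^+ 2 * _ = (k n).+1%:R ^+ 2 * a).
    rewrite (gint_scale_sq (k n) a0) => e; apply: (mulfI (x := n.+1%:R^-1)).
      by rewrite invr_eq0 pnatr_eq0.
    rewrite -e (mulrA _ _ (gint a)); congr (_ * gint a); rewrite er invf_div rmorphM fmorphV !rmorph_nat.
    by rewrite mulrA mulVf ?mul1r// pnatr_eq0.
  rewrite er rmorphXn rmorphM fmorphV !rmorph_nat; have : n.+1%:R != 0 :> R[i] by rewrite pnatr_eq0.
  by move: (n.+1%:R) ((k n).+1%:R) => x y x0; field.
pose u n := gint ((r n ^+ 2)%:C * a).
pose B := (2 * s + 1) / s ^+ 2.
have B0 : 0 <= B by rewrite divr_ge0 ?ltW// addr_gt0// mulr_gt0.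
have hmu n : `|r n ^+ 2 / s ^+ 2 - 1| <= B / n.+1%:R.
  have /andP[r1 r2] := hr n; have nle : n.+1%:R^-1 <= 1 :> R by rewrite invf_le1 ?ler1n.
  have i0 : 0 < n.+1%:R^-1 :> R by rewrite invr_gt0.
  rewrite (_ : r n ^+ 2 / s ^+ 2 - 1 = (r n ^+ 2 - s ^+ 2) / s ^+ 2); last by field; rewrite gt_eqF.
  rewrite /B mulrAC normrM normfV (gtr0_norm s20) ler_pM2r ?invr_gt0//.
  rewrite ger0_norm ?subr_ge0; last by rewrite lerXn2r ?nnegrE ?(ltW s0)// (le_trans (ltW s0)).
  rewrite subr_sqr [leRHS]mulrC; move: r1 r2 nle i0; move: (r n) (n.+1%:R^-1) => x t *.
  by apply: ler_pM; lra.
have u1 : ctends u (gint ((s ^+ 2)%:C * a)).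
  pose n0' := Num.bound (B / D); apply: (@ctends_shift _ _ _ n0').
  apply: (@ctends_of_inv _ _ _ (C * B)) => n; set n' := (n + n0')%N.
  have le1 : n'.+1%:R^-1 <= n.+1%:R^-1 :> R by rewrite lef_pV2 ?posrE// ler_nat ltnS leq_addr.
  have := hC (r n' ^+ 2 / s ^+ 2); rewrite (_ : (r n' ^+ 2 / s ^+ 2)%:C * ((s ^+ 2)%:C * a) = (r n' ^+ 2)%:C * a); last first.
    by rewrite mulrA -rmorphM /= divfK ?gt_eqF.
  move=> h; have hb := hmu n'; apply: (le_trans (h _)).
    apply: (le_trans hb); rewrite ler_pdivrMr// mulrC -ler_pdivrMr//.
    have := archi_boundP (divr_ge0 B0 (ltW D0)); rewrite -/n0' => /ltW lt; apply: (le_trans lt).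
    by rewrite ler_nat leqW// leq_addl.
  rewrite -(mulrA C B); apply: (ler_wpM2l C0); apply: (le_trans hb); exact: (ler_wpM2l B0).
have u2 : ctends u (s^-1%:C * gint a).
  apply: (@ctends_of_inv _ _ _ (s^-1 ^+ 2 * nrm (gint a))) => n.
  have /andP[r1 r2] := hr n; rewrite /u rs -mulrBl nrmM mulrAC ler_wpM2r ?nrm_ge0//.
  have r0 : 0 < r n by exact: lt_le_trans r1.
  rewrite -rmorphB /= nrm_real distrC ger0_norm; last by rewrite subr_ge0 lef_pV2 ?posrE.
  rewrite (_ : s^-1 - (r n)^-1 = (r n - s) * (s^-1 * (r n)^-1)); last by field; rewrite !gt_eqF.
  rewrite [leLHS]mulrC; apply: ler_pM.
  - by apply: mulr_ge0; rewrite invr_ge0 ltW.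
  - by rewrite subr_ge0.
  - rewrite expr2; apply: ler_wpM2l; first by rewrite invr_ge0 ltW.
    by rewrite lef_pV2 ?posrE.
  by rewrite lerBlDl.
exact: ctends_uniq u1 u2.
Qed.

End Theta.

(** * Alternating theta functions at rational points *)

Section AlternatingTheta.
Variable R : realType.
Implicit Types a x z : R[i].
Local Notation sg n := ((-1 : R[i]) ^ n).

Definition ath a x : R[i] := csum (fun r : int => sg r * gauss a (r%:~R + x)).

Lemma csmb_ath a x : 0 < Re a -> csmb (fun r : int => sg r * gauss a (r%:~R + x)).
Proof.
move=> a0; apply: (csmb_le (csmb_theta x a0)) => r.
by rewrite nrmM nrm_sg mul1r.
Qed.

Lemma sg_ce (r : int) : sg r = ce (r%:~R * (pi%:C * 'i)).
Proof. by rewrite ceXz ce_pi. Qed.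

Lemma gaussN a z : gauss a (- z) = gauss a z.
Proof. by rewrite /gauss sqrrN. Qed.

Lemma ath_refl a x : ath a (1 - x) = - ath a x.
Proof.
rewrite /ath (csum_refl (-1)) -csumN; apply: eq_csum => r.
rewrite sg_refl mulNr -[in LHS]gaussN; congr (- (_ * gauss a _)).
by rewrite intrB; ring.
Qed.

Lemma half_integer_shift (K : numFieldType) (a p n x i : K) : a != 0 -> i * i = -1 ->
  n * (p * i) + - a * (n + x) ^+ 2 =
  - i * p * x - p ^+ 2 / (4 * a) + - a * (n + (x - p * i / (2 * a))) ^+ 2.
Proof.
move=> a0 i2.
rewrite (_ : - a * (n + (x - p * i / (2 * a))) ^+ 2 =
  - a * (n + x) ^+ 2 + p * i * (n + x) - i * i * (p ^+ 2 / (4 * a))); last by field.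
by rewrite i2; ring.
Qed.

Lemma half_integer_square (K : numFieldType) (a p n x i : K) : a != 0 -> p != 0 -> i * i = -1 ->
  - i * p * x - p ^+ 2 / (4 * a) + - a * (x - p * i / (2 * a)) ^+ 2
   + - (p ^+ 2 / a) * (n + 1 + - i * a * (x - p * i / (2 * a)) / p) ^+ 2 =
  2 * (p * i) * x * (n + 1 / 2) + - (p ^+ 2 / a) * (n + 1 / 2) ^+ 2.
Proof.
move=> a0 p0 i2.
rewrite (_ : n + 1 + - i * a * (x - p * i / (2 * a)) / p = (n + 1 / 2) - i * a * x / p + (i * i + 1) / 2); last first.
  by field; do ?[apply/andP; split].
rewrite i2 addNr mul0r addr0; move: (n + 1 / 2) => u.
rewrite (_ : - a * (x - p * i / (2 * a)) ^+ 2 = - a * x ^+ 2 + p * i * x - i * i * (p ^+ 2 / (4 * a))); last first.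
  by field; do ?[apply/andP; split].
rewrite (_ : - (p ^+ 2 / a) * (u - i * a * x / p) ^+ 2 = - (p ^+ 2 / a) * u ^+ 2 + 2 * (p * i) * x * u - i * i * (a * x ^+ 2)); last first.
  by field; do ?[apply/andP; split].
by rewrite i2; ring.
Qed.

(** The sign (-1)^r amounts to a shift by - pi i / (2 a), which inversion turns into a shift by -
    1/2; moving the index by 1 makes it + 1/2. *)
Lemma ath_dual a x : 0 < Re a -> ath a x = gint a *
  csum (fun k : int => ce (2 * (pi%:C * 'i) * x * (k%:~R + 1 / 2)) * gauss (dual a) (k%:~R + 1 / 2)).
Proof.
move=> a0; have an := a_neq0 a0; have pn := pi_neq0 R.
pose z := x - pi%:C * 'i / (2 * a).
pose K := ce (- 'i * pi%:C * x - pi%:C ^+ 2 / (4 * a)).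
have i2 : 'i * 'i = -1 :> R[i] by rewrite -expr2 sqrCi.
have -> : ath a x = K * theta a z.
  rewrite /theta -csumZ; last exact: csmb_theta.
  apply: eq_csum => r; rewrite sg_ce /gauss /K -!ceD /z; congr ce.
  exact: half_integer_shift.
rewrite theta_dual// mulrCA; congr (_ * _); rewrite (mulrA K) /theta (csum_shift 1) -csumZ; last first.
  apply: (csmb_shift 1 (f := fun n : int => gauss (dual a) (n%:~R + - 'i * a * z / pi%:C))).
  exact: (csmb_theta _ (dual_gt0 a0)).
apply: eq_csum => n; rewrite /gauss /K -!ceD; congr ce; rewrite /dual rmorphXn /= intrD.
rewrite /z.
exact: half_integer_square.
Qed.

Definition rcos (t : R) : R[i] := (cos t)%:C.

Lemma rcos_ce (t : R) : rcos t = (ce (t%:C * 'i) + ce (- (t%:C * 'i))) / 2.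
Proof.
have r s : Re (s%:C * 'i : R[i]) = 0 by rewrite Re_mul /= mulr0 mul0r subr0.
have i s : Im (s%:C * 'i : R[i]) = s by rewrite Im_mul /=; ring.
rewrite -mulNr -rmorphN !ce_ReIm !r !i expR0 !mul1r cosN sinN.
apply/eqP; rewrite eq_sym; apply/eqP; apply: (canLR (mulfK _)); first by rewrite pnatr_eq0.
rewrite /rcos (_ : 2 = 2%:C); last by rewrite rmorph_nat.
by apply/eqP; rewrite eq_complex /=; apply/andP; split; apply/eqP; ring.
Qed.

Definition odds (M : nat) : seq nat := [seq j.*2.+1 | j <- iota 0 M].

Lemma sum_odds (M : nat) (f : nat -> R[i]) : \sum_(y <- odds M) f y = \sum_(j < M) f (nat_of_ord j).*2.+1.
Proof. by rewrite big_map -(big_mkord xpredT (fun j => f j.*2.+1)) /index_iota subn0. Qed.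

(** For k = M r + j one has k + 1/2 = M (r + (2 j + 1) / (2 M)). As D is odd, the exponential
    contributes exp(pi i D r) = (-1)^r, so the folded series alternate again. *)
Lemma ath_fold a (M : nat) (D : nat) : 0 < Re a -> (0 < M)%N -> odd D ->
  ath a (D%:R / (2 * M)%:R) = gint a * \sum_(y <- odds M)
    ce ((pi * (D * y)%:R / (2 * M)%:R)%:C * 'i) * ath (M%:R ^+ 2 * dual a) (y%:R / (2 * M)%:R).
Proof.
move=> a0 M0 oD; rewrite ath_dual//; congr (_ * _).
have Mn : M%:R != 0 :> R[i] by rewrite pnatr_eq0 -lt0n.
have d0 := dual_gt0 a0.
have Md : 0 < Re (M%:R ^+ 2 * dual a).
  by rewrite -(rmorph_nat (real_complex R)) -rmorphXn /= Re_mulr_real mulr_gt0// exprn_gt0// ltr0n.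
set x := D%:R / _; set f := fun k : int => _.
have sf : csmb f.
  apply: (csmb_mul_bounded (K := 1)) (csmb_theta (1 / 2) d0) => k.
  rewrite nrm_ce (_ : 2 * _ * x * _ = (pi * (D%:R / M%:R) * (k%:~R + 1 / 2))%:C * 'i); last first.
    rewrite /x natrM; move: (@pi R) => p.
    rewrite !(rmorphM, fmorphV, rmorphD, rmorph_nat, rmorph1, rmorph_int) /=.
    by move: (p%:C) (k%:~R) Mn => q n Mn; field.
  by rewrite Re_mul /= mulr0 mul0r subr0 expR0.
rewrite (csum_fold M0 sf) sum_odds; apply: eq_bigr => j _; set y := (nat_of_ord j).*2.+1.
rewrite /ath -csumZ; last exact: (csmb_ath _ Md).
apply: eq_csum => r; rewrite /f.
have ey : (y%:R : R[i]) = 2 * (j : nat)%:R + 1 by rewrite /y -addn1 -mul2n natrD natrM.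
have es : sg r = ce (r%:~R * D%:R * (pi%:C * 'i)).
  rewrite -mulrA ceXz ceX ce_pi -signr_odd oD expr1; by [].
rewrite es [in RHS]mulrA /gauss -!ceD; congr ce.
rewrite /x !natrM; move: (@pi R) => p.
rewrite !(rmorphM, fmorphV, rmorph_nat) intrD intrM -!pmulrn ey /=.
by move: (p%:C) (r%:~R) (dual a) Mn => q n da Mn; field.
Qed.

(** Under y -> 2 M - y the theta value changes sign, and the exponential is inverted and changes
    sign as well since D is odd. Averaging both forms leaves cosines. *)
Lemma ath_cos a (M : nat) (D : nat) : 0 < Re a -> (0 < M)%N -> odd D ->
  ath a (D%:R / (2 * M)%:R) = gint a * \sum_(y <- odds M)
    rcos (pi * (D * y)%:R / (2 * M)%:R) * ath (M%:R ^+ 2 * dual a) (y%:R / (2 * M)%:R).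
Proof.
move=> a0 M0 oD; have e := ath_fold a0 M0 oD.
have Mn : M%:R != 0 :> R[i] by rewrite pnatr_eq0 -lt0n.
set A := _ * dual a in e *; set h := fun y : nat => ath A (y%:R / (2 * M)%:R).
have e' : ath a (D%:R / (2 * M)%:R) = gint a * \sum_(y <- odds M)
    ce (- ((pi * (D * y)%:R / (2 * M)%:R)%:C * 'i)) * h y.
  rewrite e; congr (_ * _); rewrite !sum_odds (reindex_inj rev_ord_inj) /=; apply: eq_bigr => j _.
  set y := (nat_of_ord j).*2.+1; set y' := _.*2.+1.
  have ey : y' = (2 * M - y)%N by rewrite /y' /y; have := ltn_ord j; lia.
  have yM : (y <= 2 * M)%N by rewrite /y; have := ltn_ord j; lia.
  have -> : ath A (y'%:R / (2 * M)%:R) = - h y.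
    rewrite /h -ath_refl; congr (ath A _); rewrite ey natrB// mulrBl divff//.
    by rewrite natrM mulf_neq0// pnatr_eq0.
  have -> : ce ((pi * (D * y')%:R / (2 * M)%:R)%:C * 'i) = - ce (- ((pi * (D * y)%:R / (2 * M)%:R)%:C * 'i)) :> R[i].
    have e1 : ce (D%:R * (pi%:C * 'i)) = -1 :> R[i] by rewrite ceX ce_pi -signr_odd oD expr1.
    rewrite -mulN1r -e1 -ceD; congr ce; rewrite ey natrM natrB// natrM [(D * y)%:R]natrM; move: (@pi R) => p.
    rewrite !(rmorphM, fmorphV, rmorphB, rmorph_nat) /=.
    by move: (p%:C) Mn => q Mn; field.
  by rewrite mulrN mulNr opprK.
have two : 2 != 0 :> R[i] by rewrite pnatr_eq0.
apply: (mulIf two); rewrite mulr_natr mulr2n {1}e e' -mulrDr -big_split /= -(mulrA (gint a)); congr (_ * _).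
rewrite big_distrl /=; apply: eq_bigr => y _; rewrite rcos_ce -/(h y).
by move: (ce _) (ce _) (h y) => *; field.
Qed.

End AlternatingTheta.

(** * The matrix S *)

Section CosineTable.
Variable R : realType.
Local Notation alpha := (alpha R).

Definition c22 (n : nat) : R[i] := (Num.sqrt (2 / 11) * cos (pi * n%:R / 22))%:C.

Lemma c22_add n : c22 n.+4.+4.+4.+4.+4.+2 = - c22 n.
Proof.
rewrite /c22 -rmorphN -mulrN -cosDpi; congr ((_ * cos _)%:C).
by rewrite (_ : n.+4.+4.+4.+4.+4.+2 = (n + 22)%N) ?natrD; [field|lia].
Qed.

Lemma c22_alpha (n m : nat) : (n + 2 * m)%N = 11%N -> c22 n = alpha m.
Proof.
move=> e; rewrite /c22 /alpha -cosN -sinDpihalf; congr ((_ * sin _)%:C).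
have {e} : n%:R + 2 * m%:R = 11 :> R by rewrite -natrM -natrD e.
by move=> e; rewrite (_ : n%:R = 11 - 2 * m%:R); [field|rewrite -e addrK].
Qed.

Lemma c22_opp (n m : nat) : (n + m)%N = 22%N -> c22 n = - c22 m.
Proof.
move=> e; rewrite /c22 -rmorphN -mulrN -[in RHS](cosN (_ / _)) -cosDpi; congr ((_ * cos _)%:C).
have {e} : n%:R + m%:R = 22 :> R by rewrite -natrD e.
by move=> e; rewrite (_ : n%:R = 22 - m%:R); [field|rewrite -e addrK].
Qed.

(* Only the odd arguments are meaningful; the even entries are junk. *)
Fixpoint ctab (n : nat) : R[i] :=
  if n is m.+4.+4.+4.+4.+4.+2 then - ctab m else
  nth 0 [:: 0; alpha 5; 0; alpha 4; 0; alpha 3; 0; alpha 2; 0; alpha 1; 0; 0; 0;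
    - alpha 1; 0; - alpha 2; 0; - alpha 3; 0; - alpha 4; 0; - alpha 5] n.

(** The first 22 values are read off the table; beyond them adding 22 changes the sign. *)
Lemma c22_ctab n : odd n -> c22 n = ctab n.
Proof.
move: {2}n (leqnn n) => k; elim: k n => [|k IH] n; first by case: n.
do 22?[case: n => [|n]; first by rewrite /= => _ // _; first [
    exact: (@c22_alpha _ 5) | exact: (@c22_alpha _ 4) 
    | exact: (@c22_alpha _ 3) | exact: (@c22_alpha _ 2) | exact: (@c22_alpha _ 1) 
    | rewrite (@c22_alpha _ 0)// /alpha mul0r mul0r sin0 mulr0// 
    | rewrite (@c22_opp _ 9)// (@c22_alpha _ 1)// | rewrite (@c22_opp _ 7)// (@c22_alpha _ 2)// 
    | rewrite (@c22_opp _ 5)// (@c22_alpha _ 3)//| rewrite (@c22_opp _ 3)// (@c22_alpha _ 4)//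
    | rewrite (@c22_opp _ 1)// (@c22_alpha _ 5)//]].
move=> h; rewrite c22_add => on; rewrite /= IH//; first by lia.
by move: on; rewrite -[X in odd X]/(22 + n)%N oddD.
Qed.

End CosineTable.

(** * Theta vectors under inversion *)

Section ThetaMatrix.
Variable R : realType.
Local Notation alpha := (alpha R).
Local Notation ctab := (ctab R).
Local Notation c22 := (c22 R).
Implicit Types h : nat -> R[i].

(** The inverse of the normalisation in [alpha]; it is absorbed by scaling the Gaussian integral.
    Similarly [w2] is the square root of 2, in the form in which adding two cosines produces it. *)
Definition t11 : R := Num.sqrt (11 / 2).
Definition w2 : R := 2 * cos (pi / 4).
Local Notation t := (t11%:C).
Local Notation w := (w2%:C).

Lemma t11_gt0 : 0 < t11.
Proof. by rewrite sqrtr_gt0. Qed.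

Lemma t11_sqr : t11 ^+ 2 = 11 / 2.
Proof. by rewrite sqr_sqrtr. Qed.

Lemma rcos_c22 n : rcos (pi * n%:R / 22) = t * c22 n :> R[i].
Proof.
rewrite /c22 -rmorphM /rcos mulrA -sqrtrM// (_ : 11 / 2 * (2 / 11) = 1) ?sqrtr1 ?mul1r//.
by field.
Qed.

Lemma cos_pi4_gt0 : 0 < cos (pi / 4 : R).
Proof. by apply: cos_gt0_pihalf; have := pi_gt0 R; lra. Qed.

Lemma w2_gt0 : 0 < w2.
Proof. by rewrite mulr_gt0// cos_pi4_gt0. Qed.

Lemma sin_pi4 : sin (pi / 4) = cos (pi / 4) :> R.
Proof.
rewrite -[RHS]cosN -sinDpihalf; congr sin; by field.
Qed.

Lemma cos_pi4_sqr : 2 * cos (pi / 4 : R) ^+ 2 = 1.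
Proof. by have := cos2Dsin2 (pi / 4 : R); rewrite sin_pi4; lra. Qed.

Lemma w2_sqr : w2 ^+ 2 = 2.
Proof. by have := cos_pi4_sqr; rewrite /w2 exprMn; lra. Qed.

Lemma cos_add_natpi (x : R) (j : nat) : cos (x + j%:R * pi) = (-1) ^+ j * cos x.
Proof.
elim: j => [|j IH]; first by rewrite mul0r addr0 mul1r.
rewrite mulrS mulrDl mul1r addrCA addrC cosDpi IH exprS; ring.
Qed.

(* The index k = (d y +- 11) / 2 of the cosine of k pi / 22 to which two cosines of
   multiples of pi / 44 add up; 77 stands for - 11, as they agree mod 88. *)
Definition kidx (e : bool) (d y : nat) : nat :=
  if e == odd y./2 then (d * y + 11)./2 else (d * y + 77)./2.

(** As y is odd, the two angles differ by an odd multiple of pi/2, so the sum is cos A - sin A or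
    cos A + sin A, which is the square root of 2 times cos(A + pi/4) or cos(A - pi/4); and pi/4 is
    11 pi/44. *)
Lemma rcos_pair (e : bool) (d y : nat) : odd d -> odd y ->
  rcos (pi * (d * y)%:R / 44) + (-1) ^+ e * rcos (pi * ((d + 22) * y)%:R / 44) = w * t * c22 (kidx e d y) :> R[i].
Proof.
move=> od oy; rewrite -(mulrA w) -rcos_c22; set A := pi * (d * y)%:R / 44; pose j := y./2.
have ey : y = (j.*2.+1)%N by rewrite /j -[LHS]odd_double_half oy.
have e2 : pi * ((d + 22) * y)%:R / 44 = (A + pi / 2) + j%:R * pi.
  have ny : y%:R = 2 * j%:R + 1 :> R by rewrite {1}ey -addn1 -mul2n natrD natrM.
  by rewrite /A mulnDl natrD [(22 * y)%:R]natrM ny; field.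
have ody : odd (d * y) by rewrite oddM od.
have half n : odd n -> ((d * y + n)./2)%:R = ((d * y)%:R + n%:R) / 2 :> R.
  move=> on; have : ((d * y + n)./2.*2)%:R = (d * y + n)%:R :> R by rewrite halfK oddD ody on subn0.
  by rewrite -mul2n natrM natrD => <-; field.
rewrite e2 /rcos cos_add_natpi cosDpihalf.
rewrite -(rmorph_sign (real_complex R)) -!rmorphM -rmorphD /=; congr (_%:C).
have q := cos_pi4_sqr; rewrite /kidx -/j; case: eqP => ej; rewrite half//.
  rewrite (_ : pi * _ / 22 = A + pi / 4); last by rewrite /A; field.
  have s : (-1) ^+ e * (-1) ^+ j = 1 :> R by rewrite -[(-1) ^+ j]signr_odd -ej -expr2 sqrr_sign.
  rewrite cosD sin_pi4 /w2 (mulrA ((-1) ^+ e)) s mul1r.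
  rewrite (_ : 2 * cos (pi / 4) * _ = 2 * cos (pi / 4) ^+ 2 * (cos A - sin A)); last by ring.
  by rewrite q mul1r.
rewrite (_ : pi * _ / 22 = (A - pi / 4) + 2%:R * pi); last by rewrite /A; field.
have s : (-1) ^+ e * (-1) ^+ j = -1 :> R.
  by rewrite -[(-1) ^+ j]signr_odd; move/eqP: ej; case: e; case: (odd j) => //= _; rewrite ?expr0 ?expr1; ring.
rewrite cos_add_natpi sqrrN expr1n mul1r cosB sin_pi4 /w2 (mulrA ((-1) ^+ e)) s mulN1r opprK.
rewrite (_ : 2 * cos (pi / 4) * _ = 2 * cos (pi / 4) ^+ 2 * (cos A + sin A)); last by ring.
by rewrite q mul1r.
Qed.

(** The index lists contain closed numbers only, so they are computed outright while the theta
    values and the entries of S stay symbolic. *)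
Ltac expand_odds :=
  repeat match goal with |- context [map ?f (odds ?m)] =>
    let l := constr:(map f (odds m)) in let v := eval vm_compute in l in change l with v end;
  rewrite !big_cons big_nil.

Definition row22 h (d : nat) : R[i] := \sum_(z <- [seq ((d * y)%N, y) | y <- odds 11]) ctab z.1 * h z.2.

Lemma Smx_mul (x0 x1 x2 x3 x4 : R[i]) : Smx R *m (\col_(i < 5) [:: x0; x1; x2; x3; x4]`_i) =
  \col_(i < 5) [:: alpha 5 * x0 + alpha 4 * x1 + alpha 3 * x2 + alpha 2 * x3 + alpha 1 * x4;
    alpha 4 * x0 + alpha 1 * x1 - alpha 2 * x2 - alpha 5 * x3 - alpha 3 * x4;
    alpha 3 * x0 - alpha 2 * x1 - alpha 4 * x2 + alpha 1 * x3 + alpha 5 * x4;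
    alpha 2 * x0 - alpha 5 * x1 + alpha 1 * x2 + alpha 3 * x3 - alpha 4 * x4;
    alpha 1 * x0 - alpha 3 * x1 + alpha 5 * x2 - alpha 4 * x3 + alpha 2 * x4]`_i.
Proof.
apply/matrixP => i j; rewrite !mxE.
under eq_bigr => k _ do rewrite !mxE.
rewrite !big_ord_recl big_ord0 addr0 {j}.
by case: i => [[|[|[|[|[|//]]]]] hi] /=; ring.
Qed.

(** h(11) = 0, and y and 22 - y contribute equally: hence the factor 2 and five remaining
    unknowns. *)
Lemma row22_sum h : (forall y y', (y + y')%N = 22%N -> h y = - h y') ->
  \col_(i < 5) [:: row22 h 1; row22 h 3; row22 h 5; row22 h 7; row22 h 9]`_i =
  2 *: (Smx R *m (\col_(i < 5) [:: h 1; h 3; h 5; h 7; h 9]`_i)).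
Proof.
move=> hr; rewrite Smx_mul.
have h11 : h 11 = 0 by apply: self_opp_eq0; exact: hr.
have e : (h 13 = - h 9) * (h 15 = - h 7) * (h 17 = - h 5) * (h 19 = - h 3) * (h 21 = - h 1) by do !split; exact: hr.
apply/matrixP => i j; rewrite !mxE {j} /row22; expand_odds.
rewrite !e h11; case: i => [[|[|[|[|[|//]]]]] hi] /=; ring.
Qed.

(* [minus d] tells whether d = 1 mod 4, i.e. whether the sign (-1)^((d+1)/2) is -1. *)
Definition minus (d : nat) : bool := odd d.+1./2.

Definition row44 h (d : nat) : R[i] :=
  \sum_(z <- [seq (kidx (minus d) d y, y) | y <- odds 22]) ctab z.1 * h z.2.
Definition pair44 h (d : nat) : R[i] := h d + (-1) ^+ minus d * h (d + 22)%N.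

(** The terms at y and 44 - y agree. Among the odd y < 22 that remain, y = 11 has coefficient 0 and
    the other ten combine in pairs y, 22 - y, which are the five values [pair44]. *)
Lemma row44_sum h : (forall y y', (y + y')%N = 44%N -> h y = - h y') ->
  \col_(i < 5) [:: row44 h 1; - row44 h 3; - row44 h 5; row44 h 7; row44 h 9]`_i =
  2 *: (Smx R *m (\col_(i < 5) [:: pair44 h 9; pair44 h 5; pair44 h 1; pair44 h 3; pair44 h 7]`_i)).
Proof.
move=> hr; rewrite Smx_mul.
have h22 : h 22 = 0 by apply: self_opp_eq0; exact: hr.
have e : (h 23 = - h 21) * (h 25 = - h 19) * (h 27 = - h 17) * (h 29 = - h 15) * (h 31 = - h 13) *
  (h 33 = - h 11) * (h 35 = - h 9) * (h 37 = - h 7) * (h 39 = - h 5) * (h 41 = - h 3) * (h 43 = - h 1).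
  by do !split; exact: hr.
apply/matrixP => i j; rewrite !mxE {j} /row44; expand_odds.
rewrite /pair44 !e; case: i => [[|[|[|[|[|//]]]]] hi] /=; ring.
Qed.

Lemma row44_sum' h : (forall y y', (y + y')%N = 44%N -> h y = - h y') ->
  \col_(i < 5) [:: row44 h 9; row44 h 5; row44 h 1; row44 h 3; row44 h 7]`_i =
  2 *: (Smx R *m (\col_(i < 5) [:: pair44 h 1; - pair44 h 3; - pair44 h 5; pair44 h 7; pair44 h 9]`_i)).
Proof.
move=> hr; rewrite Smx_mul.
have e : (h 23 = - h 21) * (h 25 = - h 19) * (h 27 = - h 17) * (h 29 = - h 15) * (h 31 = - h 13) *
  (h 33 = - h 11) * (h 35 = - h 9) * (h 37 = - h 7) * (h 39 = - h 5) * (h 41 = - h 3) * (h 43 = - h 1).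
  by do !split; exact: hr.
apply/matrixP => i j; rewrite !mxE {j} /row44; expand_odds.
rewrite /pair44 !e; case: i => [[|[|[|[|[|//]]]]] hi] /=; ring.
Qed.

Lemma ath_reflM a (M : nat) (y y' : nat) : (0 < M)%N -> (y + y')%N = M ->
  ath a (y%:R / M%:R) = - ath a (y'%:R / M%:R) :> R[i].
Proof.
move=> M0 e; rewrite -ath_refl; congr (ath a _); rewrite -e natrD.
have : (y + y')%:R != 0 :> R[i] by rewrite pnatr_eq0 e -lt0n.
by rewrite natrD; move: (y%:R) (y'%:R) => x x' n0; field.
Qed.

Definition uu a : 'cV[R[i]]_5 :=
  let h (d : nat) := ath a (d%:R / 22) in \col_(i < 5) [:: h 1; h 3; h 5; h 7; h 9]`_i.

Lemma uu_dual a : 0 < Re a -> uu a = (2 * t * gint a) *: (Smx R *m uu (121 * dual a)).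
Proof.
move=> a0; pose h (y : nat) := ath (121 * dual a) (y%:R / 22).
have e d : odd d -> ath a (d%:R / 22) = t * gint a * row22 h d.
  move=> od; have := @ath_cos R a 11 d a0 isT od; rewrite (_ : 11%:R ^+ 2 = 121); last by rewrite -natrX.
  move=> ->; rewrite [t * _]mulrC -mulrA; congr (_ * _); rewrite /row22 big_map mulr_sumr.
  rewrite /odds !big_map; apply: eq_bigr => j _ /=.
  have oy : odd (d * j.*2.+1) by rewrite oddM od /= odd_double.
  by rewrite rcos_c22 (c22_ctab _ oy) -mulrA.
rewrite [2 * t]mulrC -mulrA [2 * _]mulrC mulrA -scalerA -(@row22_sum h); last first.
  by move=> y y' yy; exact: (@ath_reflM _ 22).
apply/matrixP => i j; rewrite !mxE {j}.
by case: i => [[|[|[|[|[|//]]]]] hi] /=; exact: e.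
Qed.

Definition pairth a (d : nat) : R[i] := pair44 (fun y => ath a (y%:R / 44)) d.
(** The signs are those of [2 F_sigma - F], which is F at - q^(1/2) for sigma = 0 and its negative
    for sigma = 1. In [sv] the order of the indices is the one in which the components of [Vstar]
    evaluate. *)
Definition su a : 'cV[R[i]]_5 :=
  \col_(i < 5) [:: pairth a 1; - pairth a 3; - pairth a 5; pairth a 7; pairth a 9]`_i.
Definition sv a : 'cV[R[i]]_5 :=
  \col_(i < 5) [:: pairth a 9; pairth a 5; pairth a 1; pairth a 3; pairth a 7]`_i.

Lemma pairth_dual a (d : nat) : 0 < Re a -> d \in [:: 1; 3; 5; 7; 9]%N ->
  pairth a d = w * t * gint a * row44 (fun y => ath (484 * dual a) (y%:R / 44)) d.
Proof.
move=> a0 hd; have od : odd d by move: hd; rewrite !inE => /orP[/eqP->|/orP[/eqP->|/orP[/eqP->|/orP[/eqP->|/eqP->]]]].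
have ok : all (fun y => odd (kidx (minus d) d y)) (odds 22).
  by move: hd; rewrite !inE => /orP[/eqP->|/orP[/eqP->|/orP[/eqP->|/orP[/eqP->|/eqP->]]]]; vm_compute.
have od' : odd (d + 22) by rewrite oddD od.
have e22 : 22%:R ^+ 2 = 484 :> R[i] by rewrite -natrX.
have := @ath_cos R a 22 d a0 isT od; have := @ath_cos R a 22 (d + 22) a0 isT od'.
rewrite e22 /pairth /pair44 => -> ->; rewrite (mulrCA ((-1) ^+ _) (gint a)) -mulrDr [w * t * _]mulrC -(mulrA (gint a)); congr (_ * _).
rewrite [X in _ + X]mulr_sumr -big_split /= /row44 [in RHS]big_map [RHS]mulr_sumr !big_seq.
apply: eq_bigr => y yo.
have /allP/(_ _ yo) ko := ok; have oy : odd y by move/mapP: yo => [j _ ->]; rewrite /= odd_double.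
have := rcos_pair (minus d) od oy; rewrite (c22_ctab R ko) => e.
by rewrite (mulrA ((-1) ^+ _)) -mulrDl e -mulrA.
Qed.

Lemma su_dual a : 0 < Re a -> su a = (2 * (w * t * gint a)) *: (Smx R *m sv (484 * dual a)).
Proof.
move=> a0; rewrite mulrC -scalerA -row44_sum; last by move=> y y' yy; exact: (@ath_reflM _ 44).
apply/matrixP => i j; rewrite !mxE {j}.
by case: i => [[|[|[|[|[|//]]]]] hi] /=; rewrite pairth_dual ?mulrN.
Qed.

Lemma sv_dual a : 0 < Re a -> sv a = (2 * (w * t * gint a)) *: (Smx R *m su (484 * dual a)).
Proof.
move=> a0; rewrite mulrC -scalerA -row44_sum'; last by move=> y y' yy; exact: (@ath_reflM _ 44).
apply/matrixP => i j; rewrite !mxE {j}.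
by case: i => [[|[|[|[|[|//]]]]] hi] /=; rewrite pairth_dual.
Qed.

End ThetaMatrix.

(** * Transformation of the prefactors and of the vectors *)

Section Eta.
Variable R : realType.
Implicit Types b x : R[i].
Local Notation w := ((w2 R)%:C).
Local Notation E x := (qinf x x).

(* For b = - pi i tau, so that exp(- 2 b) = q, [eta b] is the Dedekind function
   eta(tau), and [dual b] corresponds to - 1 / tau. *)
Definition eta b : R[i] := ath (3 * b) (1 / 6).

Lemma Re_mul_nat (n : nat) b : Re (n%:R * b) = n%:R * Re b.
Proof. by rewrite -(rmorph_nat (real_complex R)) Re_mulr_real. Qed.

Lemma nrm_ceN_lt1 b : 0 < Re b -> nrm (ce (- b)) < 1.
Proof. by move=> b0; rewrite nrm_ce expR_lt1; case: (b) b0 => x y /=; rewrite oppr_lt0. Qed.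

Lemma eta_qinf b : 0 < Re b -> eta b = ce (- b / 12) * E (ce (- b) ^+ 2).
Proof.
move=> b0; have p1 := nrm_ceN_lt1 b0; have p0 := ce_neq0 (- b).
have b30 : 0 < Re (3 * b) by rewrite Re_mul_nat mulr_gt0.
have e : csum (fun r : int => (-1) ^ r * ce (- b) ^ (3 * (r * r) + r)) = ce (b / 12) * eta b.
  rewrite /eta /ath -csumZ; last exact: csmb_ath.
  apply: eq_csum => r; rewrite (mulrCA (ce (b / 12))); congr (_ * _).
  rewrite -ceXz /gauss -ceD; congr ce; rewrite intrD !intrM /=.
  by move: (r%:~R) => x; field.
by rewrite (pentagonal p0 p1) e mulrA -ceD mulNr addNr ce0 mul1r.
Qed.

Lemma eta_neq0 b : 0 < Re b -> eta b != 0.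
Proof.
move=> b0; rewrite eta_qinf// mulf_neq0 ?ce_neq0// qqinf_neq0 ?expf_neq0 ?ce_neq0//.
by rewrite nrm_expr_lt1// nrm_ceN_lt1.
Qed.

Definition v3 : R := 2 * cos (pi / 6).

Lemma cos_pi6_gt0 : 0 < cos (pi / 6 : R).
Proof. by apply: cos_gt0_pihalf; have := pi_gt0 R; lra. Qed.

Lemma v3_gt0 : 0 < v3.
Proof. by rewrite mulr_gt0// cos_pi6_gt0. Qed.

(** cos(3 x) = cos x (4 cos^2 x - 3) vanishes at x = pi/6. *)
Lemma v3_sqr : v3 ^+ 2 = 3.
Proof.
have c0 := cos_pi6_gt0; have h := cos_pihalf R.
have e : cos (pi / 2 : R) = cos (pi / 6) * (4 * cos (pi / 6) ^+ 2 - 3).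
  rewrite (_ : pi / 2 = pi / 6 + (pi / 6 + pi / 6)); last by field.
  rewrite cosD sinD cosD; have := cos2Dsin2 (pi / 6 : R); move: (cos _) (sin _) => c s cs.
  rewrite (_ : c * _ - _ = c ^+ 3 - 3 * c * s ^+ 2); last by ring.
  by rewrite (_ : s ^+ 2 = 1 - c ^+ 2); [ring|rewrite -cs addrC addKr].
move: e; rewrite h => /esym/eqP; rewrite mulf_eq0 (gt_eqF c0) /= subr_eq0 => /eqP e.
by rewrite /v3 exprMn -e; ring.
Qed.

Local Notation v := (v3%:C).

(** The case M = 3, D = 1 of [ath_cos]: the term y = 3 vanishes and y = 5 repeats y = 1, so the
    coefficient is 2 cos(pi/6). *)
Lemma eta_dual b : 0 < Re b -> eta b = v * gint (3 * b) * eta (dual b).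
Proof.
move=> b0; have b30 : 0 < Re (3 * b) by rewrite Re_mul_nat mulr_gt0.
have bn := a_neq0 b0.
have := @ath_cos R (3 * b) 3 1 b30 isT isT.
rewrite (_ : 3%:R ^+ 2 * dual (3 * b) = 3 * dual b); last by rewrite /dual; field.
rewrite (_ : 1%:R / (2 * 3)%:R = 1 / 6)// -/(eta b) => ->.
rewrite -[v * _ * _]mulrA [v * _]mulrC -mulrA; congr (_ * _).
rewrite /odds /= !big_cons big_nil addr0.
pose h (y : nat) := ath (3 * dual b) (y%:R / 6).
have hr y y' : (y + y' = 6)%N -> h y = - h y' by move=> e; exact: (@ath_reflM R (3 * dual b) 6).
have h3 : h 3 = 0 by apply: self_opp_eq0; exact: hr.
have h5 : h 5 = - h 1 by exact: hr.
rewrite -/(h 1) -/(h 3) -/(h 5) h3 h5 mulr0 add0r.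
rewrite (_ : rcos (pi * (1 * 5)%:R / (2 * 3)%:R) = - rcos (pi / 6) :> R[i]); last first.
  rewrite /rcos -rmorphN -[in RHS]cosN -cosDpi; congr ((cos _)%:C).
  by rewrite mul1n; field.
rewrite (_ : pi * (1 * 1)%:R / (2 * 3)%:R = pi / 6 :> R); last by rewrite mul1n mulr1.
rewrite (_ : eta (dual b) = h 1%N) // /v3 rmorphM rmorph_nat /= -/(rcos _).
by move: (rcos _) (h 1%N) => x y; ring.
Qed.

(* The factors in front of the theta series of U and V, of U*, and of V*. *)
Definition pplus b : R[i] := eta b / (eta (b / 2) * eta (2 * b)).
Definition pminus b : R[i] := eta (b / 2) / eta b ^+ 2.
Definition pminus2 b : R[i] := eta (2 * b) / eta b ^+ 2.

Lemma dualK b : dual (dual b) = b.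
Proof.
rewrite /dual invf_div mulrCA divff ?mulr1//.
by rewrite rmorphXn expf_neq0//; exact: pi_neq0.
Qed.

Lemma dual_half b : dual (b / 2) = 2 * dual b.
Proof. by rewrite /dual invf_div mulrCA. Qed.

Lemma dual_double b : dual (2 * b) = dual b / 2.
Proof. by rewrite /dual invfM mulrCA mulrC. Qed.

Lemma Re_half_gt0 b : 0 < Re b -> 0 < Re (b / 2).
Proof.
move=> b0; rewrite (_ : b / 2 = (2^-1)%:C * b) ?Re_mulr_real ?mulr_gt0//.
by rewrite fmorphV rmorph_nat mulrC.
Qed.

Lemma Re_double_gt0 b : 0 < Re b -> 0 < Re (2 * b).
Proof. by move=> b0; rewrite Re_mul_nat mulr_gt0. Qed.

Lemma real_neq0 (x : R) : 0 < x -> x%:C != 0 :> R[i].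
Proof. by move=> x0; rewrite -(rmorph0 (real_complex R)) (inj_eq (@complexI R)) gt_eqF. Qed.

Lemma gint_eta b : 0 < Re b ->
  [/\ v * gint (3 * b) = gint b, gint (3 * (b / 2)) = w * gint (3 * b)
    & gint (3 * (2 * b)) = w^-1 * gint (3 * b)].
Proof.
move=> b0; have b30 : 0 < Re (3 * b) by rewrite Re_mul_nat mulr_gt0.
have w0 := real_neq0 (w2_gt0 R); have v0 := real_neq0 v3_gt0; split.
- have := gint_scale b0 v3_gt0; rewrite v3_sqr rmorph_nat => ->.
  by rewrite fmorphV mulrA mulfV ?mul1r.
- have wi : 0 < (w2 R)^-1 by rewrite invr_gt0 w2_gt0.
  have := gint_scale b30 wi; rewrite exprVn w2_sqr invrK => <-; congr gint.
  by rewrite fmorphV rmorph_nat; field.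
have := gint_scale b30 (w2_gt0 R); rewrite w2_sqr fmorphV => <-; congr gint.
by rewrite rmorph_nat; ring.
Qed.

Section Duals.
Variable b : R[i].
Hypothesis b0 : 0 < Re b.

Let d0 := dual_gt0 b0.
Let e0 := eta_neq0 d0.
Let e1 : eta (dual b / 2) != 0. Proof. exact: eta_neq0 (Re_half_gt0 d0). Qed.
Let e2 : eta (2 * dual b) != 0. Proof. exact: eta_neq0 (Re_double_gt0 d0). Qed.
Let g0 : gint (3 * b) != 0. Proof. by apply: gint_neq0; rewrite Re_mul_nat mulr_gt0. Qed.
Let w0 := real_neq0 (w2_gt0 R).
Let v0 := real_neq0 v3_gt0.

Let etas : (eta b = v * gint (3 * b) * eta (dual b)) *
  (eta (b / 2) = v * (w * gint (3 * b)) * eta (2 * dual b)) *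
  (eta (2 * b) = v * (w^-1 * gint (3 * b)) * eta (dual b / 2)).
Proof.
have [_ g1 g2] := gint_eta b0; do !split; first exact: eta_dual.
  by rewrite (eta_dual (Re_half_gt0 b0)) g1 dual_half.
by rewrite (eta_dual (Re_double_gt0 b0)) g2 dual_double.
Qed.

(** Each [eta] contributes one factor [v * gint (3 * b)], which is [gint b]; the scalings of b/2 and
    2 b cancel here, but leave a factor [w] in the other two quotients. *)
Lemma pplus_dual : pplus b = pplus (dual b) / gint b.
Proof.
have [<- _ _] := gint_eta b0; rewrite /pplus !etas; move: e0 e1 e2 g0 w0 v0.
move: (eta _) (eta _) (eta _) (gint _) (w) (v) => x y z g u t *.
by field; do ?[apply/andP; split].
Qed.

Lemma pminus_dual : pminus b = w / gint b * pminus2 (dual b).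
Proof.
have [<- _ _] := gint_eta b0; rewrite /pminus /pminus2 !etas; move: e0 e1 e2 g0 w0 v0.
move: (eta (dual b)) (eta _) (gint _) (w) (v) => x y g u t *.
by field; do ?[apply/andP; split].
Qed.

Lemma pminus2_dual : pminus2 b = pminus (dual b) / (w * gint b).
Proof.
have [<- _ _] := gint_eta b0; rewrite /pminus /pminus2 !etas; move: e0 e1 e2 g0 w0 v0.
move: (eta (dual b)) (eta _) (gint _) (w) (v) => x y g u t *.
by field; do ?[apply/andP; split].
Qed.

End Duals.

Section Prefactors.
Variable b : R[i].
Hypothesis b0 : 0 < Re b.
Local Notation x := (ce (- b)).

Let x0 : x != 0. Proof. exact: ce_neq0. Qed.
Let x1 : nrm x < 1. Proof. exact: nrm_ceN_lt1. Qed.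
Let Ex : E x = ce (b / 24) * eta (b / 2).
Proof.
rewrite (eta_qinf (Re_half_gt0 b0)) mulrA -ceD (_ : b / 24 + - (b / 2) / 12 = 0) ?ce0 ?mul1r; last by field.
by rewrite -ceX (_ : 2 * - (b / 2) = - b)//; field.
Qed.
Let Ex2 : E (x ^+ 2) = ce (b / 12) * eta b.
Proof. by rewrite (eta_qinf b0) mulrA -ceD mulNr addrN ce0 mul1r. Qed.
Let Ex4 : E (x ^+ 4) = ce (b / 6) * eta (2 * b).
Proof.
rewrite (eta_qinf (Re_double_gt0 b0)) mulrA -ceD (_ : b / 6 + - (2 * b) / 12 = 0) ?ce0 ?mul1r; last by field.
by rewrite -!ceX (_ : 2 * - (2 * b) = 4 * - b)//; ring.
Qed.

Let e0 := eta_neq0 b0.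
Let e1 := eta_neq0 (Re_half_gt0 b0).
Let e2 := eta_neq0 (Re_double_gt0 b0).

Lemma prefactor_plus : qinf (x ^+ 2) (- x) / E (x ^+ 2) = pplus b * ce (- b / 8).
Proof.
rewrite (pref_plus x0 x1) Ex Ex2 Ex4 /pplus.
have -> : ce (b / 12) = ce (- b / 8) * (ce (b / 24) * ce (b / 6)) by rewrite -!ceD; congr ce; field.
move: e0 e1 e2 (ce_neq0 (b / 24)) (ce_neq0 (b / 6)) (ce_neq0 (- b / 8)).
move: (eta b) (eta _) (eta _) (ce _) (ce _) (ce _) => *; field; do ?[apply/andP; split] => //.
Qed.

Lemma prefactor_minus : qinf (x ^+ 2) x / E (x ^+ 2) = pminus b * ce (- b / 8).
Proof.
rewrite (pref_minus x0 x1) Ex Ex2 /pminus.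
have -> : ce (b / 24) = ce (- b / 8) * (ce (b / 12) * ce (b / 12)) by rewrite -!ceD; congr ce; field.
move: e0 e1 (ce_neq0 (b / 12)) (ce_neq0 (- b / 8)).
move: (eta b) (eta _) (ce _) (ce _) => *; field; do ?[apply/andP; split] => //.
Qed.

Lemma prefactor_minus2 : qinf (x ^+ 2) (- x ^+ 2) / E (x ^+ 2) = pminus2 b.
Proof.
rewrite (pref_minus_sq x0 x1) Ex2 Ex4 /pminus2.
have -> : ce (b / 6) = ce (b / 12) * ce (b / 12) by rewrite -!ceD; congr ce; field.
move: e0 e2 (ce_neq0 (b / 12)).
move: (eta b) (eta _) (ce _) => *; field; do ?[apply/andP; split] => //.
Qed.

End Prefactors.

End Eta.

(** * Series with exponent 11 r^2 + d r as alternating theta functions *)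

Section ThetaSeries.
Variable R : realType.
Variable be : R[i].
Hypothesis be0 : 0 < Re be.
Local Notation x := (ce (- be)).

Lemma thF_ath (d : nat) : thF x d = ce (be * d%:R ^+ 2 / 44) * ath (11 * be) (d%:R / 22).
Proof.
have a0 : 0 < Re (11 * be) by rewrite Re_mul_nat mulr_gt0.
rewrite /thF /ath -csumZ; last exact: csmb_ath.
apply: eq_csum => r; rewrite (mulrCA (ce _)); congr (_ * _).
rewrite -ceXz /gauss -ceD; congr ce; rewrite intrD !intrM -!pmulrn /=.
by move: (r%:~R) (d%:R) => u v; field.
Qed.

Lemma sg_even (k : int) : (-1) ^ (2 * k) = 1 :> R[i].
Proof. by rewrite -exprz_exp -exprnP sqrrN expr1n exp1rz. Qed.

Lemma sg_mul_odd (d : nat) (r : int) : odd d -> (-1) ^ (d%:Z * r) = (-1) ^ r :> R[i].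
Proof. by move=> od; rewrite -exprz_exp -exprnP -signr_odd od. Qed.

Lemma exp_i_even (n : int) : 'i ^ (2 * n) = (-1) ^ n :> R[i].
Proof. by rewrite -exprz_exp -exprnP sqrCi. Qed.

Lemma nrm_i : nrm ('i : R[i]) = 1.
Proof. by apply/eqP; rewrite -[_ == _](@eqrXn2 _ 2)// -?nrmX ?sqrCi ?nrmN ?nrm1 ?nrm_ge0// expr1n. Qed.

(* Splitting r by parity turns the period-4 signs i^(11 r^2 + d r) into two
   alternating series. *)
Lemma thF_pairth (d : nat) : odd d ->
  thF (x * 'i) d = ce (be * d%:R ^+ 2 / 44) * pairth (44 * be) d.
Proof.
move=> od; have a0 : 0 < Re (44 * be) by rewrite Re_mul_nat mulr_gt0.
have s0 : x * 'i != 0 :> R[i] by rewrite mulf_neq0 ?ce_neq0// neq0Ci.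
have s1 : nrm (x * 'i) < 1 by rewrite nrmM nrm_i mulr1 nrm_ceN_lt1.
have sf : csmb (fun r : int => (-1) ^ r * (x * 'i) ^ (11 * (r * r) + d%:Z * r)).
  by apply: (csmb_sg_pow (C := d%:Z * d%:Z)) => // r; nia.
have od2 : d = ((d./2).*2.+1)%N by rewrite -[LHS]odd_double_half od.
rewrite /thF (csum_fold (isT : (0 < 2)%N) sf) 2!big_ord_recl big_ord0 addr0 /pairth /pair44 mulrDr; congr (_ + _).
  rewrite /ath -csumZ; last exact: csmb_ath.
  apply: eq_csum => r; rewrite addr0 sg_even mul1r expfzMl.
  rewrite [X in 'i ^ X](_ : _ = 2 * (22 * (r * r) + d%:Z * r)); last by ring.
  rewrite exp_i_even sgD (sg_mul_odd _ od) (_ : 22 * (r * r) = 2 * (11 * (r * r))); last by ring.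
  rewrite sg_even mul1r mulrC (mulrCA (ce _)); congr (_ * _).
  rewrite -ceXz /gauss -ceD; congr ce; rewrite intrD !intrM -!pmulrn /=.
  by move: (r%:~R) (d%:R) => u v; field.
rewrite /ath mulrCA -csumZ; last exact: csmb_ath.
rewrite -csumZ; last exact: csmbZ (csmb_ath _ a0).
apply: eq_csum => r; rewrite (_ : nat_of_ord (lift ord0 ord0) = 1%N)// sgD sg_even mul1r expr1z expfzMl.
set E := (11 * _ + _).
(* i^E is (-1)^(E/2), so E/2 is split into even blocks, whose signs drop out, and the parts d r, (d
   + 1)/2 and 1 that determine the sign. *)
have eE : E = 2 * (d%:Z * r + ((d.+1./2)%:Z + 2 * (11 * (r * r) + 11 * r) + 2 * 2) + 1).
  have hd : d%:Z = 2 * (d./2)%:Z + 1 by rewrite {1}od2 -addn1 -mul2n PoszD PoszM.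
  have hd' : (d.+1./2)%:Z = (d./2)%:Z + 1 by rewrite {1}od2; lia.
  by rewrite hd' /E; move: hd; move: (d./2) => k hd; rewrite hd; ring.
have eI : 'i ^ E = - ((-1) ^+ minus d * (-1) ^ r) :> R[i].
  rewrite eE exp_i_even !sgD !sg_even (sg_mul_odd _ od) mulr1 mulr1 expr1z -exprnP -(signr_odd _ d.+1./2) -/(minus d).
  by move: (_ ^+ _) (_ ^ _) => s u; ring.
have eC : x ^ E = ce (be * d%:R ^+ 2 / 44) * gauss (44 * be) (r%:~R + (d + 22)%:R / 44).
  rewrite -ceXz /gauss -ceD; congr ce; rewrite /E !(intrD, intrM) -!pmulrn natrD /=.
  by move: (r%:~R) (d%:R) => u v; field.
by rewrite eI eC; ring.
Qed.

End ThetaSeries.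

(** * The components of the four vectors *)

Section Components.
Variable R : realType.
Variable tau : R[i].

Fact nome_spec : {b : R[i] | b = - ('i * pi%:C * tau)}.
Proof. by eexists. Qed.
Definition nome : R[i] := sval nome_spec.
Lemma nomeE : nome = - ('i * pi%:C * tau).
Proof. exact: (svalP nome_spec). Qed.

Lemma qpowE (r : rat) : qpow tau r = ce (- (2 * ratr r * nome)).
Proof. by rewrite /qpow -ceE; congr ce; rewrite nomeE; ring. Qed.

Hypothesis b0 : 0 < Re nome.
Local Notation b := nome.
Local Notation p := (qpow tau (1 / 2)).
Local Notation q := (qpow tau 1).

Lemma p_ce : p = ce (- b).
Proof. by rewrite qpowE fmorph_div rmorph1 rmorph_nat; congr ce; field. Qed.

Lemma q_ce : q = ce (- (2 * b)).
Proof. by rewrite qpowE rmorph1 mulr1. Qed.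

Lemma q_p : q = p ^+ 2.
Proof. by rewrite p_ce q_ce -(ceX 2) -mulrN. Qed.

(** The exponents of a component's power of q, of its prefactor and of the completed square add up
    to 0. For [Uvec] this explains the powers of q: they are (d^2 - 11)/176 for d = 1, 3, 5, 7,
    9. *)
Lemma ce_cancel (x y z P H : R[i]) : x + y + z = 0 -> ce x * ((P * ce y) * (ce z * H)) = P * H.
Proof.
move=> e; rewrite (_ : ce x * _ = ce x * ce y * ce z * (P * H)); last by ring.
by rewrite -!ceD e ce0 mul1r.
Qed.

Let p1 : nrm p < 1. Proof. by rewrite p_ce nrm_ceN_lt1. Qed.
Let p0 : p != 0. Proof. by rewrite p_ce ce_neq0. Qed.
Let b20 : 0 < Re (2 * b). Proof. exact: Re_double_gt0. Qed.
Let bh0 : 0 < Re (b / 2). Proof. exact: Re_half_gt0. Qed.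
Let q1 : nrm q < 1. Proof. by rewrite q_ce nrm_ceN_lt1. Qed.
Let q0 : q != 0. Proof. by rewrite q_ce ce_neq0. Qed.
Let n1 : nrm (1 : R[i]) <= 1. Proof. by rewrite nrm1. Qed.
Let qX1 n : nrm (q ^+ n) <= 1. Proof. exact: (nrm_expr_le1 n (ltW q1)). Qed.
Let q1' : nrm q <= 1. Proof. exact: ltW. Qed.

Lemma ratr_frac (m n : nat) : ratr (m%:R / n%:R) = m%:R / n%:R :> R[i].
Proof. by rewrite fmorph_div !rmorph_nat. Qed.

Lemma ratr_fracN (m n : nat) : ratr (- m%:R / n%:R) = - m%:R / n%:R :> R[i].
Proof. by rewrite fmorph_div rmorphN !rmorph_nat. Qed.

Lemma Uvec_uu : Uvec tau = pplus b *: uu (11 / 2 * b).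
Proof.
pose s := ce (- (b / 2)); have s0 : s != 0 by exact: ce_neq0.
have s1 : nrm s < 1 by exact: nrm_ceN_lt1.
have s2 : s ^+ 2 = p by rewrite p_ce -(ceX 2); congr ce; field.
have s4 : s ^+ 4 = q by rewrite q_p -s2 -exprM.
have e (d : nat) : thF s d = ce (b * d%:R ^+ 2 / 88) * ath (11 / 2 * b) (d%:R / 22).
  rewrite /s thF_ath//; congr (ce _ * ath _ _); last by field.
  by move: (d%:R) => x; field.
have c : qinf q (- p) / qinf q q = pplus b * ce (- b / 8) by rewrite q_p p_ce prefactor_plus.
have t1 := F_theta1 s0 s1; have t3 := F_theta3 s0 s1; have t5 := F_theta5 s0 s1.
have t7 := F_theta7 s0 s1; have t9 := F_theta9 s0 s1.
rewrite s4 s2 c in t1 t3 t5 t7 t9.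
have k1 : qpow tau (- 5 / 88) * F 1 1 1 p = pplus b * ath (11 / 2 * b) (1%:R / 22).
  by rewrite t1 (e 1%N : thF s 1 = _) qpowE ratr_fracN ce_cancel//; field.
have k3 : qpow tau (- 1 / 88) * F 1 1 q p = pplus b * ath (11 / 2 * b) (3%:R / 22).
  by rewrite t3 (e 3%N : thF s 3 = _) qpowE (ratr_fracN 1) ce_cancel//; field.
have k5 : qpow tau (7 / 88) * (F 1 q q p + q * F q (q ^+ 2) (q ^+ 3) p) = pplus b * ath (11 / 2 * b) (5%:R / 22).
  by rewrite t5 (e 5%N : thF s 5 = _) qpowE ratr_frac ce_cancel//; field.
have k7 : qpow tau (19 / 88) * F 1 q (q ^+ 2) p = pplus b * ath (11 / 2 * b) (7%:R / 22).
  by rewrite t7 (e 7%N : thF s 7 = _) qpowE ratr_frac ce_cancel//; field.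
have k9 : qpow tau (35 / 88) * F q q (q ^+ 2) p = pplus b * ath (11 / 2 * b) (9%:R / 22).
  by rewrite t9 (e 9%N : thF s 9 = _) qpowE ratr_frac ce_cancel//; field.
apply/matrixP => i j; rewrite !mxE {j}.
by case: i => [[|[|[|[|[|//]]]]] hi]; [exact: k1|exact: k3|exact: k5|exact: k7|exact: k9].
Qed.

Lemma Vvec_uu : Vvec tau = pplus (2 * b) *: uu (44 * b).
Proof.
have Q : q ^+ 2 = ce (- (4 * b)) by rewrite q_ce -(ceX 2); congr ce; ring.
have b40 : 0 < Re (4 * b) by rewrite Re_mul_nat mulr_gt0.
have e (d : nat) : thF (q ^+ 2) d = ce (b * d%:R ^+ 2 / 11) * ath (44 * b) (d%:R / 22).
  rewrite Q (thF_ath b40); congr (ce _ * ath _ _); last by ring.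
  by move: (d%:R) => x; field.
have c : qinf (q ^+ 2) (- q) / qinf (q ^+ 2) (q ^+ 2) = pplus (2 * b) * ce (- (2 * b) / 8).
  by rewrite q_ce prefactor_plus.
have t1 := V_theta1 q0 q1; have t3 := V_theta3 q0 q1; have t5 := V_theta5 q0 q1.
have t7 := V_theta7 q0 q1; have t9 := V_theta9 q0 q1.
rewrite c in t1 t3 t5 t7 t9.
have qn (n : nat) : q ^+ n = ce (- (n%:R * (2 * b))) by rewrite q_ce -ceX mulrN.
have k1 : qpow tau (- 7 / 88) * Gpar 0 1 1 1 q = pplus (2 * b) * ath (44 * b) (1%:R / 22).
  by rewrite t1 (e 1%N : thF _ 1 = _) qpowE ratr_fracN ce_cancel//; field.
have k3 : qpow tau (25 / 88) * (Gpar 0 q 1 1 q + Gpar 1 (q ^+ 3) (q ^+ 2) q q) = pplus (2 * b) * ath (44 * b) (3%:R / 22).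
  by rewrite t3 (e 3%N : thF _ 3 = _) qpowE ratr_frac ce_cancel//; field.
have k5 : qpow tau (1 / 88) * Gpar 1 1 1 q q = pplus (2 * b) * ath (44 * b) (5%:R / 22).
  by rewrite t5 (e 5%N : thF _ 5 = _) mulrA q_ce qpowE (ratr_frac 1) -ceD ce_cancel//; field.
have k7 : qpow tau (9 / 88) * Gpar 1 q 1 q q = pplus (2 * b) * ath (44 * b) (7%:R / 22).
  by rewrite t7 (e 7%N : thF _ 7 = _) mulrA qn qpowE ratr_frac -ceD ce_cancel//; field.
have k9 : qpow tau (49 / 88) * Gpar 1 (q ^+ 2) (q ^+ 2) q q = pplus (2 * b) * ath (44 * b) (9%:R / 22).
  by rewrite t9 (e 9%N : thF _ 9 = _) mulrA qn qpowE ratr_frac -ceD ce_cancel//; field.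
apply/matrixP => i j; rewrite !mxE {j}.
by case: i => [[|[|[|[|[|//]]]]] hi]; [exact: k1|exact: k3|exact: k5|exact: k7|exact: k9].
Qed.

Lemma Ustar_su : Ustar tau = pminus b *: su (22 * b).
Proof.
(* The factor i realises q^(1/2) -> - q^(1/2): s^2 changes sign while s^4 = q does not. *)
pose s := ce (- (b / 2)) * 'i; have s2 : s ^+ 2 = - p.
  by rewrite exprMn sqrCi mulrN1 p_ce -(ceX 2); congr (- ce _); field.
have s4 : s ^+ 4 = q by rewrite (exprM s 2 2) s2 sqrrN q_p.
have s0 : s != 0 by rewrite mulf_neq0 ?ce_neq0// neq0Ci.
have s1 : nrm s < 1 by rewrite nrmM nrm_i mulr1 nrm_ceN_lt1.
have e (d : nat) : odd d -> thF s d = ce (b * d%:R ^+ 2 / 88) * pairth (22 * b) d.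
  move=> od; rewrite /s thF_pairth//; congr (ce _ * pairth _ _); last by field.
  by move: (d%:R) => x; field.
have c : qinf q p / qinf q q = pminus b * ce (- b / 8) by rewrite q_p p_ce prefactor_minus.
have t1 := F_theta1 s0 s1; have t3 := F_theta3 s0 s1; have t5 := F_theta5 s0 s1.
have t7 := F_theta7 s0 s1; have t9 := F_theta9 s0 s1.
rewrite s4 s2 opprK c in t1 t3 t5 t7 t9.
have sub2 (y A B C : R[i]) : 2 * A = B + C -> 2 * (y * A) - y * B = y * C.
  by move=> h; rewrite (mulrCA 2 y A) h; ring.
have k1 : 2 * (qpow tau (- 5 / 88) * Fpar 0 1 1 1 p) - qpow tau (- 5 / 88) * F 1 1 1 p = pminus b * pairth (22 * b) 1.
  rewrite (sub2 _ _ _ _ (Fpar0 p0 p1 n1 n1 n1)).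
  by rewrite t1 (e 1%N isT : thF s 1 = _) qpowE ratr_fracN ce_cancel//; field.
have k3 : 2 * (qpow tau (- 1 / 88) * Fpar 1 1 1 q p) - qpow tau (- 1 / 88) * F 1 1 q p = pminus b * - pairth (22 * b) 3.
  rewrite (sub2 _ _ _ _ (Fpar1 p0 p1 n1 n1 q1')) (mulrN (pminus b)) (mulrN (qpow tau _)); congr (- _).
  by rewrite t3 (e 3%N isT : thF s 3 = _) qpowE (ratr_fracN 1) ce_cancel//; field.
have k5 : 2 * (qpow tau (7 / 88) * (Fpar 1 1 q q p + q * Fpar 1 q (q ^+ 2) (q ^+ 3) p)) -
    qpow tau (7 / 88) * (F 1 q q p + q * F q (q ^+ 2) (q ^+ 3) p) = pminus b * - pairth (22 * b) 5.
  have h : 2 * (Fpar 1 1 q q p + q * Fpar 1 q (q ^+ 2) (q ^+ 3) p) =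
      (F 1 q q p + q * F q (q ^+ 2) (q ^+ 3) p) + - (F 1 q q (- p) + q * F q (q ^+ 2) (q ^+ 3) (- p)).
    rewrite mulrDr (Fpar1 p0 p1 n1 q1' q1') (mulrCA 2 q) (Fpar1 p0 p1 q1' (qX1 2) (qX1 3)).
    by move: (F _ _ _ _) (F _ _ _ _) (F _ _ _ _) (F _ _ _ _) => *; ring.
  rewrite (sub2 _ _ _ _ h) (mulrN (pminus b)) (mulrN (qpow tau _)); congr (- _).
  by rewrite t5 (e 5%N isT : thF s 5 = _) qpowE ratr_frac ce_cancel//; field.
have k7 : 2 * (qpow tau (19 / 88) * Fpar 0 1 q (q ^+ 2) p) - qpow tau (19 / 88) * F 1 q (q ^+ 2) p = pminus b * pairth (22 * b) 7.
  rewrite (sub2 _ _ _ _ (Fpar0 p0 p1 n1 q1' (qX1 2))).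
  by rewrite t7 (e 7%N isT : thF s 7 = _) qpowE ratr_frac ce_cancel//; field.
have k9 : 2 * (qpow tau (35 / 88) * Fpar 0 q q (q ^+ 2) p) - qpow tau (35 / 88) * F q q (q ^+ 2) p = pminus b * pairth (22 * b) 9.
  rewrite (sub2 _ _ _ _ (Fpar0 p0 p1 q1' q1' (qX1 2))).
  by rewrite t9 (e 9%N isT : thF s 9 = _) qpowE ratr_frac ce_cancel//; field.
apply/matrixP => i j; rewrite !mxE {j}.
by case: i => [[|[|[|[|[|//]]]]] hi]; [exact: k1|exact: k3|exact: k5|exact: k7|exact: k9].
Qed.

Lemma Vstar_sv : Vstar tau = pminus2 (2 * b) *: sv (44 * b).
Proof.
pose s := ce (- b) * 'i; have s2 : s ^+ 2 = - q by rewrite exprMn sqrCi mulrN1 q_p p_ce.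
have s4 : s ^+ 4 = q ^+ 2 by rewrite (exprM s 2 2) s2 sqrrN.
have e (d : nat) : odd d -> thF s d = ce (b * d%:R ^+ 2 / 44) * pairth (44 * b) d.
  by move=> od; rewrite /s thF_pairth.
have c : qinf (q ^+ 2) (- q ^+ 2) / qinf (q ^+ 2) (q ^+ 2) = pminus2 (2 * b).
  by rewrite q_ce prefactor_minus2.
have t1 := Vstar_theta1 q0 q1 s2; have t3 := Vstar_theta3 q0 q1 s2; have t5 := Vstar_theta5 q0 q1 s2.
have t7 := Vstar_theta7 q0 q1 s2; have t9 := Vstar_theta9 q0 q1 s2.
rewrite c in t1 t3 t5 t7 t9.
have cancel (x z P H : R[i]) : x + z = 0 -> ce x * (P * (ce z * H)) = P * H.
  by move=> xz; rewrite mulrCA (mulrA (ce x)) -ceD xz ce0 mul1r.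
have k9 : qpow tau (- 7 / 88) * G 1 1 1 q - qpow tau (- 7 / 88) * Gpar 0 1 1 1 q = pminus2 (2 * b) * pairth (44 * b) 9.
  rewrite -mulrBr (Gpar_sum q0 q1 n1 n1 n1) addrC addKr t9 (e 9%N isT : thF s 9 = _).
  rewrite qpowE ratr_fracN; set x := ce (- (2 * _ * _)); rewrite q_ce (mulrA x) /x -ceD cancel//.
  by field.
have k5 : qpow tau (25 / 88) * (G q 1 1 q + G (q ^+ 3) (q ^+ 2) q q) -
    qpow tau (25 / 88) * (Gpar 0 q 1 1 q + Gpar 1 (q ^+ 3) (q ^+ 2) q q) = pminus2 (2 * b) * pairth (44 * b) 5.
  rewrite -mulrBr (Gpar_sum q0 q1 q1' n1 n1) (Gpar_sum q0 q1 (qX1 3) (qX1 2) q1').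
  have cross (x y z u : R[i]) : x + y + (z + u) - (x + u) = y + z by ring.
  rewrite cross.
  by rewrite t5 (e 5%N isT : thF s 5 = _) qpowE ratr_frac cancel//; field.
have k1 : qpow tau (1 / 88) * G 1 1 q q - qpow tau (1 / 88) * Gpar 1 1 1 q q = pminus2 (2 * b) * pairth (44 * b) 1.
  rewrite -mulrBr (Gpar_sum q0 q1 n1 n1 q1') addrK t1 (e 1%N isT : thF s 1 = _).
  by rewrite qpowE (ratr_frac 1) cancel//; field.
have k3 : qpow tau (9 / 88) * G q 1 q q - qpow tau (9 / 88) * Gpar 1 q 1 q q = pminus2 (2 * b) * pairth (44 * b) 3.
  rewrite -mulrBr (Gpar_sum q0 q1 q1' n1 q1') addrK t3 (e 3%N isT : thF s 3 = _).
  by rewrite qpowE ratr_frac cancel//; field.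
have k7 : qpow tau (49 / 88) * G (q ^+ 2) (q ^+ 2) q q - qpow tau (49 / 88) * Gpar 1 (q ^+ 2) (q ^+ 2) q q = pminus2 (2 * b) * pairth (44 * b) 7.
  rewrite -mulrBr (Gpar_sum q0 q1 (qX1 2) (qX1 2) q1') addrK t7 (e 7%N isT : thF s 7 = _).
  by rewrite qpowE ratr_frac cancel//; field.
apply/matrixP => i j; rewrite !mxE {j}.
by case: i => [[|[|[|[|[|//]]]]] hi]; [exact: k9|exact: k5|exact: k1|exact: k3|exact: k7].
Qed.

End Components.

Lemma nome_inversion (K : numFieldType) (i p x : K) : i * i = -1 -> p != 0 -> x != 0 ->
  2 * - (i * p * (- 1 / (2 * x))) = p ^+ 2 / - (i * p * x).
Proof.
move=> i2 p0 x0; have i0 : i != 0.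
  by apply/eqP => e; move/eqP: i2; rewrite e mulr0 eq_sym oppr_eq0 oner_eq0.
have n0 : - (i * p * x) != 0 by rewrite oppr_eq0 !mulf_neq0.
apply: (mulIf n0); rewrite divfK//.
rewrite [LHS](_ : _ = - (i * i) * p ^+ 2); last by field.
by rewrite i2 opprK mul1r.
Qed.

(** * The transformation under tau -> - 1/(2 tau) *)

Section Transformation.
Variable R : realType.
Implicit Types B : R[i].
Local Notation t := ((t11 R)%:C).
Local Notation w := ((w2 R)%:C).
Local Notation S := (Smx R).

Let t0 : t != 0. Proof. exact: real_neq0 (t11_gt0 R). Qed.
Let w0 : w != 0. Proof. exact: real_neq0 (w2_gt0 R). Qed.
Let tt : t * t = 11 / 2 :> R[i].
Proof. by rewrite -rmorphM /= -expr2 t11_sqr fmorph_div !rmorph_nat. Qed.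
Let ww : w * w = 2 :> R[i].
Proof. by rewrite -rmorphM /= -expr2 w2_sqr rmorph_nat. Qed.

Lemma gint_half11 B : 0 < Re B -> gint (11 / 2 * B) = t^-1 * gint B.
Proof.
move=> B0; have := gint_scale B0 (t11_gt0 R); rewrite t11_sqr fmorphV => <-; congr gint.
by rewrite fmorph_div !rmorph_nat.
Qed.

Lemma gint_22 B : 0 < Re B -> gint (22 * B) = (2 * t)^-1 * gint B.
Proof.
move=> B0; have p : 0 < 2 * t11 R by rewrite mulr_gt0// t11_gt0.
have := gint_scale B0 p; rewrite exprMn t11_sqr.
rewrite (_ : ((2 * t11 R)^-1)%:C = (2 * t)^-1); last by rewrite fmorphV rmorphM rmorph_nat.
move=> <-; congr gint.
by rewrite (_ : 2 ^+ 2 * (11 / 2) = 22 :> R) ?rmorph_nat//; field.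
Qed.

Lemma Re_22 B : 0 < Re B -> 0 < Re (22 * B).
Proof. by move=> B0; rewrite Re_mul_nat mulr_gt0. Qed.

Lemma Re_half11 B : 0 < Re B -> 0 < Re (11 / 2 * B).
Proof. by move=> B0; rewrite mulrAC; apply: Re_half_gt0; rewrite Re_mul_nat mulr_gt0. Qed.

Lemma scale_dual (k : R[i]) B : dual (k * dual B) = k^-1 * B.
Proof. by rewrite -[in RHS](dualK B) /dual invfM mulrCA. Qed.

(** Where S and 2 S part ways: [uu_dual] brings 2 t, which [gint (22 * B)] cancels through 1/(2 t),
    whereas [gint (11 / 2 * B)] only brings 1/t. *)
Lemma V_dual B : 0 < Re B ->
  pplus (dual B) *: uu (22 * dual B) = S *m (pplus B *: uu (11 / 2 * B)).
Proof.
move=> B0; have d0 := dual_gt0 B0; have g0 := gint_neq0 d0.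
rewrite (uu_dual (Re_22 d0)) gint_22// scale_dual (pplus_dual d0) dualK scalerA -scalemxAr.
congr (_ *: (_ *m uu _)); last by field.
by move: t0 g0; move: (gint _) (t) => g u *; field; do ?[apply/andP; split].
Qed.

Lemma U_dual B : 0 < Re B ->
  pplus (dual B) *: uu (11 / 2 * dual B) = (2 *: S) *m (pplus B *: uu (22 * B)).
Proof.
move=> B0; have d0 := dual_gt0 B0; have g0 := gint_neq0 d0.
rewrite (uu_dual (Re_half11 d0)) gint_half11// scale_dual (pplus_dual d0) dualK scalerA -scalemxAr -scalemxAl scalerA.
congr (_ *: (_ *m uu _)); last by field.
by move: t0 g0; move: (gint _) (t) => g u *; field; do ?[apply/andP; split].
Qed.

Lemma Vstar_dual B : 0 < Re B ->
  pminus2 (dual B) *: sv (22 * dual B) = S *m (pminus B *: su (22 * B)).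
Proof.
move=> B0; have d0 := dual_gt0 B0; have g0 := gint_neq0 d0.
rewrite (sv_dual (Re_22 d0)) gint_22// scale_dual (pminus2_dual d0) dualK scalerA -scalemxAr.
congr (_ *: (_ *m su _)); last by field.
by move: t0 w0 g0; move: (gint _) (t) (w) => g u v *; field; do ?[apply/andP; split].
Qed.

(** The integrals now leave the same scalar in both directions; the factor 2 arises as [w * w], one
    [w] coming from [su_dual] and one from [pminus_dual]. *)
Lemma Ustar_dual B : 0 < Re B ->
  pminus (dual B) *: su (22 * dual B) = (2 *: S) *m (pminus2 B *: sv (22 * B)).
Proof.
move=> B0; have d0 := dual_gt0 B0; have g0 := gint_neq0 d0.
rewrite (su_dual (Re_22 d0)) gint_22// scale_dual (pminus_dual d0) dualK scalerA -scalemxAr -scalemxAl scalerA.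
congr (_ *: (_ *m sv _)); last by field.
rewrite (_ : w / gint (dual B) * _ * _ = w * w * pminus2 B); first by rewrite ww mulrC.
by move: t0 g0; move: (gint _) (t) (w) => g u v *; field; do ?[apply/andP; split].
Qed.

End Transformation.

Theorem theorem1p6 (R : realType) (tau : R[i]) (tau_gt0 : 0 < complex.Im tau) :
  [/\ Vvec (- 1 / (2 * tau)) = Smx R *m Uvec tau
    & Uvec (- 1 / (2 * tau)) = (2 *: Smx R) *m Vvec tau]
  /\ [/\ Vstar (- 1 / (2 * tau)) = Smx R *m Ustar tau
       & Ustar (- 1 / (2 * tau)) = (2 *: Smx R) *m Vstar tau]
  /\ [/\ gvee (- 1 / (2 * tau)) = (2 *: Smx R) *m gvec tau
       & gvec (- 1 / (2 * tau)) = Smx R *m gvee tau].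
Proof.
set tau' := - 1 / (2 * tau).
have tn : tau != 0 by apply/eqP => e; move: tau_gt0; rewrite e ltxx.
pose B := nome tau.
have B0 : 0 < Re B.
  rewrite /B nomeE (_ : - ('i * pi%:C * tau) = pi%:C * - ('i * tau)); last by ring.
  by rewrite Re_mulr_real mulr_gt0 ?pi_gt0//; case: (tau) tau_gt0 => x y /=; lra.
have eB : 2 * nome tau' = dual B.
  rewrite /dual /B !nomeE /tau' rmorphXn /=.
  by apply: nome_inversion => //; [rewrite -expr2 sqrCi|exact: pi_neq0].
have B0' : 0 < Re (nome tau').
  by rewrite (_ : nome tau' = dual B / 2) ?Re_half_gt0 ?dual_gt0// -eB; field.
have B20 := Re_double_gt0 B0.
have e2 : nome tau' = dual (2 * B) by rewrite dual_double -eB; field.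
have [EV EU] : Vvec tau' = Smx R *m Uvec tau /\ Uvec tau' = (2 *: Smx R) *m Vvec tau.
  split.
    rewrite (Vvec_uu B0') (Uvec_uu B0) -V_dual// -eB; congr (_ *: uu _); ring.
  rewrite (Uvec_uu B0') (Vvec_uu B0) e2 U_dual//; congr (_ *m (_ *: uu _)); rewrite -/B; ring.
have [EVs EUs] : Vstar tau' = Smx R *m Ustar tau /\ Ustar tau' = (2 *: Smx R) *m Vstar tau.
  split.
    rewrite (Vstar_sv B0') (Ustar_su B0) -Vstar_dual// -eB; congr (_ *: sv _); ring.
  rewrite (Ustar_su B0') (Vstar_sv B0) e2 Ustar_dual//; congr (_ *m (_ *: sv _)); rewrite -/B; ring.
split; first exact: (conj EV EU).
split; first exact: (conj EVs EUs).
have gv (x : R[i]) : gvee x = Vvec x + Vstar x by rewrite /Vstar addrC subrK.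
have g2 (x : R[i]) : 2 *: gvec x = Uvec x + Ustar x by rewrite /Ustar addrC subrK.
split.
  by rewrite gv EV EVs -mulmxDr -g2 -scalemxAr -scalemxAl.
have two : 2 != 0 :> R[i] by rewrite pnatr_eq0.
apply: (scalerI two); by rewrite g2 EU EUs -mulmxDr -gv -scalemxAl.
Qed.
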